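(* Let $I=[\alpha_0,\alpha_1]\subset(0,1)$ be a compact interval, $\varphi\in L^2(0,L)$, and $x_*\in(0,L)$. If $$(\mathcal{A}^{-1}\varphi)(x_* )\ne0,$$ then there exists $T_I>1$ such that, for every $t_0\ge T_I$ and every $d_0\in\mathbb{R}$, the equation $u_\alpha(t_0,x_* )=d_0$ has at most one solution $\alpha\in I$. The map $I\ni\alpha\mapsto u_\alpha(t_0,x_* )$ is decreasing for large $t_0$ if $(\mathcal{A}^{-1}\varphi)(x_* )>0$, and increasing for large $t_0$ if $(\mathcal{A}^{-1}\varphi)(x_* )<0$.
   Context: Let $L>0$, $\kappa>0$, $q\ge0$, and let $\mathcal{A}=-\kappa\frac{d^2}{dx^2}+q$ on $L^2(0,L)$ with domain $H^2(0,L)\cap H_0^1(0,L)$. Its eigenpairs are $\lambda_n=\kappa(n\pi/L)^2+q$, $v_n(x)=\sqrt{2/L}\,\sin(n\pi x/L)$, $n\ge1$. For $\alpha\in(0,1)$ and $\varphi\in L^2(0,L)$, $u_\alpha$ is the mild solution of the Caputo problem $\partial_t^\alpha u-\kappa u_{xx}+qu=0$ for $t>0$, $0<x<L$, with $u(t,0)=u(t,L)=0$ and $u(0,x)=\varphi(x)$, given by $u_\alpha(t,x)=\sum_{n=1}^\infty\varphi_nE_{\alpha,1}(-\lambda_nt^\alpha)v_n(x)$, $\varphi_n=\int_0^L\varphi v_n\,dx$, where $E_{\alpha,1}(z)=\sum_{i\ge0}z^i/\Gamma(\alpha i+1)$. For $t>0$, $u_\alpha(t,\cdot)\in\operatorname{Dom}(\mathcal{A})$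 has a continuous representative, and $u_\alpha(t,x_* )$ is its value at $x_*$. Likewise $\mathcal{A}^{-1}\varphi\in H^2(0,L)\cap H^1_0(0,L)$ is identified with its continuous representative. *)

(* Defs.v *)
From HB Require Import structures.
From mathcomp Require Import all_boot all_order all_algebra.
From mathcomp Require Import all_classical all_reals all_analysis.

Set Implicit Arguments.
Unset Strict Implicit.
Unset Printing Implicit Defensive.
Import Order.TTheory GRing.Theory Num.Theory.
Import numFieldNormedType.Exports.

Local Open Scope classical_set_scope.
Local Open Scope ring_scope.

(* Elements of L^2(0,L) are handled through representatives R -> R: the values
   outside ]0, L[ are irrelevant (hence the restriction f \_ `]0, L[), and
   equality of classes is [ae_eq] on ]0, L[. *)

Definition L2 (R : realType) (L : R) : set (R -> R) :=
  [set f : R -> R | (f \_ `]0, L[) \in Lfun (@lebesgue_measure R) 2%:E].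

Definition L2norm (R : realType) (L : R) (f : R -> R) : \bar R :=
  Lnorm (@lebesgue_measure R) 2%:E (EFin \o (f \_ `]0, L[)).

(* C^1_c(0,L), extended by 0 to the whole line.  As in Brezis, "Functional
   Analysis, Sobolev Spaces and PDE", chapter 8, this is the space of test
   functions used for the weak derivative and for the definition of H^1_0 in
   dimension one. *)
Definition C1c (R : realType) (L : R) : set (R -> R) :=
  [set psi : R -> R |
    [/\ forall x, derivable psi x 1,
        continuous (derive1 psi) &
        exists K : set R, [/\ compact K, K `<=` `]0, L[ &
          forall x, ~ K x -> psi x = 0]]].

Definition weak_deriv (R : realType) (L : R) (f g : R -> R) : Prop :=
  [/\ L2 L f, L2 L g &
      forall psi, C1c L psi ->
        \int[@lebesgue_measure R]_(x in `]0, L[) (f x * derive1 psi x) =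
        - \int[@lebesgue_measure R]_(x in `]0, L[) (g x * psi x)].

Definition H1 (R : realType) (L : R) : set (R -> R) :=
  [set f | exists g, weak_deriv L f g].

Definition H2 (R : realType) (L : R) : set (R -> R) :=
  [set f | exists2 g, weak_deriv L f g & H1 L g].

(* closure of C^1_c(0,L) in H^1(0,L) *)
Definition H10 (R : realType) (L : R) : set (R -> R) :=
  [set f | exists2 g, weak_deriv L f g &
     forall e : R, 0 < e -> exists psi, [/\ C1c L psi,
       (L2norm L (fun x => f x - psi x)%R < e%:E)%E &
       (L2norm L (fun x => g x - derive1 psi x)%R < e%:E)%E]].

Definition domA (R : realType) (L : R) : set (R -> R) := H2 L `&` H10 L.

(* w lies in the domain of A = - kappa d^2/dx^2 + q, and A w = f in L^2(0,L) *)
Definition graphA (R : realType) (L kappa q : R) (w f : R -> R) : Prop :=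
  domA L w /\
  exists w1 w2, [/\ weak_deriv L w w1, weak_deriv L w1 w2 &
    ae_eq (@lebesgue_measure R) [set` `]0, L[] f
      (fun x => - kappa * w2 x + q * w x)].

(* The representative of A^{-1} f that is continuous on [0,L]; it is unique on
   [0,L], and its values elsewhere are unspecified. *)
Definition invA (R : realType) (L kappa q : R) (f : R -> R) : R -> R :=
  xget (fun=> 0)
    [set w | {within `[0, L], continuous w} /\ graphA L kappa q w f].

Definition eigval (R : realType) (L kappa q : R) (n : nat) : R :=
  kappa * (n%:R * pi / L) ^+ 2 + q.

Definition eigfun (R : realType) (L : R) (n : nat) (x : R) : R :=
  Num.sqrt (2 / L) * sin (n%:R * pi * x / L).

Definition coef (R : realType) (L : R) (phi : R -> R) (n : nat) : R :=
  \int[@lebesgue_measure R]_(x in `]0, L[) (phi x * eigfun L n x).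

Definition Gamma (R : realType) (x : R) : R :=
  \int[@lebesgue_measure R]_(t in `]0, +oo[) (t `^ (x - 1) * expR (- t)).

(* Mittag-Leffler function E_{alpha,beta} *)
Definition mittag_leffler (R : realType) (alpha beta z : R) : R :=
  limn (series (fun i : nat => z ^+ i / Gamma (alpha * i%:R + beta))).

Definition mild_partial_sum (R : realType) (L kappa q : R) (phi : R -> R)
    (alpha t : R) (N : nat) (x : R) : R :=
  \sum_(1 <= n < N.+1)
    coef L phi n * mittag_leffler alpha 1 (- eigval L kappa q n * t `^ alpha)
    * eigfun L n x.

(* The series defining u_alpha(t, .) converges in L^2(0,L); u_alpha(t, .) is
   the representative of its sum that is continuous on [0,L] (unique there). *)
Definition mild_solution (R : realType) (L kappa q : R) (phi : R -> R)
    (alpha t : R) : R -> R :=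
  xget (fun=> 0)
    [set U : R -> R | {within `[0, L], continuous U} /\
      L2norm L (fun x => U x - mild_partial_sum L kappa q phi alpha t N x)
        @[N --> \oo] --> 0%E].

(* Main.v *)
Require Import Defs.
From HB Require Import structures.
From mathcomp Require Import all_boot all_order all_algebra.
From mathcomp Require Import all_classical all_reals all_analysis.
From mathcomp Require Import measurable_realfun ring lra.
Set Implicit Arguments.
Unset Strict Implicit.
Unset Printing Implicit Defensive.
Import Order.TTheory GRing.Theory Num.Theory.
Import numFieldNormedType.Exports.

Local Open Scope classical_set_scope.
Local Open Scope ring_scope.

Local Notation mu := (@lebesgue_measure _).
Local Notation Rpos R := (`]0%R, +oo[%classic : set R).

(** Why the theorem is true.  Let v_n be the eigenfunctions, lam_n the eigenvalues
    and phi_n the coefficients of the initial value.  For fixed order a in (0,1),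
    the Mittag-Leffler function decays only algebraically on the negative axis,
    E_a(-x) ~ 1 / (Gamma(1 - a) x), so that

      u_a(t, x) ~ t^(-a) / Gamma(1 - a) * sum_n phi_n / lam_n v_n(x)
                = t^(-a) / Gamma(1 - a) * (A^-1 phi)(x)

    for large t.  The prefactor t^(-a) decreases in a at the logarithmic rate ln t,
    which for t large dominates the variation in a of all that remains.  To make this
    rigorous one needs the asymptotics of E_a together with a Lipschitz bound in a,
    both uniform on compact intervals of orders.

    Both follow from the exact formula [ml_representation],

      E_a(-x) = N_a(1/x) / x,
      N_a(xi) = sin(a pi)/pi * int_0^oo t^(a-1) e^(-t)
                               / (1 + 2 t^a xi cos(a pi) + t^(2a) xi^2) dt,

    in which N_a(xi), called [ml_profile], is Lipschitz in (a, xi) up to xi = 0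
    ([ml_profile_lip]) and N_a(0) is bounded below ([ml_profile0_ge]).  So
    u_a(t, x) = t^(-a) * sum_n b_n N_a(t^(-a) / lam_n) with b_n = phi_n v_n(x) / lam_n
    ([mild_solution_value]), and [mode_sum_decreasing] carries out the argument
    above.

    The formula itself is proved by comparing Laplace transforms in t of the two
    sides at x = t^a.  That of E_a(-t^a) is computed termwise ([ml_laplace]).  By
    Tonelli's theorem, that of the right-hand side is the Stieltjes transform of the
    jump of z^a / (1 + z^a) across the negative axis ([laplace_ml_integral]), and
    Cauchy's integral formula evaluates it ([stieltjes]).  Here holomorphic functions
    are pairs of real functions of the polar coordinates that satisfy the
    Cauchy-Riemann equations, and the contour is the boundary of a polar rectangle,
    whose lower side is pushed to the positive axis, where the pole p contributes
    pi times the value at p through a Poisson kernel.  Uniqueness is the theorem of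
    Lerch ([lerch]).

    On the side of the interval it remains to identify the two continuous
    representatives.  The coefficients of A^-1 phi are phi_n / lam_n ([graphA_coef]):
    integrate by parts twice against v_n, which the definition of weak derivatives
    by compactly supported test functions permits after a cutoff.  The series for
    u_a(t, .) converges uniformly, and a continuous function is determined by its
    sine coefficients ([coef_inj]); the latter, like Lerch's theorem, rests on
    testing against powers of a kernel that concentrate at a point
    ([concentration]). *)

(** * Integration and elementary estimates on the half-line *)

Section Toolbox.
Context {R : realType}.
Implicit Types (f g F : R -> R) (D : set (measurableTypeR R)).

Lemma is_derive_continuous f (x d : R) : is_derive x 1 f d -> {for x, continuous f}.
Proof. by move=> df; apply/differentiable_continuous/derivable1_diffP. Qed.

Lemma le_integrableR D f g : measurable D -> measurable_fun D f ->
  (forall x : R, D x -> `|f x| <= g x) -> mu.-integrable D (EFin \o g) ->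
  mu.-integrable D (EFin \o f).
Proof.
move=> mD mf fg ig; apply: le_integrable ig => //.
  exact/measurable_EFinP.
by move=> x Dx /=; rewrite lee_fin (le_trans (fg _ Dx))// ler_norm.
Qed.

Lemma integrableZR D k f : measurable D -> mu.-integrable D (EFin \o f) ->
  mu.-integrable D (EFin \o (fun x => k * f x)).
Proof. by move=> mD h; have := integrableZl mD k h. Qed.

Lemma integrableDR D f g : measurable D -> mu.-integrable D (EFin \o f) ->
  mu.-integrable D (EFin \o g) ->
  mu.-integrable D (EFin \o (fun x => f x + g x)).
Proof. by move=> mD h1 h2; have := integrableD mD h1 h2. Qed.

Lemma integrableBR D f g : measurable D -> mu.-integrable D (EFin \o f) ->
  mu.-integrable D (EFin \o g) ->
  mu.-integrable D (EFin \o (fun x => f x - g x)).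
Proof. by move=> mD h1 h2; have := integrableB mD h1 h2. Qed.

Lemma measurable_Rpos : measurable (Rpos R : set (measurableTypeR R)).
Proof. exact: measurable_itv. Qed.

Lemma Rdominated_cvg D (f_ : (R -> R)^nat) f g : measurable D ->
  (forall n, measurable_fun D (f_ n)) ->
  (forall x : R, D x -> f_ n x @[n --> \oo] --> f x) ->
  (forall n x, D x -> `|f_ n x| <= g x) ->
  mu.-integrable D (EFin \o g) ->
  mu.-integrable D (EFin \o f) /\
  (\int[mu]_(x in D) f_ n x)%R @[n --> \oo] --> (\int[mu]_(x in D) f x)%R.
Proof.
move=> mD mf ff fg ig.
have mlim : measurable_fun D f by apply: (measurable_fun_cvg (h := f_)).
have cE x : D x -> (f_ n x)%:E @[n --> \oo] --> (f x)%:E.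
  by move=> Dx; apply: cvg_EFin; [exact: nearW|exact: ff].
have mfE n : measurable_fun D (EFin \o f_ n) by exact/measurable_EFinP.
have mlE : measurable_fun D (EFin \o f) by exact/measurable_EFinP.
have [||i1 _ i2] := @dominated_convergence _ _ _ mu D mD (fun n => EFin \o f_ n)
  (EFin \o f) (EFin \o g) mfE mlE _ ig.
- by apply: aeW => x; exact: cE.
- by apply: aeW => x n Dx; rewrite /= lee_fin fg.
split=> //; apply: fine_cvg; rewrite fineK//; exact: integrable_fin_num.
Qed.

Lemma near_oo_inv (x : R) : 0 < x -> \forall n \near \oo, n.+1%:R^-1 <= x <= n.+1%:R.
Proof.
move=> x0; near=> n; apply/andP; split.
  rewrite -[leRHS]invrK lef_pV2 ?posrE ?invr_gt0//.
  rewrite (le_trans (ltW (truncnS_gt _)))// ler_nat ltnS.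
  near: n; exact: nbhs_infty_ge.
rewrite (le_trans (ltW (truncnS_gt _)))// ler_nat ltnS.
near: n; exact: nbhs_infty_ge.
Unshelve. all: end_near. Qed.

Lemma bigcup_itv_oy (c : R) : 0 < c ->
  \bigcup_n `[c / n.+1%:R, c * n.+1%:R]%classic = Rpos R.
Proof.
move=> c0; apply/seteqP; split => x /=.
  move=> [n _] /=; rewrite !in_itv/= andbT => /andP[h _].
  by rewrite (lt_le_trans _ h)// divr_gt0.
rewrite in_itv/= andbT => x0.
have [n _ /(_ n)] : \forall n \near \oo, n.+1%:R^-1 <= x / c <= n.+1%:R.
  by apply: near_oo_inv; rewrite divr_gt0.
rewrite /= leqnn => /(_ isT)/andP[h1 h2]; exists n => //=.
rewrite in_itv/=; apply/andP; split.
  by rewrite mulrC -ler_pdivlMr.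
by rewrite mulrC -ler_pdivrMr.
Qed.

Lemma nondecreasing_itv_oy (c : R) : 0 < c ->
  nondecreasing_seq (fun n : nat => `[c / n.+1%:R, c * n.+1%:R]%classic : set R).
Proof.
move=> c0 m n mn; apply/subsetPset; apply: subset_itv; rewrite bnd_simp.
  by rewrite ler_pM2l// lef_pV2 ?posrE// ler_nat.
by rewrite ler_pM2l// ler_nat.
Qed.

Lemma itv_sub_oy (a b : R) : 0 < a -> `[a, b]%classic `<=` (Rpos R).
Proof. by move=> a0 x /=; rewrite !in_itv/= andbT => /andP[/(lt_le_trans a0)]. Qed.

(** Exhausting the open half-line by the compacts [c/(n+1), c(n+1)] reduces the
    integrals below to compact intervals, to which the fundamental theorem of
    calculus and the changes of variables apply. *)
Lemma cvg_integral_oy f (c : R) : 0 < c ->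
  measurable_fun (Rpos R) f -> (forall x : R, 0 < x -> 0 <= f x) ->
  (\int[mu]_(x in `[(c / n.+1%:R)%R, (c * n.+1%:R)%R]) (f x)%:E)%E @[n --> \oo] -->
  (\int[mu]_(x in Rpos R) (f x)%:E)%E.
Proof.
move=> c0 mf f0; rewrite -(bigcup_itv_oy c0).
have sub n : `[c / n.+1%:R, c * n.+1%:R]%classic `<=` (Rpos R).
  by apply: itv_sub_oy; rewrite divr_gt0.
apply: ge0_nondecreasing_set_cvg_integral.
- exact: nondecreasing_itv_oy.
- by move=> n; exact: measurable_itv.
- move=> n; apply/measurable_EFinP; apply: measurable_funS mf => //.
- move=> n x /sub; rewrite /= in_itv/= andbT => x0; rewrite lee_fin; exact: f0.
Qed.

Lemma integral_FTC_cc f F (a b : R) : a <= b ->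
  (forall x : R, a <= x <= b -> is_derive x 1 F (f x)) ->
  (forall x : R, a <= x <= b -> {for x, continuous f}) ->
  (\int[mu]_(x in `[a, b]) (f x)%:E = (F b - F a)%:E)%E.
Proof.
rewrite le_eqVlt => /predU1P[->|ab] dF cf.
  by rewrite set_itv1 integral_set1 subrr.
have cF x : a <= x <= b -> {for x, continuous F}.
  by move=> /dF ?; apply/differentiable_continuous/derivable1_diffP.
rewrite EFinB; apply: continuous_FTC2 => //.
- by apply: continuous_in_subspaceT => x; rewrite inE/= in_itv/=; exact: cf.
- split.
  + move=> x; rewrite in_itv/= => /andP[? ?].
    have /dF ? : a <= x <= b by rewrite !ltW.
    by [].
  + by apply: cvg_at_right_filter; apply: cF; rewrite lexx ltW.
  + by apply: cvg_at_left_filter; apply: cF; rewrite lexx ltW.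
- move=> x; rewrite in_itv/= => /andP[? ?].
  have /dF ? : a <= x <= b by rewrite !ltW.
  by rewrite derive1E derive_val.
Qed.

Lemma open_oy : open (Rpos R).
Proof. exact: interval_open. Qed.

Lemma measurable_oy f : (forall x : R, 0 < x -> {for x, continuous f}) ->
  measurable_fun (Rpos R) f.
Proof.
move=> cf; apply: open_continuous_measurable_fun; first exact: open_oy.
by move=> x; rewrite inE/= in_itv/= andbT; exact: cf.
Qed.

(** By monotone convergence along these compacts: on each of them the integral is a
    difference of two values of F, at most 2 M. *)
Lemma integrable_oy_FTC f F (M : R) :
  (forall x : R, 0 < x -> 0 <= f x) ->
  (forall x : R, 0 < x -> {for x, continuous f}) ->
  (forall x : R, 0 < x -> is_derive x 1 F (f x)) ->
  (forall x : R, 0 < x -> `|F x| <= M) ->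
  mu.-integrable (Rpos R) (EFin \o f).
Proof.
move=> f0 cf dF FM; have mf := measurable_oy cf.
apply/integrableP; split; first exact/measurable_EFinP.
have -> : (\int[mu]_(x in Rpos R) `|(EFin \o f) x| =
           \int[mu]_(x in Rpos R) (f x)%:E)%E.
  apply: eq_integral => x; rewrite inE/= in_itv/= andbT => x0.
  by rewrite ger0_norm// f0.
apply: (@le_lt_trans _ _ (M + M)%:E); last exact: ltry.
have /cvg_lim <- // := cvg_integral_oy (@ltr01 R) mf f0.
apply: lime_le.
  by apply: cvgP; exact: (cvg_integral_oy (@ltr01 R) mf f0).
apply: nearW => n.
have p0 : 0 < 1 / n.+1%:R :> R by rewrite divr_gt0.
have pn : 1 / n.+1%:R <= 1 * n.+1%:R :> R.
  rewrite !mul1r (@le_trans _ _ 1)// ?ler1n// invf_le1 ?ler1n//.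
have dF' (x : R) : 1 / n.+1%:R <= x <= 1 * n.+1%:R -> is_derive x 1 F (f x).
  by move=> /andP[/(lt_le_trans p0) + _]; exact: dF.
rewrite (integral_FTC_cc pn dF').
- rewrite lee_fin (le_trans (ler_norm _))// (le_trans (ler_normB _ _))//.
  by rewrite lerD// FM// (lt_le_trans p0).
- by move=> x /andP[/(lt_le_trans p0) + _]; exact: cf.
Qed.

Lemma continuous_powR_pos (a x : R) : 0 < x -> {for x, continuous (@powR R ^~ a)}.
Proof.
move=> x0; apply/differentiable_continuous/derivable1_diffP/derivable_powR.
by rewrite in_itv/= x0.
Qed.

Lemma powR_le1 (r s : R) : 0 < r -> r <= 1 -> 0 <= s -> r `^ s <= 1.
Proof. by move=> r0 r1 s0; rewrite -(powRr0 r) ger_powR// r0. Qed.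

Lemma powR_ge1 (r s : R) : 1 <= r -> 0 <= s -> 1 <= r `^ s.
Proof. by move=> r1 s0; rewrite -(powRr0 r) ler_powR. Qed.

(** The model integrand: it is comparable to r^(s-1) near 0 and to r^(-s-1) at
    infinity, and it has the bounded primitive -1/(1+r^s).  Integrability
    on the half-line is proved by comparison with it. *)
Lemma integrable_powR_base (s : R) : 0 < s ->
  mu.-integrable (Rpos R) (EFin \o (fun r => s * r `^ (s - 1) / (1 + r `^ s) ^+ 2)).
Proof.
move=> s0.
have pos x : 0 < 1 + x `^ s :> R by rewrite ltr_pwDl// powR_ge0.
apply: (@integrable_oy_FTC _ (fun r => - (1 + r `^ s)^-1) 1).
- by move=> x x0; rewrite divr_ge0 ?sqr_ge0// mulr_ge0 ?powR_ge0// ltW.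
- move=> x x0; apply: cvgM; first by apply: cvgMr; exact: continuous_powR_pos.
  apply: cvgV; first by rewrite expf_neq0// gt_eqF.
  rewrite expr2; under eq_fun do rewrite expr2.
  by apply: cvgM; (apply: cvgD; [exact: cvg_cst|exact: continuous_powR_pos]).
- move=> x x0; have h := is_derive1_powR s x0.
  have p := gt_eqF (pos x).
  apply: is_derive_eq; first by apply: is_deriveN; apply: is_deriveV; rewrite p.
  rewrite /= add0r /GRing.scale/=; field. by rewrite p.
- move=> x x0; rewrite normrN ger0_norm ?invr_ge0 ?(ltW (pos x))//.
  by rewrite invf_le1// lerDl powR_ge0.
Qed.

Lemma integrable_oy (s C : R) f : 0 < s -> measurable_fun (Rpos R) f ->
  (forall r : R, 0 < r <= 1 -> `|f r| <= C * r `^ (s - 1)) ->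
  (forall r : R, 1 <= r -> `|f r| <= C * r `^ (- s - 1)) ->
  mu.-integrable (Rpos R) (EFin \o f).
Proof.
move=> s0 mf f1 f2.
have C0 : 0 <= C.
  by have := f2 1; rewrite lexx powR1 mulr1 => /(_ isT); exact: le_trans.
have := integrableZR (C * 4 / s) measurable_Rpos (integrable_powR_base s0).
apply: le_integrableR => //.
move=> x /=; rewrite in_itv/= andbT => x0.
have X0 : 0 < x `^ s by rewrite powR_gt0.
have E1 : 1 = 1 `^ s :> R by rewrite powR1.
have P0 : 0 < 1 + x `^ s by rewrite ltr_pwDl// ltW.
have key (w u : R) : 0 <= u -> u * (1 + x `^ s) ^+ 2 <= 4 * w ->
    C * u <= C * 4 / s * (s * w / (1 + x `^ s) ^+ 2).
  move=> u0 h.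
  have -> : C * 4 / s * (s * w / (1 + x `^ s) ^+ 2) = C * (4 * w / (1 + x `^ s) ^+ 2).
    by field; rewrite !gt_eqF.
  by rewrite ler_wpM2l// ler_pdivlMr// exprn_gt0.
have [x1|x1] := leP x 1.
  apply: (le_trans (f1 _ _)); first by rewrite x0 x1.
  apply: key; rewrite ?powR_ge0//.
  rewrite [leRHS]mulrC ler_wpM2l ?powR_ge0//.
  have : x `^ s <= 1.
    by rewrite [leRHS]E1 ge0_ler_powR// ?nnegrE ?ltW.
  by nra.
apply: (le_trans (f2 _ (ltW x1))); apply: key; rewrite ?powR_ge0//.
have -> : x `^ (s - 1) = x `^ (- s - 1) * x `^ s ^+ 2.
  have xn0 := gt_eqF x0.
  rewrite expr2 mulrA -powRD ?xn0 ?implybT// -powRD ?xn0 ?implybT//.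
  by congr powR; ring.
have : 1 <= x `^ s by rewrite [leLHS]E1 ge0_ler_powR// ?nnegrE ?ltW.
move=> h; rewrite [leRHS]mulrCA ler_wpM2l ?powR_ge0//.
nra.
Qed.

Lemma integral_scale f (c : R) : 0 < c ->
  (forall x : R, 0 < x -> {for x, continuous f}) -> (forall x : R, 0 < x -> 0 <= f x) ->
  (\int[mu]_(x in Rpos R) (f x)%:E =
   \int[mu]_(x in Rpos R) (c * f (c * x)%R)%:E)%E.
Proof.
move=> c0 cf f0.
have cg x : 0 < x -> {for x, continuous (fun x => c * f (c * x))}.
  move=> x0; apply: cvgMr; apply: continuous_comp => /=.
    by apply: cvgMr; exact: cvg_id.
  by apply: cf; rewrite mulr_gt0.
have h1 := cvg_integral_oy c0 (measurable_oy cf) f0.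
have h2 : (\int[mu]_(x in `[(1 / n.+1%:R)%R, (1 * n.+1%:R)%R]) (c * f (c * x)%R)%:E)%E
    @[n --> \oo] --> (\int[mu]_(x in Rpos R) (c * f (c * x)%R)%:E)%E.
  apply: cvg_integral_oy => //; first exact: measurable_oy.
  by move=> x x0; rewrite mulr_ge0 ?f0 ?mulr_gt0// ltW.
apply: (cvg_unique _ h1); rewrite //=.
apply: cvg_trans h2; apply: near_eq_cvg; apply: nearW => n.
have p0 : 0 < 1 / n.+1%:R :> R by rewrite divr_gt0.
have pn : 1 / n.+1%:R <= 1 * n.+1%:R :> R.
  rewrite !mul1r (@le_trans _ _ 1)// ?ler1n// invf_le1 ?ler1n//.
have dF (x : R) : is_derive x 1 ( *%R c) c.
  by apply: is_derive_eq; rewrite /GRing.scale/= mulr1.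
have F'E : ( *%R c)^`()%classic = (fun=> c).
  by apply/funext => x; rewrite derive1E derive_val.
have -> : c / n.+1%:R = c * (1 / n.+1%:R) by rewrite mul1r.
have -> : c * n.+1%:R = c * (1 * n.+1%:R) by rewrite mul1r.
rewrite (@integration_by_substitution_increasing _ ( *%R c) f)//.
- by apply: eq_integral => x _ /=; rewrite F'E mulrC.
- by move=> x y _ _ xy; rewrite ltr_pM2l.
- by move=> x _; rewrite F'E; exact: cvg_cst.
- by rewrite F'E; exact: is_cvg_cst.
- by rewrite F'E; exact: is_cvg_cst.
- split.
  + by move=> x _.
  + apply: cvg_at_right_filter; apply/differentiable_continuous/derivable1_diffP => //.
  + apply: cvg_at_left_filter; apply/differentiable_continuous/derivable1_diffP => //.
- apply: continuous_in_subspaceT => x; rewrite inE/= in_itv/= => /andP[h _].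
  by apply: cf; rewrite (lt_le_trans _ h)// mulr_gt0.
Qed.

Lemma lip1_of_derive (f f' : R -> R) : (forall x : R, is_derive x 1 f (f' x)) ->
  (forall x, `|f' x| <= 1) -> forall x y, `|f x - f y| <= `|x - y|.
Proof.
move=> df f1 x y; wlog xy : x y / y < x => [H|].
  have [h|h|->] := ltgtP y x; [exact: H| |by rewrite !subrr normr0].
  by rewrite distrC (distrC x); exact: H.
have cf : {within `[y, x], continuous f}.
  by apply: continuous_subspaceT => z; apply: is_derive_continuous.
have [c _ ->] := @MVT _ f f' _ _ xy (fun x _ => df x) cf.
by rewrite normrM ler_piMl.
Qed.

Lemma sin_lip (x y : R) : `|sin x - sin y| <= `|x - y|.
Proof. by apply: (lip1_of_derive (f' := cos)) => z; exact: cos_max. Qed.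

Lemma cos_lip (x y : R) : `|cos x - cos y| <= `|x - y|.
Proof. by apply: (lip1_of_derive (f' := fun x => - sin x)) => z; rewrite normrN sin_max. Qed.

Lemma sin_le_id (t : R) : 0 <= t -> sin t <= t.
Proof.
move=> t0; have := sin_lip t 0; rewrite sin0 !subr0 (ger0_norm t0).
exact/le_trans/ler_norm.
Qed.

Lemma Rintegral_ge_itv D f (u v c : R) : measurable D -> mu.-integrable D (EFin \o f) ->
  (forall x : R, D x -> 0 <= f x) -> u < v -> `]u, v[%classic `<=` D ->
  (forall x : R, u < x < v -> c <= f x) -> c * (v - u) <= \int[mu]_(x in D) f x.
Proof.
move=> mD fi f0 uv uvD cf.
have mC : measurable (`]u, v[%classic : set (measurableTypeR R)) by exact: measurable_itv.
have DC : D `&` `]u, v[%classic = `]u, v[%classic by exact: setIidr.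
pose e : R -> R := (fun=> c) \_ `]u, v[%classic.
have muC : @lebesgue_measure R `]u, v[%classic = (v - u)%:E.
  by rewrite lebesgue_measure_itv/= lte_fin uv EFinB.
have ie : mu.-integrable D (EFin \o e).
  rewrite /e -restrict_EFin; apply/integrable_restrict => //; rewrite DC.
  apply/integrableP; split; first exact: measurable_cst.
  by rewrite integral_cst// [X in (_ * X)%E]muC ltry.
have -> : c * (v - u) = \int[mu]_(x in D) e x.
  rewrite /e -Rintegral_mkcondr DC Rintegral_cst//.
  by rewrite [X in fine X]muC.
apply: le_Rintegral => // x Dx; rewrite /e patchE; case: ifPn => [|_]; last exact: f0.
by rewrite inE/= in_itv/= => /cf.
Qed.

End Toolbox.

(** * Holomorphic functions in polar coordinates *)

Section Holomorphic.
Context {R : realType}.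
Implicit Types (D : set (R * R)) (P Q A B : R * R -> R).

(** The pair (P, Q) stands for the real and imaginary parts of a function f that
    is holomorphic in z = r exp(i t), seen as a function of (r, t); (A, B) are the
    real and imaginary parts of z f'(z).  The four derivatives are the
    Cauchy-Riemann equations in polar form, d/dr f = f' z / r and d/dt f = i z f'.
    Carrying A and B along makes the class visibly closed under the field
    operations. *)
Definition holo D P Q A B := forall z : R * R, D z -> 0 < z.1 /\
  ([/\ is_derive z.1 1 (fun r : R => P (r, z.2)) (A z / z.1),
      is_derive z.1 1 (fun r : R => Q (r, z.2)) (B z / z.1),
      is_derive z.2 1 (fun t : R => P (z.1, t)) (- B z) &
      is_derive z.2 1 (fun t : R => Q (z.1, t)) (A z)] /\
  [/\ {for z, continuous P}, {for z, continuous Q},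
      {for z, continuous A} & {for z, continuous B}]).

Lemma holo_cst D (c : R) : (forall z, D z -> 0 < z.1) ->
  holo D (fun=> c) (fun=> 0) (fun=> 0) (fun=> 0).
Proof.
move=> D0 z Dz; split; first exact: D0.
rewrite oppr0 mul0r; split; split; try exact: cvg_cst; exact: is_derive_cst.
Qed.

Lemma holo_add D P Q A B P' Q' A' B' : holo D P Q A B -> holo D P' Q' A' B' ->
  holo D (fun z => P z + P' z) (fun z => Q z + Q' z)
         (fun z => A z + A' z) (fun z => B z + B' z).
Proof.
move=> h h' z Dz; have [z0 [[h1 h2 h3 h4] [c1 c2 c3 c4]]] := h z Dz.
have [_ [[h1' h2' h3' h4'] [c1' c2' c3' c4']]] := h' z Dz.
split=> //; split; last by split; apply: cvgD.
rewrite !mulrDl opprD.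
by split; apply: is_deriveD.
Qed.

Lemma holo_opp D P Q A B : holo D P Q A B ->
  holo D (fun z => - P z) (fun z => - Q z) (fun z => - A z) (fun z => - B z).
Proof.
move=> h z Dz; have [z0 [[h1 h2 h3 h4] [c1 c2 c3 c4]]] := h z Dz.
split=> //; split; last by split; apply: cvgN.
by rewrite !mulNr; split; apply: is_deriveN.
Qed.

Lemma cont_mul P Q z : {for z, continuous P} -> {for z, continuous Q} ->
  {for z, continuous (fun z => P z * Q z)}.
Proof. by move=> cf cg; exact: cvgM. Qed.

Lemma cont_add P Q z : {for z, continuous P} -> {for z, continuous Q} ->
  {for z, continuous (fun z => P z + Q z)}.
Proof. by move=> cf cg; exact: cvgD. Qed.

Lemma cont_sub P Q z : {for z, continuous P} -> {for z, continuous Q} ->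
  {for z, continuous (fun z => P z - Q z)}.
Proof. by move=> cf cg; exact: cvgB. Qed.

Lemma holo_mul D P Q A B P' Q' A' B' : holo D P Q A B -> holo D P' Q' A' B' ->
  holo D (fun z => P z * P' z - Q z * Q' z) (fun z => P z * Q' z + Q z * P' z)
         (fun z => (A z * P' z - B z * Q' z) + (P z * A' z - Q z * B' z))
         (fun z => (A z * Q' z + B z * P' z) + (P z * B' z + Q z * A' z)).
Proof.
move=> h h' z Dz; have [z0 [[h1 h2 h3 h4] [c1 c2 c3 c4]]] := h z Dz.
have [_ [[h1' h2' h3' h4'] [c1' c2' c3' c4']]] := h' z Dz.
split; first exact: z0.
split; last first.
  split.
  - exact: cont_sub (cont_mul c1 c1') (cont_mul c2 c2').
  - exact: cont_add (cont_mul c1 c2') (cont_mul c2 c1').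
  - exact: cont_add (cont_sub (cont_mul c3 c1') (cont_mul c4 c2')) (cont_sub (cont_mul c1 c3') (cont_mul c2 c4')).
  - exact: cont_add (cont_add (cont_mul c3 c2') (cont_mul c4 c1')) (cont_add (cont_mul c1 c4') (cont_mul c2 c3')).
case: z z0 h1 h2 h3 h4 h1' h2' h3' h4' {Dz c1 c2 c3 c4 c1' c2' c3' c4'}
  => r t /= r0 h1 h2 h3 h4 h1' h2' h3' h4'.
split.
- by apply: is_derive_eq; rewrite /GRing.scale/=; ring.
- by apply: is_derive_eq; rewrite /GRing.scale/=; ring.
- by apply: is_derive_eq; rewrite /GRing.scale/=; ring.
- by apply: is_derive_eq; rewrite /GRing.scale/=; ring.
Qed.

Lemma holo_inv D P Q A B : holo D P Q A B ->
  (forall z, D z -> P z ^+ 2 + Q z ^+ 2 != 0) ->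
  let N z := P z ^+ 2 + Q z ^+ 2 in
  exists A' B', holo D (fun z => P z / N z) (fun z => - Q z / N z) A' B'.
Proof.
move=> h N0 N.
exists (fun z => - (A z * (P z ^+ 2 - Q z ^+ 2) + 2 * B z * P z * Q z) / N z ^+ 2).
exists (fun z => - (B z * (P z ^+ 2 - Q z ^+ 2) - 2 * A z * P z * Q z) / N z ^+ 2).
move=> z Dz; have [z0 [[h1 h2 h3 h4] [c1 c2 c3 c4]]] := h z Dz.
have Nz : N z != 0 by exact: N0.
have cX (f : R * R -> R) : {for z, continuous f} -> {for z, continuous (fun z => f z ^+ 2)}.
  by move=> cf; exact: (continuous_comp cf (@exprn_continuous R 2 _)).
have cN : {for z, continuous N}.
  by apply: cvgD; exact: cX.
have cO (f : R * R -> R) : {for z, continuous f} -> {for z, continuous (fun z => - f z : R)}.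
  by move=> cf; exact: cvgN.
have ci : {for z, continuous (fun z => (N z)^-1)} by apply: cvgV.
have ci2 : {for z, continuous (fun z => (N z ^+ 2)^-1)}.
  by apply: cvgV; [rewrite expf_neq0|exact: (cX _ cN)].
have c2c (f : R * R -> R) : {for z, continuous f} -> {for z, continuous (fun z => 2 * f z)}.
  by move=> cf; apply: cvgM => //; exact: cvg_cst.
have cS := cont_sub (cX _ c1) (cX _ c2).
split; first exact: z0.
split; last first.
  split.
  - exact: cont_mul c1 ci.
  - exact: cont_mul (cO _ c2) ci.
  - exact: cont_mul (cO _ (cont_add (cont_mul c3 cS) (cont_mul (cont_mul (c2c _ c4) c1) c2))) ci2.
  - exact: cont_mul (cO _ (cont_sub (cont_mul c4 cS) (cont_mul (cont_mul (c2c _ c3) c1) c2))) ci2.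
case: z z0 Nz h1 h2 h3 h4 {Dz c1 c2 c3 c4 cN cX cO ci ci2 c2c cS}
  => r t /= r0 Nz h1 h2 h3 h4.
have rn0 : r != 0 by rewrite gt_eqF.
have Nx : P (r, t) * P (r, t) + Q (r, t) * Q (r, t) != 0 by rewrite -!expr2.
have dN1 : is_derive r 1 (fun r : R => N (r, t)) (2 * (P (r,t) * (A (r,t) / r) + Q (r,t) * (B (r,t)/r))).
  by apply: is_derive_eq; rewrite /GRing.scale/=; ring.
have dN2 : is_derive t 1 (fun t : R => N (r, t)) (2 * (- P (r,t) * B (r,t) + Q (r,t) * A (r,t))).
  by apply: is_derive_eq; rewrite /GRing.scale/=; ring.
have dV1 := @is_deriveV _ (fun r => N (r, t)) r _ 1 Nz dN1.
have dV2 := @is_deriveV _ (fun t => N (r, t)) t _ 1 Nz dN2.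
rewrite /= in dV1 dV2.
split.
- by apply: is_derive_eq; rewrite /GRing.scale/= /N; field; rewrite Nx rn0.
- by apply: is_derive_eq; rewrite /GRing.scale/= /N; field; rewrite Nx rn0.
- by apply: is_derive_eq; rewrite /GRing.scale/= /N; field.
- by apply: is_derive_eq; rewrite /GRing.scale/= /N; field.
Qed.

(** The branch z^b = r^b exp(i b t), which polar coordinates make single-valued. *)
Lemma holo_powR D (b : R) : (forall z, D z -> 0 < z.1) ->
  holo D (fun z => z.1 `^ b * cos (b * z.2)) (fun z => z.1 `^ b * sin (b * z.2))
    (fun z => b * (z.1 `^ b * cos (b * z.2))) (fun z => b * (z.1 `^ b * sin (b * z.2))).
Proof.
move=> D0 z Dz; have z0 := D0 z Dz; split=> //.
have c1 : {for z, continuous (fun z : R * R => z.1 `^ b)}.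
  apply: (@continuous_comp _ _ _ (fun z : R * R => z.1) (@powR R ^~ b)); first exact: cvg_fst.
  exact: continuous_powR_pos.
have c2 : {for z, continuous (fun z : R * R => b * z.2)}.
  by apply: cvgM; [exact: cvg_cst|exact: cvg_snd].
have c3 : {for z, continuous (fun z : R * R => cos (b * z.2))}.
  by apply: (continuous_comp c2); exact: continuous_cos.
have c4 : {for z, continuous (fun z : R * R => sin (b * z.2))}.
  by apply: (continuous_comp c2); exact: continuous_sin.
split; last first.
  split; first exact: cvgM.
  - exact: cvgM.
  - by apply: cvgM; [exact: cvg_cst|exact: cvgM].
  - by apply: cvgM; [exact: cvg_cst|exact: cvgM].
case: z z0 {Dz c1 c2 c3 c4} => r t /= r0.
have e : r `^ (b - 1) = r `^ b / r.
  by rewrite powRB ?(gt_eqF r0) ?implybT// powRr1// ltW.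
have d1 := is_derive1_powR b r0.
have d2 : is_derive t 1 (fun t : R => cos (b * t)) (- (b * sin (b * t))).
  have h : is_derive t 1 ( *%R b) b.
    by apply: is_derive_eq; rewrite /GRing.scale/= mulr1.
  have := @is_derive1_comp _ cos ( *%R b) t _ _ (is_derive_cos _) h.
  by move=> /is_derive_eq; apply; rewrite mulNr mulrC.
have d3 : is_derive t 1 (fun t : R => sin (b * t)) (b * cos (b * t)).
  have h : is_derive t 1 ( *%R b) b.
    by apply: is_derive_eq; rewrite /GRing.scale/= mulr1.
  have := @is_derive1_comp _ sin ( *%R b) t _ _ (is_derive_sin _) h.
  by move=> /is_derive_eq; apply; rewrite mulrC.
split.
- by apply: is_derive_eq; rewrite /GRing.scale/= e; ring.
- by apply: is_derive_eq; rewrite /GRing.scale/= e; ring.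
- by apply: is_derive_eq; rewrite /GRing.scale/=; ring.
- by apply: is_derive_eq; rewrite /GRing.scale/=; ring.
Qed.

Lemma holo_id D : (forall z, D z -> 0 < z.1) ->
  holo D (fun z => z.1 * cos z.2) (fun z => z.1 * sin z.2)
         (fun z => z.1 * cos z.2) (fun z => z.1 * sin z.2).
Proof.
move=> D0 z Dz; have z0 := D0 z Dz; split=> //.
have c3 : {for z, continuous (fun z : R * R => cos z.2)}.
  by apply: continuous_comp; [exact: cvg_snd|exact: continuous_cos].
have c4 : {for z, continuous (fun z : R * R => sin z.2)}.
  by apply: continuous_comp; [exact: cvg_snd|exact: continuous_sin].
split; last by split; (apply: cvgM; first exact: cvg_fst).
case: z z0 {Dz c3 c4} => r t /= r0; have rn0 : r != 0 by rewrite gt_eqF.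
by split; apply: is_derive_eq; rewrite /GRing.scale/=; field.
Qed.

End Holomorphic.

(** * The Cauchy integral theorem on a polar rectangle *)

Section Rectangle.
Context {R : realType}.
Implicit Types (D : set (R * R)) (P Q A B : R * R -> R).

Lemma continuous_slice1 (f : R * R -> R) (r t : R) :
  {for (r, t), continuous f} -> {for r, continuous (fun r => f (r, t))}.
Proof.
move=> cf; have c1 : {for r, continuous (fun r : R => (r, t))}.
  by apply: (@cvg_pair _ _ _ _ (nbhs r) (nbhs t)); [exact: cvg_id|exact: cvg_cst].
exact: (continuous_comp c1 cf).
Qed.

Lemma continuous_integrable_cc (f : R -> R) (a b : R) :
  (forall x, a <= x <= b -> {for x, continuous f}) ->
  mu.-integrable `[a, b] (EFin \o f).
Proof.
move=> cf; apply: continuous_compact_integrable; first exact: segment_compact.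
by apply: continuous_in_subspaceT => x; rewrite inE/= in_itv/=; exact: cf.
Qed.

(** Cauchy's theorem for f dz / z on the polar rectangle a <= r <= b,
    t1 <= t <= t2, in the form that is used: the integrals of Q / r over the two
    radial sides differ by at most C (t2 - t1), where C bounds the jump of P
    across the two arcs.  Indeed, differentiating under the integral sign and then
    using the Cauchy-Riemann equations, the derivative of J is the integral of
    d/dr P, that is P (b, t) - P (a, t); conclude by the mean value theorem. *)
Lemma holo_rectangle D P Q A B (a b u v t1 t2 C : R) :
  holo D P Q A B -> 0 < a -> a < b -> u < t1 -> t1 < t2 -> t2 < v ->
  (forall r t, a <= r <= b -> u <= t <= v -> D (r, t)) ->
  (forall t, t1 <= t <= t2 -> `|P (b, t) - P (a, t)| <= C) ->
  let J t := \int[mu]_(r in `[a, b]) (Q (r, t) / r) in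
  is_true (`|J t2 - J t1| <= C * (t2 - t1)).
Proof.
move=> h a0 ab ut1 t12 t2v DK PC J.
have cA : {within `[a, b] `*` `[u, v], continuous A}.
  apply: continuous_in_subspaceT => -[r t]; rewrite inE/= !in_itv/= => -[hr ht].
  by have [_ [_ []]] := h _ (DK r t hr ht).
have cK : compact (`[a, b]%classic `*` `[u, v]%classic : set (R * R)).
  by apply: compact_setX; exact: segment_compact.
have /compact_bounded[M [_ Mlt]] := continuous_compact cA cK.
have hM := Mlt (M + 1) ltac:(by rewrite ltrDl).
have AM r t : a <= r <= b -> u <= t <= v -> `|A (r, t)| <= M + 1.
  by move=> hr ht; apply: hM => /=; exists (r, t).
have M0 : 0 <= M + 1.
  by apply: (le_trans (normr_ge0 (A (a, t1)))); apply: AM; rewrite ?lexx !ltW// (lt_trans t12).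
have rpos r : a <= r <= b -> 0 < r by move=> /andP[/(lt_le_trans a0)].
have dJ t : u < t < v -> is_derive t 1 J (P (b, t) - P (a, t)).
  move=> utv; have utv' : u <= t <= v by case/andP: utv => *; rewrite !ltW.
  have intf s : `]u, v[%classic s -> mu.-integrable `[a, b] (EFin \o (fun r => Q (r, s) / r)).
    rewrite /= in_itv/= => /andP[us sv]; apply: continuous_integrable_cc => r hr.
    have [_ [_ [_ cQ _ _]]] := h _ (DK r s hr ltac:(by rewrite !ltW)).
    apply: cvgM; first exact: continuous_slice1.
    by apply: cvgV; rewrite ?gt_eqF// rpos.
  have dQ s r : u < s < v -> a <= r <= b ->
      is_derive s 1 (fun s => Q (r, s) / r) (A (r, s) / r).
    move=> /andP[us sv] hr.
    have [_ [[_ _ _ dQ] _]] := h _ (DK r s hr ltac:(by rewrite !ltW)).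
    by rewrite /= in dQ; apply: is_derive_eq; rewrite /GRing.scale/= mulr0 add0r mulrC.
  have d1E s r : u < s < v -> a <= r <= b ->
      partial1of2 (fun s r => Q (r, s) / r) s r = A (r, s) / r.
    by move=> hs hr; have dd := dQ s r hs hr; rewrite partial1of2E derive_val.
  have mab : measurable (`[a, b]%classic : set (measurableTypeR R)) by exact: measurable_itv.
  have It : `]u, v[%classic t by rewrite /= in_itv.
  have der s r : `]u, v[%classic s -> `[a, b]%classic r ->
      derivable (fun s => Q (r, s) / r) s 1.
    by rewrite /= !in_itv/= => hs hr; have dd := dQ s r hs hr.
  have Gub s r : `]u, v[%classic s -> `[a, b]%classic r ->
      `|partial1of2 (fun s r => Q (r, s) / r) s r| <= (M + 1) / a.
    rewrite /= !in_itv/= => hs hr; rewrite d1E// normrM.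
    have r0 := rpos _ hr.
    apply: ler_pM => //; first by apply: AM => //; case/andP: hs => *; rewrite !ltW.
    by rewrite ger0_norm ?invr_ge0 ?(ltW r0)// lef_pV2 ?posrE//; case/andP: hr.
  have iG : mu.-integrable `[a, b] (EFin \o (fun=> (M + 1) / a)).
    by apply: continuous_integrable_cc => r _; exact: cvg_cst.
  have G0 (r : R) : 0 <= (M + 1) / a by rewrite divr_ge0// ltW.
  have dd := @derivable_under_integral R _ _ mu (fun s r => Q (r, s) / r) _ mab
    t u v It intf der _ G0 iG Gub.
  have de := @differentiation_under_integral R _ _ mu (fun s r => Q (r, s) / r) _ mab
    t u v It intf der _ G0 iG Gub.
  apply: DeriveDef; first exact: dd.
  rewrite -derive1E [LHS]de.
  transitivity (\int[mu]_(r in `[a, b]) (A (r, t) / r)).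
    apply: eq_Rintegral => r; rewrite inE/= in_itv/= => hr.
    by rewrite d1E.
  have dP r : a <= r <= b -> is_derive r 1 (fun r => P (r, t)) (A (r, t) / r).
    by move=> hr; have [_ [[]]] := h _ (DK r t hr utv').
  have cAr r : a <= r <= b -> {for r, continuous (fun r => A (r, t) / r)}.
    move=> hr; have [_ [_ [_ _ cA' _]]] := h _ (DK r t hr utv').
    apply: cvgM; first exact: continuous_slice1.
    by apply: cvgV; rewrite ?gt_eqF// rpos.
  by rewrite /Rintegral (integral_FTC_cc (ltW ab) dP cAr).
have cJ : {within `[t1, t2], continuous J}.
  apply: derivable_within_continuous => t; rewrite in_itv/= => /andP[t1t tt2].
  by have := dJ t; rewrite (lt_le_trans ut1)// (le_lt_trans tt2)// => /(_ isT).
have [t|t + ->] := @MVT _ J (fun t => P (b, t) - P (a, t)) _ _ t12 _ cJ.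
  rewrite in_itv/= => /andP[t1t tt2]; apply: dJ.
  by rewrite (lt_trans ut1)// (lt_trans tt2).
rewrite in_itv/= => /andP[t1t tt2].
rewrite normrM (gtr0_norm (x := t2 - t1)) ?subr_gt0//.
by apply: ler_wpM2r; [rewrite subr_ge0 ltW|apply: PC; rewrite !ltW].
Qed.

End Rectangle.

(** * The functions z^a / (1 + z^a) and 1 / (p - z) *)

Section Integrand.
Context {R : realType}.
Implicit Types (a p r t : R).

Lemma mul_le_of_sqr_le (x y n : R) : x ^+ 2 <= n -> y ^+ 2 <= n -> x * y <= n.
Proof. by move=> *; nra. Qed.

Lemma integrable_oy_two (s1 s2 C : R) (f : R -> R) : 0 < s1 -> 0 < s2 -> measurable_fun (Rpos R) f ->
  (forall r : R, 0 < r <= 1 -> `|f r| <= C * r `^ (s1 - 1)) ->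
  (forall r : R, 1 <= r -> `|f r| <= C * r `^ (- s2 - 1)) ->
  mu.-integrable (Rpos R) (EFin \o f).
Proof.
move=> s10 s20 mf f1 f2; have C0 : 0 <= C.
  by have := f2 1; rewrite lexx powR1 mulr1 => /(_ isT); exact: le_trans.
apply: (@integrable_oy _ (Num.min s1 s2) C) => //; first by rewrite lt_min s10.
- move=> r r01; apply: (le_trans (f1 r r01)); apply: ler_wpM2l => //.
  by apply: ger_powR => //; rewrite lerD2r ge_min lexx.
- move=> r r1; apply: (le_trans (f2 r r1)); apply: ler_wpM2l => //.
  by apply: ler_powR => //; rewrite lerD2r lerN2 ge_min lexx orbT.
Qed.

(** The exceptional point c is needed because the integrands below converge
    everywhere except at the pole r = p. *)
Lemma Rdominated_cvg_off_point (D : set (measurableTypeR R)) (f_ : (R -> R)^nat) (c : R) (g : R -> R) :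
  measurable D ->
  (forall n, measurable_fun D (f_ n)) ->
  (forall x : R, D x -> x != c -> f_ n x @[n --> \oo] --> 0) ->
  (forall n (x : R), D x -> `|f_ n x| <= g x) ->
  mu.-integrable D (EFin \o g) ->
  (\int[mu]_(x in D) f_ n x)%R @[n --> \oo] --> (0 : R).
Proof.
move=> mD mf ff fg ig.
have mfE n : measurable_fun D (EFin \o f_ n) by exact/measurable_EFinP.
have mlE : measurable_fun D (EFin \o (fun=> 0 : R)) by exact/measurable_EFinP.
have [||i1 _ i2] := @dominated_convergence _ _ _ mu D mD (fun n => EFin \o f_ n)
  (EFin \o (fun=> 0 : R)) (EFin \o g) mfE mlE _ ig.
- exists [set c]; split; first exact: measurable_set1.
    exact: lebesgue_measure_set1.
  move=> x /=; apply: contra_notP => xc Dx.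
  apply: cvg_EFin; [exact: nearW|apply: ff => //; exact/eqP].
- by apply: aeW => x n Dx; rewrite /= lee_fin fg.
rewrite (_ : 0 = fine (\int[mu]_(x in D) (0%R)%:E)%E); last by rewrite integral0.
by apply: fine_cvg; rewrite fineK//; exact: integrable_fin_num.
Qed.

(** |1 + z^a|^2 for z = r exp(i t). *)
Definition sqabs1 a (z : R * R) :=
  (1 + z.1 `^ a * cos (a * z.2)) ^+ 2 + (z.1 `^ a * sin (a * z.2)) ^+ 2.
(** frac_re + i frac_im = z^a / (1 + z^a), written as 1 - 1 / (1 + z^a). *)
Definition frac_re a (z : R * R) := 1 - (1 + z.1 `^ a * cos (a * z.2)) / sqabs1 a z.
Definition frac_im a (z : R * R) := z.1 `^ a * sin (a * z.2) / sqabs1 a z.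
(** |p - z|^2. *)
Definition sqabsB p (z : R * R) := (p - z.1 * cos z.2) ^+ 2 + (z.1 * sin z.2) ^+ 2.
(** ker_re + i ker_im = 1 / (p - z). *)
Definition ker_re p (z : R * R) := (p - z.1 * cos z.2) / sqabsB p z.
Definition ker_im p (z : R * R) := z.1 * sin z.2 / sqabsB p z.
(** prod_re + i prod_im = z^a / (1 + z^a) / (p - z). *)
Definition prod_re a p z := frac_re a z * ker_re p z - frac_im a z * ker_im p z.
Definition prod_im a p z := frac_re a z * ker_im p z + frac_im a z * ker_re p z.

Lemma sqabs1E a r t : sqabs1 a (r, t) = 1 + 2 * r `^ a * cos (a * t) + (r `^ a) ^+ 2.
Proof.
rewrite /sqabs1/=; have := cos2Dsin2 (a * t); move: (cos _) (sin _) => c s h.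
have -> : (1 + r `^ a * c) ^+ 2 + (r `^ a * s) ^+ 2 =
  1 + 2 * r `^ a * c + (r `^ a) ^+ 2 * (c ^+ 2 + s ^+ 2) by ring.
by rewrite h; ring.
Qed.

Lemma sqabs1E2 a r t : sqabs1 a (r, t) = (r `^ a + cos (a * t)) ^+ 2 + sin (a * t) ^+ 2.
Proof.
rewrite sqabs1E; have := cos2Dsin2 (a * t); move: (cos _) (sin _) => c s h.
have -> : (r `^ a + c) ^+ 2 + s ^+ 2 = (r `^ a) ^+ 2 + 2 * r `^ a * c + (c ^+ 2 + s ^+ 2) by ring.
by rewrite h; ring.
Qed.

Lemma sqabsBE p r t : sqabsB p (r, t) = (p - r) ^+ 2 + 2 * p * r * (1 - cos t).
Proof.
rewrite /sqabsB/=; have := cos2Dsin2 t; move: (cos _) (sin _) => c s h.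
have -> : (p - r * c) ^+ 2 + (r * s) ^+ 2 = p ^+ 2 - 2 * p * r * c + r ^+ 2 * (c ^+ 2 + s ^+ 2) by ring.
by rewrite h; ring.
Qed.

Lemma sqabsBE2 p r t : sqabsB p (r, t) = (r - p * cos t) ^+ 2 + (p * sin t) ^+ 2.
Proof.
rewrite sqabsBE; have := cos2Dsin2 t; move: (cos _) (sin _) => c s h.
have -> : (r - p * c) ^+ 2 + (p * s) ^+ 2 = r ^+ 2 - 2 * p * r * c + p ^+ 2 * (c ^+ 2 + s ^+ 2) by ring.
by rewrite h; ring.
Qed.

Lemma cos_lt1 t : 0 < t < pi *+ 2 -> cos t < 1.
Proof.
move=> /andP[t0 tpi].
have s0 : 0 < sin (t / 2) by apply: sin_gt0_pi; rewrite divr_gt0//= ltr_pdivrMr// mulr_natr.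
rewrite (_ : t = (t / 2) *+ 2); last by rewrite -mulr_natr mulfVK.
rewrite cos_mulr2n; have := cos2Dsin2 (t / 2); nra.
Qed.

Lemma sqabsB_gt0 p r t : 0 < p -> 0 < r -> 0 < t < pi *+ 2 -> 0 < sqabsB p (r, t).
Proof.
move=> p0 r0 t02; rewrite sqabsBE ltr_wpDl ?sqr_ge0// !mulr_gt0// subr_gt0.
exact: cos_lt1.
Qed.

Lemma sqabs1_gt0 a r t : 0 < a * t < pi -> 0 < sqabs1 a (r, t).
Proof. by move=> h; rewrite sqabs1E2 ltr_wpDl ?sqr_ge0// exprn_gt0// sin_gt0_pi. Qed.

Lemma holo_prod a p (v : R) : 0 < a -> 0 < p -> a * v <= pi -> v <= pi *+ 2 ->
  exists A B, holo [set z | 0 < z.1 /\ 0 < z.2 < v] (prod_re a p) (prod_im a p) A B.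
Proof.
move=> a0 p0 av v2.
set D := [set z | _].
have D0 z : D z -> 0 < z.1 by case.
have h1 := holo_cst 1 D0.
have h2 := holo_add h1 (holo_powR a D0).
have {h2}[|A1 [B1 h2]] := holo_inv h2.
  move=> -[r t] /= [r0 /andP[t0 tv]]; rewrite add0r gt_eqF//.
  apply: (@sqabs1_gt0 a r t); rewrite mulr_gt0//= (lt_le_trans _ av)// ltr_pM2l//.
have {h2} hF := holo_add h1 (holo_opp h2).
have h3 := holo_add (holo_cst p D0) (holo_opp (holo_id D0)).
have {h3}[|A2 [B2 hk]] := holo_inv h3.
  move=> -[r t] /= [r0 /andP[t0 tv]]; rewrite add0r sqrrN gt_eqF//.
  have := @sqabsB_gt0 p r t p0 r0; rewrite t0 (lt_le_trans tv)// => /(_ isT).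
  by rewrite /sqabsB.
have h := holo_mul hF hk.
set P' := (X in holo _ X) in h; set Q' := (X in holo _ _ X) in h.
have <- : P' = prod_re a p.
  by apply/funext => z; rewrite /P' /prod_re /frac_re /frac_im /ker_re /ker_im /sqabs1 /sqabsB !add0r !(sqrrN, mulNr, opprK).
have <- : Q' = prod_im a p.
  by apply/funext => z; rewrite /Q' /prod_im /frac_re /frac_im /ker_re /ker_im /sqabs1 /sqabsB !add0r !(sqrrN, mulNr, opprK).
by do 2 eexists; exact: h.
Qed.

End Integrand.

(** * Bounds on the integrand near the cut and at small angles *)

Section StieltjesBounds.
Context {R : realType}.
Variables (a p : R).
Hypotheses (a0 : 0 < a) (a1 : a < 1) (p0 : 0 < p).

(** On 0 <= t <= pi the modulus |1 + z^a| is smallest on the cut t = pi, where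
    a < 1 keeps it away from 0. *)
Lemma sqabs1_ge_pi r t : 0 < r -> 0 <= t <= pi -> sqabs1 a (r, pi) <= sqabs1 a (r, t).
Proof.
move=> r0 /andP[t0 tpi]; rewrite !sqabs1E lerD2r lerD2l ler_wpM2l ?mulr_ge0 ?powR_ge0//.
have pi0 := (@pi_ge2 R).
move: tpi; rewrite le_eqVlt => /predU1P[->//|tpi]; apply/ltW.
have b1 : a * t < a * pi by rewrite ltr_pM2l.
have b2 : 0 <= a * t by rewrite mulr_ge0// ltW.
have b3 : a * pi <= pi by rewrite ler_piMl ?pi_ge0// ltW.
by rewrite ltr_cos ?in_itv/= ?b1//; lra.
Qed.

Let sg := sin (a * pi) : R.

Lemma sin_mulpi_gt0 : 0 < sg.
Proof. by apply: sin_gt0_pi; rewrite mulr_gt0 ?pi_gt0//= gtr_pMl ?pi_gt0. Qed.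

Lemma sqabs1_ge r t : 0 < r -> 0 <= t <= pi ->
  sg ^+ 2 <= sqabs1 a (r, t) /\ (r `^ a * sg) ^+ 2 <= sqabs1 a (r, t).
Proof.
move=> r0 ht; have h := sqabs1_ge_pi r0 ht; split; apply: le_trans h.
  by rewrite sqabs1E2 lerDr sqr_ge0.
by rewrite /sqabs1 /= lerDr sqr_ge0.
Qed.

Lemma frac_reE r t : sqabs1 a (r, t) != 0 ->
  frac_re a (r, t) = r `^ a * (r `^ a + cos (a * t)) / sqabs1 a (r, t).
Proof. by rewrite /frac_re sqabs1E /= => h; field. Qed.

Lemma normrM_le_of_sqr (x y n : R) : x ^+ 2 <= n -> y ^+ 2 <= n -> 0 <= y -> `|x| * y <= n.
Proof.
by move=> h1 h2 y0; apply: mul_le_of_sqr_le => //; rewrite -normrX ger0_norm ?sqr_ge0.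
Qed.

Lemma frac_bound r t : 0 < r -> 0 <= t <= pi ->
  [/\ `|frac_re a (r, t)| <= r `^ a / sg, `|frac_re a (r, t)| <= sg^-1,
      `|frac_im a (r, t)| <= r `^ a / sg & `|frac_im a (r, t)| <= sg^-1].
Proof.
move=> r0 ht; have [h1 h2] := sqabs1_ge r0 ht; have s0 := sin_mulpi_gt0.
have n0 : 0 < sqabs1 a (r, t) by apply: lt_le_trans h1; rewrite exprn_gt0.
have X0 : 0 < r `^ a by rewrite powR_gt0.
have c1 : (r `^ a + cos (a * t)) ^+ 2 <= sqabs1 a (r, t) by rewrite sqabs1E2 lerDl sqr_ge0.
have c2 : sin (a * t) ^+ 2 <= sqabs1 a (r, t) by rewrite sqabs1E2 lerDr sqr_ge0.
have c3 : (r `^ a * sin (a * t)) ^+ 2 <= sqabs1 a (r, t) by rewrite /sqabs1/= lerDr sqr_ge0.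
have nn (x : R) : `|x / sqabs1 a (r, t)| = `|x| / sqabs1 a (r, t).
  by rewrite normrM (gtr0_norm (x := _^-1)) ?invr_gt0.
rewrite frac_reE ?gt_eqF// /frac_im/= !nn; split.
- rewrite normrM (gtr0_norm X0) ler_pdivrMr// -mulrA ler_pM2l// ler_pdivlMl// mulrC.
  by apply: normrM_le_of_sqr => //; exact: ltW.
- rewrite normrM (gtr0_norm X0) ler_pdivrMr// ler_pdivlMl// mulrA mulrC (mulrC sg).
  by apply: normrM_le_of_sqr => //; rewrite mulr_ge0// ltW.
- rewrite normrM (gtr0_norm X0) ler_pdivrMr// -mulrA ler_pM2l// ler_pdivlMl// mulrC.
  by apply: normrM_le_of_sqr => //; exact: ltW.
- rewrite ler_pdivrMr// ler_pdivlMl// mulrC.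
  by apply: normrM_le_of_sqr => //; exact: ltW.
Qed.

Lemma ker_bound r t : 0 < r -> 0 < t < pi *+ 2 -> r != p ->
  `|ker_re p (r, t)| <= `|p - r|^-1 /\ `|ker_im p (r, t)| <= `|p - r|^-1.
Proof.
move=> r0 ht rp; have n0 := sqabsB_gt0 p0 r0 ht.
have d0 : 0 < `|p - r| by rewrite normr_gt0 subr_eq0 eq_sym.
have c1 : `|p - r| ^+ 2 <= sqabsB p (r, t).
  by rewrite -normrX ger0_norm ?sqr_ge0// sqabsBE lerDl !mulr_ge0 ?subr_ge0 ?cos_le1 ?(ltW p0) ?(ltW r0).
have nn (x : R) : `|x / sqabsB p (r, t)| = `|x| / sqabsB p (r, t).
  by rewrite normrM (gtr0_norm (x := _^-1)) ?invr_gt0.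
rewrite /ker_re /ker_im !nn/= !ler_pdivrMr//; split; rewrite ler_pdivlMl// mulrC;
  apply: normrM_le_of_sqr => //; rewrite /sqabsB/= ?lerDl ?lerDr ?sqr_ge0//.
Qed.

Lemma prod_re_bound r t : 0 < r -> 0 < t <= pi -> r != p ->
  `|prod_re a p (r, t)| <= 2 * (r `^ a / sg) / `|p - r| /\
  `|prod_re a p (r, t)| <= 2 * sg^-1 / `|p - r|.
Proof.
move=> r0 /andP[t0 tpi] rp.
have ht : 0 <= t <= pi by rewrite ltW.
have ht2 : 0 < t < pi *+ 2.
  by rewrite t0 (le_lt_trans tpi)// mulr2n ltrDl (lt_le_trans _ (@pi_ge2 R)).
have [f1 f2 f3 f4] := frac_bound r0 ht; have [k1 k2] := ker_bound r0 ht2 rp.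
have gen (x y z w : R) : `|x * y - z * w| <= `|x| * `|y| + `|z| * `|w|.
  by rewrite -!normrM ler_normB.
have h := gen (frac_re a (r, t)) (ker_re p (r, t)) (frac_im a (r, t)) (ker_im p (r, t)).
have dbl (x y : R) : 2 * x / y = x * y^-1 + x * y^-1 by rewrite -mulrA mulr_natl mulr2n.
split; apply: (le_trans h); rewrite dbl; apply: lerD; exact: ler_pM.
Qed.

End StieltjesBounds.

Section StieltjesRest.
Context {R : realType}.
Variables (a p : R).
Hypotheses (a0 : 0 < a) (a1 : a < 1) (p0 : 0 < p).

Lemma ler_pdiv_cross (x y n d : R) : 0 < n -> 0 < d -> x * d <= y * n -> x / n <= y / d.
Proof. by move=> n0 d0 h; rewrite ler_pdivrMr// mulrAC ler_pdivlMr. Qed.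

Definition frac_pos (r : R) := r `^ a / (1 + r `^ a).
(** The integrand at small angle t, after subtracting the part that concentrates at
    r = p: the latter is a Poisson kernel times the value at the pole. *)
Definition remainder (r t : R) :=
  (frac_im a (r, t) * ker_re p (r, t) + (frac_re a (r, t) - frac_pos p) * ker_im p (r, t)) / r.

(** This is where a < 1 enters the estimates at small angles. *)
Lemma small_angle (t : R) : 0 < t <= 1 ->
  [/\ 0 <= cos (a * t), 0 < sin (a * t), sin (a * t) <= sin t, sin t <= 1 &
   0 <= 1 - cos (a * t) <= sin t ^+ 2 /\ sin t ^+ 2 <= 2 * (1 - cos t)].
Proof.
move=> /andP[t0 t1]; have pi2 := @pi_ge2 R.
have at0 : 0 < a * t by rewrite mulr_gt0.
have att : a * t < t by rewrite -[ltRHS]mul1r ltr_pM2r.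
have c0 : 0 <= cos t by apply: cos_ge0_pihalf; lra.
have cc : cos t < cos (a * t).
  by rewrite ltr_cos ?in_itv/= ?att//; lra.
have := cos2Dsin2 t; have := cos_le1 t; have := cos_le1 (a * t) => h1 h2 h3.
split; [nra| by apply: sin_gt0_pi; lra| | exact: sin_le1|split; nra].
by apply/ltW; rewrite ltr_sin ?in_itv/= ?att//; lra.
Qed.

Lemma powR_dist (r : R) : 0 < r -> `|r `^ a - p `^ a| <= p `^ (a - 1) * `|r - p|.
Proof.
move=> r0.
have pE : p `^ a = p `^ (a - 1) * p by rewrite mulrC mulr_powRB1// ltW.
have rE : r = p * (r / p) by rewrite mulrC divfK// gt_eqF.
have x0 : 0 < r / p by rewrite divr_gt0.
have w0 : 0 < p `^ (a - 1) by rewrite powR_gt0.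
have -> : r `^ a = p `^ (a - 1) * p * (r / p) `^ a.
  by rewrite {1}rE powRM ?ltW// pE.
have -> : `|r - p| = p * `|r / p - 1|.
  by rewrite -{2}(gtr0_norm p0) -normrM mulrBr -rE mulr1.
rewrite pE -[X in `|_ - X|]mulr1 -mulrBr normrM (gtr0_norm (x := _ * p)) ?mulr_gt0//.
rewrite -mulrA !ler_pM2l//.
have E1 : 1 = 1 `^ a :> R by rewrite powR1.
move: (r / p) x0 => x x0.
have [x1|x1] := leP x 1.
  have h1 : x <= x `^ a by apply: ger1_powR; rewrite ?x0 ?x1 ?ltW.
  have h2 : x `^ a <= 1.
    by rewrite [leRHS]E1 ge0_ler_powR// ?nnegrE ?ltW.
  by rewrite !ler0_norm ?subr_le0// lerN2 lerD2r.
have h1 : x `^ a <= x by apply: ler1_powR; rewrite ltW.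
have h2 : 1 <= x `^ a.
  by rewrite [leLHS]E1 ge0_ler_powR// ?nnegrE ?ltW.
by rewrite !ger0_norm ?subr_ge0 ?(ltW x1)// lerD2r.
Qed.

Lemma frac_pos_bound (r : R) : 0 < r -> 0 < frac_pos r < 1.
Proof.
move=> r0; have X0 : 0 < r `^ a by rewrite powR_gt0.
by rewrite /frac_pos divr_gt0 ?addr_gt0//= ltr_pdivrMr ?addr_gt0// mul1r ltrDr.
Qed.

Lemma frac_pos_lip (r : R) : 0 < r -> `|frac_pos r - frac_pos p| <= p `^ (a - 1) * `|r - p|.
Proof.
move=> r0; apply: le_trans (powR_dist r0).
have X0 : 0 < r `^ a by rewrite powR_gt0.
have Y0 : 0 < p `^ a by rewrite powR_gt0.
have -> : frac_pos r - frac_pos p = (r `^ a - p `^ a) / ((1 + r `^ a) * (1 + p `^ a)).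
  by rewrite /frac_pos; field; rewrite !gt_eqF ?addr_gt0.
have M0 : 1 <= (1 + r `^ a) * (1 + p `^ a) by nra.
rewrite normrM (gtr0_norm (x := _^-1)) ?invr_gt0 ?(lt_le_trans _ M0)//.
by rewrite ler_pdivrMr ?(lt_le_trans _ M0)// ler_peMr.
Qed.

Lemma frac_re_dist (r t : R) : 0 < r -> 0 < t <= 1 -> `|frac_re a (r, t) - frac_pos r| <= 1 - cos (a * t).
Proof.
move=> r0 ht; have [c0 s0 ss s1 [/andP[c1 c2] c3]] := small_angle ht.
have X0 : 0 < r `^ a by rewrite powR_gt0.
have n1' : 1 + (r `^ a) ^+ 2 <= sqabs1 a (r, t).
  by rewrite sqabs1E; have := mulr_ge0 (ltW X0) c0; lra.
have n0 : 0 < sqabs1 a (r, t) by apply: lt_le_trans n1'; rewrite ltr_pwDl ?sqr_ge0.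
have -> : frac_re a (r, t) - frac_pos r =
   (1 - cos (a * t)) * (r `^ a * (r `^ a - 1) / ((1 + r `^ a) * sqabs1 a (r, t))).
  rewrite frac_reE ?gt_eqF// /frac_pos; move: n0; rewrite sqabs1E => n0.
  by field; rewrite (gt_eqF n0) gt_eqF ?addr_gt0.
have D0 : 0 < (1 + r `^ a) * sqabs1 a (r, t) by apply: mulr_gt0 => //; apply: addr_gt0.
rewrite normrM (ger0_norm c1) ler_piMr// normrM (gtr0_norm (x := _^-1)) ?invr_gt0//.
rewrite ler_pdivrMr// mul1r normrM gtr0_norm//.
apply: (@le_trans _ _ ((1 + r `^ a) * (1 + (r `^ a) ^+ 2))); last by rewrite ler_pM2l// addr_gt0.
have : `|r `^ a - 1| <= r `^ a + 1 by rewrite (le_trans (ler_normB _ _))// normr1 gtr0_norm.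
nra.
Qed.

Let h2 (r : R) := r `^ 2^-1.

Lemma powR_half_sqr r : 0 < r -> h2 r ^+ 2 = r /\ 0 < h2 r.
Proof.
move=> r0; rewrite /h2 powR_gt0//; split=> //.
by rewrite -powR_mulrn ?powR_ge0// -powRrM mulVf// powRr1// ltW.
Qed.

(** A majorant independent of t, for dominated convergence as t -> 0.  The three
    terms come from remainder = Im f * Re k / r + (Re f - f(r)) Im k / r +
    (f(r) - f(p)) Im k / r with f = z^a / (1 + z^a) and k = 1 / (p - z).  In the
    last one, f(r) - f(p) = O(|r - p|) on r <= 2 p compensates the kernel
    sin t / |p - z|^2 through (r - p)^2 + p r sin(t)^2 >= 2 |r - p| sqrt(p r) sin t;
    for r > 2 p the kernel itself is integrable. *)
Lemma remainder_bound (r t : R) : 0 < r -> 0 < t <= 1 -> `|remainder r t| <=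
  2 * r `^ (a - 1) / (p + r) + 2 / (p ^+ 2 + r ^+ 2) +
  (5 / (p ^+ 2 + r ^+ 2) + (5 * p ^+ 2 * p `^ (a - 1) / h2 p) * ((h2 r)^-1 / (p ^+ 2 + r ^+ 2))).
Proof.
move=> r0 ht; have [c0 s0 ss s1 [/andP[c1 c2] c3]] := small_angle ht.
have S0 : 0 < sin t by apply: lt_le_trans ss.
have X0 : 0 < r `^ a by rewrite powR_gt0.
have [q1 q2] := powR_half_sqr p0; have [q3 q4] := powR_half_sqr r0.
have ht2 : 0 < t < pi *+ 2.
  by case/andP: ht => t0 t1; have pi2 := @pi_ge2 R; rewrite t0 mulr2n; lra.
have N0 := sqabsB_gt0 p0 r0 ht2.
have n1' : 1 <= sqabs1 a (r, t).
  by rewrite sqabs1E; have := mulr_ge0 (ltW X0) c0; have := sqr_ge0 (r `^ a); lra.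
have e1 : (p - r * cos t) ^+ 2 <= sqabsB p (r, t) by rewrite /sqabsB/= lerDl sqr_ge0.
have e2 : (r * sin t) ^+ 2 <= sqabsB p (r, t) by rewrite /sqabsB/= lerDr sqr_ge0.
have e3 : (p * sin t) ^+ 2 <= sqabsB p (r, t) by rewrite sqabsBE2 lerDr sqr_ge0.
have e4 : `|r - p| ^+ 2 + p * r * sin t ^+ 2 <= sqabsB p (r, t).
  rewrite sqabsBE -normrX ger0_norm ?sqr_ge0// -(sqrrN (r - p)) opprB lerD2l.
  have := ler_wpM2l (mulr_ge0 (ltW p0) (ltW r0)) c3; lra.
have D1 : 0 < p ^+ 2 + r ^+ 2 by rewrite addr_gt0// exprn_gt0.
have -> : remainder r t = frac_im a (r, t) * ker_re p (r, t) / r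
    + (frac_re a (r, t) - frac_pos r) * (sin t / sqabsB p (r, t))
    + (frac_pos r - frac_pos p) * (sin t / sqabsB p (r, t)).
  by rewrite /remainder /ker_im/=; field; rewrite !gt_eqF.
apply: (le_trans (ler_normD _ _)); apply: lerD; first apply: (le_trans (ler_normD _ _)); first apply: lerD.
- rewrite /frac_im /ker_re /= !normrM (gtr0_norm X0) (gtr0_norm s0) (gtr0_norm (x := r^-1)) ?invr_gt0//.
  rewrite (gtr0_norm (x := (sqabs1 _ _)^-1)) ?invr_gt0 ?(lt_le_trans _ n1')//.
  rewrite (gtr0_norm (x := (sqabsB _ _)^-1)) ?invr_gt0//.
  have -> : r `^ (a - 1) = r `^ a / r.
    by rewrite powRB ?(gt_eqF r0) ?implybT// powRr1// ltW.
  set X := `|_|.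
  have x1 : X * (p * sin t) <= sqabsB p (r, t) by apply: normrM_le_of_sqr => //; rewrite mulr_ge0 ?ltW.
  have x2 : X * (r * sin t) <= sqabsB p (r, t) by apply: normrM_le_of_sqr => //; rewrite mulr_ge0 ?ltW.
  have -> : r `^ a * sin (a * t) / sqabs1 a (r, t) * (X / sqabsB p (r, t)) / r =
    r `^ a / r * (sin (a * t) / sqabs1 a (r, t) * (X / sqabsB p (r, t))).
    by field; rewrite !gt_eqF// (lt_le_trans _ n1').
  have -> : 2 * (r `^ a / r) / (p + r) = r `^ a / r * (2 / (p + r)) by ring.
  rewrite ler_pM2l ?divr_gt0//.
  apply: (@le_trans _ _ (sin t * (X / sqabsB p (r, t)))).
    apply: ler_wpM2r; first by apply: divr_ge0; [exact: normr_ge0|exact: ltW].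
    by rewrite ler_pdivrMr ?(lt_le_trans _ n1')//; nra.
  rewrite mulrA; apply: ler_pdiv_cross => //; first by rewrite addr_gt0.
  by nra.
- rewrite normrM (gtr0_norm (x := sin t / _)) ?divr_gt0//.
  apply: (@le_trans _ _ (sin t ^+ 2 * (sin t / sqabsB p (r, t)))).
    by rewrite ler_wpM2r ?divr_ge0 ?(ltW S0) ?(ltW N0)// (le_trans (frac_re_dist r0 ht)).
  rewrite mulrA; apply: ler_pdiv_cross => //.
  apply: (@le_trans _ _ (sin t * (2 * sqabsB p (r, t)))); last by rewrite ler_piMl// ltW// mulr_gt0.
  have -> : sin t ^+ 2 * sin t * (p ^+ 2 + r ^+ 2) =
    sin t * ((p * sin t) ^+ 2 + (r * sin t) ^+ 2) by ring.
  by rewrite ler_pM2l//; lra.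
- rewrite normrM (gtr0_norm (x := sin t / _)) ?divr_gt0//.
  have /andP[f1 f2] := frac_pos_bound r0; have /andP[f3 f4] := frac_pos_bound p0.
  have w0 : 0 < p `^ (a - 1) by rewrite powR_gt0.
  have [rp|rp] := leP r (2 * p); last first.
    apply: (@le_trans _ _ (5 / (p ^+ 2 + r ^+ 2))); last first.
      by rewrite lerDl !mulr_ge0 ?invr_ge0// ?ltW// mulr_gt0.
    apply: (@le_trans _ _ (1 * (1 / sqabsB p (r, t)))).
      apply: ler_pM => //; first by rewrite divr_ge0 ?ltW.
        by rewrite ler_norml; apply/andP; split; lra.
      by rewrite ler_wpM2r// invr_ge0 ltW.
    rewrite mul1r; apply: ler_pdiv_cross => //; rewrite mul1r.
    have : (r - p) ^+ 2 <= sqabsB p (r, t).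
      by rewrite sqabsBE -(sqrrN (r - p)) opprB lerDl !mulr_ge0 ?subr_ge0 ?cos_le1 ?(ltW p0) ?(ltW r0).
    nra.
  apply: (@le_trans _ _ ((5 * p ^+ 2 * p `^ (a - 1) / h2 p) * ((h2 r)^-1 / (p ^+ 2 + r ^+ 2)))); last first.
    by rewrite lerDr divr_ge0 ?ltW.
  apply: (@le_trans _ _ (p `^ (a - 1) * (`|r - p| * (sin t / sqabsB p (r, t))))).
    rewrite [leRHS]mulrA; apply: ler_wpM2r; last exact: frac_pos_lip.
    by apply: divr_ge0; exact: ltW.
  have -> : (5 * p ^+ 2 * p `^ (a - 1) / h2 p) * ((h2 r)^-1 / (p ^+ 2 + r ^+ 2)) =
     p `^ (a - 1) * ((h2 p * h2 r)^-1 * (5 * p ^+ 2 / (p ^+ 2 + r ^+ 2))).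
    by field; rewrite !gt_eqF.
  rewrite ler_pM2l//.
  apply: (@le_trans _ _ (h2 p * h2 r)^-1).
    rewrite mulrA ler_pdivrMr// ler_pdivlMl ?mulr_gt0//.
    have e5 : p * r = (h2 p * h2 r) ^+ 2 by rewrite exprMn q1 q3.
    apply: le_trans e4; rewrite e5 -exprMn.
    move: (h2 p * h2 r) (`|r - p|) (sin t) => z x y.
    by have := sqr_ge0 (x - z * y); have := sqr_ge0 (x + z * y); nra.
  rewrite ler_peMr ?invr_ge0 ?(ltW (mulr_gt0 q2 q4))// ler_pdivlMr// mul1r; nra.
Qed.

(** Away from the pole the remainder is O(t), hence tends to 0 pointwise. *)
Lemma remainder_small (r t : R) : 0 < r -> 0 < t <= 1 -> r != p ->
  `|remainder r t| <= t * ((r `^ a / `|p - r|) / r + 2 / `|p - r| ^+ 2).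
Proof.
move=> r0 ht rp; have [c0 s0 ss s1 [/andP[c1 c2] c3]] := small_angle ht.
have S0 : 0 < sin t by apply: lt_le_trans ss.
have X0 : 0 < r `^ a by rewrite powR_gt0.
have ht2 : 0 < t < pi *+ 2.
  by case/andP: ht => t0 t1; have pi2 := @pi_ge2 R; rewrite t0 mulr2n; lra.
have N0 := sqabsB_gt0 p0 r0 ht2.
have n1' : 1 <= sqabs1 a (r, t).
  by rewrite sqabs1E; have := mulr_ge0 (ltW X0) c0; have := sqr_ge0 (r `^ a); lra.
have [k1 k2] := ker_bound p0 r0 ht2 rp.
have st : sin t <= t by case/andP: ht => t0 _; exact: sin_le_id (ltW t0).
have d0 : 0 < `|p - r| by rewrite normr_gt0 subr_eq0 eq_sym.
have /andP[f1 f2] := frac_pos_bound r0; have /andP[f3 f4] := frac_pos_bound p0.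
have fb : `|frac_re a (r, t) - frac_pos p| <= 2.
  have h := frac_re_dist r0 ht.
  have -> : frac_re a (r, t) - frac_pos p = (frac_re a (r, t) - frac_pos r) + (frac_pos r - frac_pos p) by ring.
  rewrite (le_trans (ler_normD _ _))//.
  have : `|frac_pos r - frac_pos p| <= 1 by rewrite ler_norml; apply/andP; split; lra.
  by lra.
have -> : remainder r t = frac_im a (r, t) * ker_re p (r, t) / r
    + (frac_re a (r, t) - frac_pos p) * (sin t / sqabsB p (r, t)).
  by rewrite /remainder /ker_im/=; field; rewrite !gt_eqF.
rewrite mulrDr (le_trans (ler_normD _ _))//; apply: lerD.
  have nm (x y z : R) : 0 < z -> `|x * y / z| = `|x| * `|y| / z.
    by move=> z0; rewrite !normrM (gtr0_norm (x := z^-1)) ?invr_gt0.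
  rewrite nm// mulrA ler_pM2r ?invr_gt0// mulrA; apply: ler_pM => //.
  have n0 := lt_le_trans ltr01 n1'.
  rewrite /frac_im/= nm// (gtr0_norm X0) (gtr0_norm s0) ler_pdivrMr//.
  rewrite [leRHS](_ : _ = r `^ a * (t * sqabs1 a (r, t))) ?ler_pM2l//; last by ring.
  by rewrite (le_trans ss)// (le_trans st)// ler_peMr// (le_trans _ st)// ltW.
rewrite normrM (gtr0_norm (x := sin t / _)) ?divr_gt0// mulrCA.
have S0' := ltW S0; have N0' := ltW N0.
apply: ler_pM => //; rewrite ?divr_ge0//.
apply: ler_pM => //; rewrite ?invr_ge0//.
rewrite lef_pV2 ?posrE ?exprn_gt0// -normrX ger0_norm ?sqr_ge0//.
by rewrite sqabsBE lerDl !mulr_ge0 ?subr_ge0 ?cos_le1 ?(ltW p0) ?(ltW r0).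
Qed.

End StieltjesRest.

(** * The Poisson kernel near the positive axis *)

Section PoissonKernel.
Context {R : realType}.

Lemma cvg_near_dist (u v c : R^nat) (l : R) : v @ \oo --> l -> c @ \oo --> 0 ->
  (\forall n \near \oo, `|u n - v n| <= c n) -> u @ \oo --> l.
Proof.
move=> vl c0 uv; have -> : u = (fun n => (u n - v n) + v n) by apply/funext => n; rewrite subrK.
rewrite -[l]add0r; apply: cvgD => //; apply: norm_cvg0.
apply: (@squeeze_cvgr _ _ _ _ (fun=> 0) c) => //; last exact: cvg_cst.
by apply: filterS uv => n ->; rewrite normr_ge0.
Qed.

Lemma near_Sn_ge (A : R) : \forall n \near \oo, A <= n.+1%:R.
Proof.
near=> n; rewrite (le_trans (ler_norm A))// (le_trans (ltW (truncnS_gt _)))// ler_nat ltnS.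
by near: n; exact: nbhs_infty_ge.
Unshelve. all: end_near. Qed.

Lemma cvgy_of_linear_ge (u : R^nat) (k : R) : 0 < k ->
  (\forall n \near \oo, k * n.+1%:R <= u n) -> u @ \oo --> +oo.
Proof.
move=> k0 h; apply/cvgryPge => A; have h' := near_Sn_ge (A / k).
near=> n; have hn : k * n.+1%:R <= u n by near: n.
by apply: le_trans hn; rewrite mulrC -ler_pdivrMr//; near: n.
Unshelve. all: end_near. Qed.

Variables (a p : R).
Hypotheses (a0 : 0 < a) (a1 : a < 1) (p0 : 0 < p).

Lemma ker_im_continuous t : 0 < t < pi *+ 2 -> forall r : R, 0 < r ->
  {for r, continuous (fun r : R => ker_im p (r, t) / r)} /\ {for r, continuous (fun r : R => ker_im p (r, t))}.
Proof.
move=> ht r r0; have N0 := sqabsB_gt0 p0 r0 ht.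
have cn : {for r, continuous (fun r : R => sqabsB p (r, t))}.
  have cl (c k : R) : {for r, continuous (fun r : R => c + r * k)}.
    by apply: cvgD; [exact: cvg_cst|apply: cvgM; [exact: cvg_id|exact: cvg_cst]].
  rewrite (_ : (fun r : R => sqabsB p (r, t)) =
    (fun r : R => (p + r * - cos t) * (p + r * - cos t) + (0 + r * sin t) * (0 + r * sin t))); last first.
    by apply/funext => x; rewrite /sqabsB/=; ring.
  by apply: cvgD; apply: cvgM; [exact: (cl p)|exact: (cl p)| exact: (cl 0)|exact: (cl 0)].
have ck : {for r, continuous (fun r : R => ker_im p (r, t))}.
  apply: (@cvgM _ _ _ _ (fun r : R => r * sin t) (fun r : R => (sqabsB p (r, t))^-1)).
    by apply: cvgM; [exact: cvg_id|exact: cvg_cst].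
  by apply: cvgV => //; rewrite gt_eqF.
split=> //; apply: cvgM => //.
by apply: cvgV; [rewrite gt_eqF|exact: cvg_id].
Qed.

Lemma prod_im_continuous t : 0 < t <= pi -> forall r : R, 0 < r ->
  {for r, continuous (fun r : R => prod_im a p (r, t) / r)}.
Proof.
move=> /andP[t0 tpi] r r0.
have pi_gt := pi_gt0 R.
set v := Num.min (pi / a) (pi *+ 2).
have v1 : a * v <= pi by rewrite -ler_pdivlMl// mulrC ge_min lexx.
have v2 : v <= pi *+ 2 by rewrite ge_min lexx orbT.
have tv : t < v.
  rewrite lt_min (le_lt_trans tpi)/=; last by rewrite ltr_pdivlMr// gtr_pMr.
  by rewrite (le_lt_trans tpi)// mulr2n ltrDl.
have [A [B h]] := holo_prod a0 p0 v1 v2.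
have [_ [_ [_ c _ _]]] := h (r, t) (conj r0 (introT andP (conj t0 tv))).
apply: cvgM; first exact: continuous_slice1.
by apply: cvgV; [rewrite gt_eqF|exact: cvg_id].
Qed.

Lemma remainderE r t : remainder a p r t = prod_im a p (r, t) / r - frac_pos a p * (ker_im p (r, t) / r).
Proof. by rewrite /remainder /prod_im; ring. Qed.

Lemma remainder_continuous t : 0 < t <= pi -> forall r : R, 0 < r ->
  {for r, continuous (fun r : R => remainder a p r t)}.
Proof.
move=> ht r r0.
have ht2 : 0 < t < pi *+ 2.
  by case/andP: ht => -> h; rewrite (le_lt_trans h)// mulr2n ltrDl pi_gt0.
have -> : (fun r : R => remainder a p r t) = (fun r : R => prod_im a p (r, t) / r - frac_pos a p * (ker_im p (r, t) / r)).
  by apply/funext => x; exact: remainderE.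
apply: cvgD; first exact: (prod_im_continuous ht r0).
apply: cvgN; apply: cvgM; first exact: cvg_cst.
by have [] := ker_im_continuous ht2 r0.
Qed.

(** The integrand is p sin t / ((r - p cos t)^2 + (p sin t)^2), up to 1/p. *)
Lemma Rintegral_ker_im (b c t : R) : 0 < b -> b <= c -> 0 < t < pi ->
  \int[mu]_(r in `[b, c]) (ker_im p (r, t) / r) =
  p^-1 * (atan ((c - p * cos t) / (p * sin t)) - atan ((b - p * cos t) / (p * sin t))).
Proof.
move=> b0 bc ht; have s0 : 0 < sin t by exact: sin_gt0_pi.
have ht2 : 0 < t < pi *+ 2.
  by case/andP: ht => -> h; rewrite (lt_trans h)// mulr2n ltrDl pi_gt0.
have rp r : b <= r <= c -> 0 < r by move=> /andP[/(lt_le_trans b0)].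
have cc r : b <= r <= c -> {for r, continuous (fun r : R => ker_im p (r, t) / r)}.
  by move=> /rp r0; have [] := ker_im_continuous ht2 r0.
have dd (r : R) : b <= r <= c -> is_derive r 1 (fun r : R => p^-1 * atan ((r - p * cos t) / (p * sin t)))
    (ker_im p (r, t) / r).
  move=> /rp r0; have N0 := sqabsB_gt0 p0 r0 ht2.
  have d1 : is_derive r 1 (fun r : R => (r - p * cos t) / (p * sin t)) (p * sin t)^-1.
    by apply: is_derive_eq; rewrite /GRing.scale/=; ring.
  have d2 := @is_derive1_comp _ (@atan R) (fun r : R => (r - p * cos t) / (p * sin t)) r _ _ (is_derive1_atan _) d1.
  have d3 := is_deriveZ p^-1 d2.
  apply: (is_derive_eq d3).
  rewrite /GRing.scale/= /ker_im/=; move: N0; rewrite sqabsBE2 => N0.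
  field; rewrite !gt_eqF//.
by rewrite /Rintegral (integral_FTC_cc bc dd cc)/= mulrBr.
Qed.

Let tn (n : nat) : R := n.+1%:R^-1.

Lemma invSn_01 n : 0 < tn n <= 1.
Proof. by rewrite /tn invr_gt0 ltr0n/= invf_le1 ?ler1n. Qed.

Lemma cvg_invSn : tn @ \oo --> 0. Proof. exact: cvg_harmonic. Qed.

Lemma invSn_pi n : 0 < tn n <= pi.
Proof. by have /andP[-> h] := invSn_01 n; rewrite (le_trans h)// (le_trans _ (@pi_ge2 R))// ler1n. Qed.

(** Along t = 1/(n+1) and r from 1/(n+1) to n+1 the two arctangents tend to pi/2
    and -pi/2, which is where the factor pi of the Stieltjes formula comes from. *)
Lemma cvg_Rintegral_ker_im :
  \int[mu]_(r in `[1 / n.+1%:R, 1 * n.+1%:R]) (ker_im p (r, tn n) / r) @[n --> \oo] --> pi / p.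
Proof.
have pi2 := @pi_ge2 R.
have E n : \int[mu]_(r in `[1 / n.+1%:R, 1 * n.+1%:R]) (ker_im p (r, tn n) / r) =
  p^-1 * (atan ((1 * n.+1%:R - p * cos (tn n)) / (p * sin (tn n))) +
    atan (- ((1 / n.+1%:R - p * cos (tn n)) / (p * sin (tn n))))).
  rewrite atanN Rintegral_ker_im ?divr_gt0//.
    by rewrite !mul1r (@le_trans _ _ 1)// ?ler1n// invf_le1 ?ler1n.
  by have /andP[-> h] := invSn_01 n; rewrite (le_lt_trans h)//; lra.
under eq_cvg do rewrite E.
rewrite (_ : pi / p = p^-1 * (pi / 2 + pi / 2)); last by rewrite -splitr mulrC.
apply: cvgM; first exact: cvg_cst.
have st n : 0 < sin (tn n) <= 1 /\ sin (tn n) <= tn n.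
  have /andP[t0 t1] := invSn_01 n.
  rewrite sin_le1 sin_gt0_pi; last by rewrite t0 (le_lt_trans t1)//; lra.
  by split=> //; exact: sin_le_id (ltW t0).
apply: cvgD; (apply: (@cvg_comp _ _ _ _ (@atan R) _ +oo); last exact: cvgy_atan).
- apply: (@cvgy_of_linear_ge _ ((2 * p)^-1)); first by rewrite invr_gt0 mulr_gt0.
  near=> n.
  have [/andP[s0 s1] _] := st n.
  have h : 2 * p <= n.+1%:R by near: n; exact: near_Sn_ge.
  rewrite mul1r ler_pdivlMr ?mulr_gt0// -mulrA ler_pdivrMl ?mulr_gt0//.
  have := cos_le1 (tn n) => c1.
  have e1 : p * cos (tn n) <= p by rewrite ler_piMr// ltW.
  have e2 : p * sin (tn n) <= p by rewrite ler_piMr// ltW.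
  have n0 : 0 <= n.+1%:R :> R by [].
  have := ler_wpM2l n0 e2; have := ler_wpM2l (ltW p0) h; have := ler_wpM2l (ltW p0) e1.
  by move: (n.+1%:R) (p * cos (tn n)) (p * sin (tn n)) => m y z; lra.
- apply: (@cvgy_of_linear_ge _ (4^-1)); first by rewrite invr_gt0.
  near=> n.
  have [/andP[s0 s1] s2] := st n.
  have h : (4 / p) <= n.+1%:R by near: n; exact: near_Sn_ge.
  have h2 : 2 <= n.+1%:R :> R by near: n; exact: near_Sn_ge.
  have n0 : 0 < n.+1%:R :> R by [].
  have t2 : tn n <= 2^-1 by rewrite /tn lef_pV2 ?posrE.
  have t4 : tn n <= p / 4 by rewrite /tn -[p / 4]invrK lef_pV2 ?posrE ?invr_gt0 ?divr_gt0// invf_div.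
  have t0 : 0 < tn n by rewrite /tn invr_gt0.
  have c2 : 2^-1 <= cos (tn n).
    have := cos2Dsin2 (tn n).
    have cpos : 0 <= cos (tn n) by apply: cos_ge0_pihalf; lra.
    by have := cos_le1 (tn n); nra.
  rewrite -mulNr ler_pdivlMr ?mulr_gt0// mul1r -/(tn n) opprB.
  apply: (@le_trans _ _ (4^-1 * n.+1%:R * (p * tn n))).
    by rewrite ler_pM2l ?mulr_gt0 ?invr_gt0// ler_pM2l.
  rewrite (_ : 4^-1 * n.+1%:R * (p * tn n) = p / 4); last by rewrite /tn; field; rewrite addrC natr1 gt_eqF.
  by nra.
Unshelve. all: end_near. Qed.

End PoissonKernel.

Section RemainderLimit.
Context {R : realType}.
Variables (a p : R).
Hypotheses (a0 : 0 < a) (a1 : a < 1) (p0 : 0 < p).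

Let tn (n : nat) : R := n.+1%:R^-1.
Let J n : set R := `[1 / n.+1%:R, 1 * n.+1%:R]%classic.

Lemma itv_invSn_gt0 n (r : R) : 1 / n.+1%:R <= r <= 1 * n.+1%:R -> 0 < r.
Proof. by move=> /andP[+ _]; apply: lt_le_trans; rewrite divr_gt0. Qed.

Lemma cvg_Rintegral_remainder : \int[mu]_(r in J n) remainder a p r (tn n) @[n --> \oo] --> (0 : R).
Proof.
pose h2 (r : R) := r `^ 2^-1.
pose g (r : R) := 2 * r `^ (a - 1) / (p + r) + 2 / (p ^+ 2 + r ^+ 2) +
  (5 / (p ^+ 2 + r ^+ 2) + (5 * p ^+ 2 * p `^ (a - 1) / h2 p) * ((h2 r)^-1 / (p ^+ 2 + r ^+ 2))).
have mR := @measurable_Rpos R.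
have sub n : J n `&` Rpos R = J n.
  by apply: setIidl; apply: itv_sub_oy; rewrite divr_gt0.
have E n : \int[mu]_(r in J n) remainder a p r (tn n) =
    \int[mu]_(r in Rpos R) (((fun r : R => remainder a p r (tn n)) \_ (J n)) r).
  by rewrite -[in LHS](sub n) Rintegral_mkcondl.
under eq_cvg do rewrite E.
have tpi n : 0 < tn n <= pi by exact: invSn_pi.
have mf n : measurable_fun (Rpos R) ((fun r : R => remainder a p r (tn n)) \_ (J n)).
  apply/measurable_restrict => //; first exact: measurable_itv.
  by apply: measurable_funS (measurable_oy (remainder_continuous a0 a1 p0 (tpi n))).
apply: (Rdominated_cvg_off_point (c := p) (g := g)) => //.
- move=> r /=; rewrite in_itv/= andbT => r0 rp.
  pose k := (r `^ a / `|p - r|) / r + 2 / `|p - r| ^+ 2.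
  apply: (@cvg_near_dist _ _ (fun=> 0) (fun n => tn n * k)); first exact: cvg_cst.
    rewrite -[X in _ --> X](mul0r k); apply: cvgM; [exact: cvg_invSn|exact: cvg_cst].
  apply: nearW => n; rewrite subr0 patchE.
  have /andP[t0 t1] := @invSn_01 R n.
  case: ifPn => _; last by rewrite normr0 mulr_ge0 ?(ltW t0)// addr_ge0// !divr_ge0 ?powR_ge0 ?(ltW r0) ?sqr_ge0.
  by apply: remainder_small => //; exact: invSn_01.
- move=> n r /=; rewrite in_itv/= andbT => r0; rewrite patchE.
  case: ifPn => _; first by apply: remainder_bound => //; exact: invSn_01.
  have [q1 q2] := powR_half_sqr p0; have [q3 q4] := powR_half_sqr r0.
  have D1 : 0 < p ^+ 2 + r ^+ 2 by rewrite addr_gt0// exprn_gt0.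
  rewrite normr0 /g; apply/ltW.
  by rewrite !addr_gt0 ?divr_gt0 ?mulr_gt0 ?invr_gt0 ?powR_gt0 ?exprn_gt0 ?addr_gt0 ?exprn_gt0.
- have cD (r : R) : 0 < r -> {for r, continuous (fun r : R => p ^+ 2 + r ^+ 2)}.
    move=> r0; apply: cvgD; first exact: cvg_cst.
    exact: (@exprn_continuous R 2 r).
  have cV (r : R) : 0 < r -> {for r, continuous (fun r : R => (p ^+ 2 + r ^+ 2)^-1)}.
    move=> r0; apply: cvgV; last exact: cD.
    by rewrite gt_eqF// addr_gt0// exprn_gt0.
  have bV (r : R) : 0 < r -> (p ^+ 2 + r ^+ 2)^-1 <= (p^-1) ^+ 2 /\ (p ^+ 2 + r ^+ 2)^-1 <= (r ^+ 2)^-1.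
    move=> r0; rewrite exprVn !lef_pV2 ?posrE ?addr_gt0 ?exprn_gt0//.
    by rewrite lerDl lerDr !sqr_ge0.
  have V0 (r : R) : 0 < r -> 0 < (p ^+ 2 + r ^+ 2)^-1.
    by move=> r0; rewrite invr_gt0 addr_gt0 ?exprn_gt0.
  have pw (r x : R) : 0 < r -> r ^+ 2 = r `^ 2 by move=> r0; rewrite -powR_mulrn ?ltW.
  have i1 : mu.-integrable (Rpos R) (EFin \o (fun r : R => (p ^+ 2 + r ^+ 2)^-1)).
    apply: (@integrable_oy _ 1 (1 + p^-1 ^+ 2)) => //; first exact: measurable_oy.
    + move=> r /andP[r0 r1]; rewrite subrr powRr0 mulr1 ger0_norm ?(ltW (V0 _ r0))//.
      by have [h _] := bV r r0; rewrite (le_trans h)// lerDr.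
    + move=> r r1; have r0 := lt_le_trans ltr01 r1.
      have [_ h] := bV r r0; rewrite ger0_norm ?(ltW (V0 _ r0))// (le_trans h)//.
      rewrite (_ : - 1 - 1 = - 2); last by ring.
      by rewrite powRN (powR_mulrn 2) ?(ltW r0)// ler_peMl ?invr_ge0 ?exprn_ge0 ?(ltW r0)// lerDl sqr_ge0.
  have i2 : mu.-integrable (Rpos R) (EFin \o (fun r : R => (h2 r)^-1 / (p ^+ 2 + r ^+ 2))).
    apply: (@integrable_oy _ (2^-1) (1 + p^-1 ^+ 2)) => //.
    + apply: measurable_oy => r r0; apply: cvgM; last exact: cV.
      by apply: cvgV; [rewrite gt_eqF// powR_gt0|exact: continuous_powR_pos].
    + move=> r /andP[r0 r1]; have [_ q4] := powR_half_sqr r0.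
      rewrite ger0_norm ?mulr_ge0 ?invr_ge0 ?(ltW q4) ?(ltW (V0 _ r0))//; last by rewrite -invr_ge0 ltW// V0.
      rewrite (_ : 2^-1 - 1 = - 2^-1); last by field.
      rewrite powRN mulrC ler_wpM2r ?invr_ge0 ?(ltW q4)//.
      by have [h _] := bV r r0; rewrite (le_trans h)// lerDr.
    + move=> r r1; have r0 := lt_le_trans ltr01 r1; have [_ q4] := powR_half_sqr r0.
      rewrite ger0_norm ?mulr_ge0 ?invr_ge0 ?(ltW q4) ?(ltW (V0 _ r0))//; last by rewrite -invr_ge0 ltW// V0.
      rewrite powRB ?(gt_eqF r0) ?implybT// powRr1 ?(ltW r0)// powRN.
      have [_ h] := bV r r0; rewrite mulrCA ler_pM2l ?invr_gt0//.
      apply: (le_trans h).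
      apply: (@le_trans _ _ r^-1).
        by rewrite lef_pV2 ?posrE ?exprn_gt0// expr2 ler_pMl.
      by rewrite ler_peMl ?invr_ge0 ?(ltW r0)// lerDl sqr_ge0.
  have i3 : mu.-integrable (Rpos R) (EFin \o (fun r : R => r `^ (a - 1) / (p + r))).
    have cp (r : R) : 0 < r -> {for r, continuous (fun r : R => (p + r)^-1)}.
      move=> r0; apply: cvgV; first by rewrite gt_eqF// addr_gt0.
      by apply: cvgD; [exact: cvg_cst|exact: cvg_id].
    have b1 (r : R) : 0 < r -> (p + r)^-1 <= p^-1 /\ (p + r)^-1 <= r^-1.
      by move=> r0; rewrite !lef_pV2 ?posrE ?addr_gt0// lerDl lerDr !ltW.
    have pn (r : R) : 0 < r -> 0 <= r `^ (a - 1) / (p + r).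
      by move=> r0; rewrite divr_ge0 ?powR_ge0 ?ltW// addr_gt0.
    apply: (@integrable_oy_two _ a (1 - a) (1 + p^-1)) => //; first by rewrite subr_gt0.
    + by apply: measurable_oy => r r0; apply: cvgM; [exact: continuous_powR_pos|exact: cp].
    + move=> r /andP[r0 r1]; rewrite ger0_norm ?pn// mulrC ler_wpM2r ?powR_ge0//.
      by have [h _] := b1 r r0; rewrite (le_trans h)// lerDr.
    + move=> r r1; have r0 := lt_le_trans ltr01 r1; rewrite ger0_norm ?pn//.
      rewrite (_ : - (1 - a) - 1 = (a - 1) - 1); last by ring.
      rewrite [leRHS](_ : _ = r `^ (a - 1) * ((1 + p^-1) / r)); last first.
        by rewrite (@powRB _ _ (a - 1)) ?(gt_eqF r0) ?implybT// powRr1 ?(ltW r0)//; ring.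
      rewrite ler_wpM2l ?powR_ge0//.
      have [_ h] := b1 r r0; rewrite (le_trans h)// ler_peMl ?invr_ge0 ?(ltW r0)//.
      by rewrite lerDl invr_ge0 ltW.
  have := integrableDR mR (integrableDR mR (integrableZR 2 mR i3) (integrableZR 2 mR i1))
    (integrableDR mR (integrableZR 5 mR i1) (integrableZR (5 * p ^+ 2 * p `^ (a - 1) / h2 p) mR i2)).
  by apply: eq_integrable => // r _ /=; rewrite /g; congr (_ + _ + _)%:E; rewrite mulrA.
Qed.

End RemainderLimit.

(** * The Stieltjes transform of the Mittag-Leffler spectral density *)

Section StieltjesFormula.
Context {R : realType}.
Variables (a p : R).
Hypotheses (a0 : 0 < a) (a1 : a < 1) (p0 : 0 < p).

Let tn (n : nat) : R := n.+1%:R^-1.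
Let J n : set R := `[1 / n.+1%:R, 1 * n.+1%:R]%classic.

Lemma integrable_itv_invSn n (f : R -> R) : (forall r : R, 0 < r -> {for r, continuous f}) ->
  mu.-integrable (J n) (EFin \o f).
Proof.
by move=> cf; apply: continuous_integrable_cc => r /itv_invSn_gt0; exact: cf.
Qed.

Lemma cvg_Rintegral_prod_im : \int[mu]_(r in J n) (prod_im a p (r, tn n) / r) @[n --> \oo] -->
  frac_pos a p * (pi / p).
Proof.
have tpi2 n : 0 < tn n < pi *+ 2.
  by have /andP[-> h] := @invSn_pi R n; rewrite (le_lt_trans h)// mulr2n ltrDl pi_gt0.
have E n : \int[mu]_(r in J n) (prod_im a p (r, tn n) / r) =
   frac_pos a p * \int[mu]_(r in J n) (ker_im p (r, tn n) / r) + \int[mu]_(r in J n) remainder a p r (tn n).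
  have mJ : measurable (J n : set (measurableTypeR R)) by exact: measurable_itv.
  have i1 : mu.-integrable (J n) (EFin \o (fun r : R => ker_im p (r, tn n) / r)).
    by apply: integrable_itv_invSn => r r0; have [] := ker_im_continuous p0 (tpi2 n) r0.
  have i2 : mu.-integrable (J n) (EFin \o (fun r : R => remainder a p r (tn n))).
    by apply: integrable_itv_invSn => r r0; apply: remainder_continuous => //; exact: invSn_pi.
  rewrite -RintegralZl// -RintegralD//; last exact: integrableZR.
  by apply: eq_Rintegral => r _; rewrite remainderE addrC subrK.
under eq_cvg do rewrite E.
rewrite (_ : frac_pos a p * _ = frac_pos a p * (pi / p) + 0); last by rewrite addr0.
apply: cvgD; last exact: cvg_Rintegral_remainder.
by apply: cvgM; [exact: cvg_cst|exact: cvg_Rintegral_ker_im].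
Qed.

(** Cauchy's theorem moves the integral from the angle 1/(n+1) to the cut t = pi.
    The two arcs cost O((1/n)^a) near 0 and O(1/n) at infinity. *)
Lemma cvg_Rintegral_prod_im_pi : \int[mu]_(r in J n) (prod_im a p (r, pi) / r) @[n --> \oo] -->
  frac_pos a p * (pi / p).
Proof.
have pi_gt := pi_gt0 R.
(* The product is holomorphic up to the angle v > pi, that is beyond the cut, but
   before 1 + z^a can vanish and before the positive axis is met again. *)
set v := Num.min (pi / a) (pi *+ 2).
have v1 : a * v <= pi by rewrite -ler_pdivlMl// mulrC ge_min lexx.
have v2 : v <= pi *+ 2 by rewrite ge_min lexx orbT.
have piv : pi < v.
  rewrite lt_min mulr2n ltrDl pi_gt andbT ltr_pdivlMr// gtr_pMr//.
have [A [B h]] := holo_prod a0 p0 v1 v2.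
have sg0 := sin_mulpi_gt0 a0 a1.
set sg := sin (a * pi) in sg0.
pose c n := (4 / (sg * p) * (tn n `^ a) + 4 / sg * tn n) * pi.
have c0 : c @ \oo --> 0.
  rewrite /c -(mul0r pi); apply: cvgM; last exact: cvg_cst.
  rewrite -(addr0 0); apply: cvgD.
    rewrite -(mulr0 (4 / (sg * p))); apply: cvgM; first exact: cvg_cst.
    have /cvg_at_rightP h0 := powR_cvg0 a0.
    by apply: h0; split; [move=> n; rewrite /tn invr_gt0|exact: cvg_invSn].
  by rewrite -(mulr0 (4 / sg)); apply: cvgM; [exact: cvg_cst|exact: cvg_invSn].
apply: (cvg_near_dist cvg_Rintegral_prod_im c0); near=> n.
have e1 : 2 <= n.+1%:R :> R by near: n; exact: near_Sn_ge.
have e2 : 2 * p <= n.+1%:R by near: n; exact: near_Sn_ge.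
have e3 : 2 / p <= n.+1%:R by near: n; exact: near_Sn_ge.
have n0 : 0 < n.+1%:R :> R by [].
have t0 : 0 < tn n by rewrite /tn invr_gt0.
have tp : tn n <= p / 2 by rewrite /tn -[p / 2]invrK lef_pV2 ?posrE ?invr_gt0 ?divr_gt0// invf_div.
have t1 : tn n <= 2^-1 by rewrite /tn lef_pV2 ?posrE.
have pi2 := @pi_ge2 R.
have an0 : 0 < 1 / n.+1%:R :> R by rewrite divr_gt0.
have ab : 1 / n.+1%:R < 1 * n.+1%:R :> R.
  by rewrite !mul1r -/(tn n); apply: (le_lt_trans t1); lra.
have DK r t : 1 / n.+1%:R <= r <= 1 * n.+1%:R -> tn n / 2 <= t <= (pi + v) / 2 ->
    [set z : R * R | 0 < z.1 /\ 0 < z.2 < v] (r, t).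
  move=> /itv_invSn_gt0 r0 /andP[h1 h2] /=; split=> //.
  by apply/andP; split; [apply: lt_le_trans h1; rewrite divr_gt0|lra].
have PC t : tn n <= t <= pi -> `|prod_re a p (1 * n.+1%:R, t) - prod_re a p (1 / n.+1%:R, t)| <=
    4 / (sg * p) * (tn n `^ a) + 4 / sg * tn n.
  move=> /andP[h1 h2]; have ht : 0 < t <= pi by rewrite h2 andbT (lt_le_trans t0).
  rewrite (le_trans (ler_normB _ _))// addrC; apply: lerD.
    have an : 1 / n.+1%:R = tn n by rewrite mul1r.
    rewrite an.
    have [|h3 _] := prod_re_bound a0 a1 p0 t0 ht; first by rewrite lt_eqF//; lra.
    apply: (le_trans h3); rewrite (_ : 4 / (sg * p) * tn n `^ a = (2 * (tn n `^ a / sg)) / (p / 2)).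
      apply: ler_wpM2l; first by rewrite mulr_ge0// divr_ge0 ?powR_ge0 ?ltW.
      by rewrite lef_pV2 ?posrE ?divr_gt0 ?ger0_norm//; lra.
    by field; rewrite !gt_eqF.
  rewrite mul1r; have [|_ h3] := prod_re_bound a0 a1 p0 n0 ht; first by rewrite gt_eqF//; lra.
  apply: (le_trans h3); rewrite (_ : 4 / sg * tn n = 2 * sg^-1 / (n.+1%:R / 2)).
    apply: ler_wpM2l; first by rewrite mulr_ge0// invr_ge0 ltW.
    by rewrite lef_pV2 ?posrE ?divr_gt0 ?ler0_norm//; lra.
  by rewrite /tn; field; rewrite !gt_eqF// addrC natr1.
have := holo_rectangle h an0 ab (_ : tn n / 2 < tn n) _ (_ : pi < (pi + v) / 2) DK PC.
move=> /(_ ltac:(lra) ltac:(lra) ltac:(lra)) hh.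
apply: (le_trans hh); rewrite /c; apply: ler_wpM2l; last lra.
by rewrite addr_ge0// mulr_ge0 ?divr_ge0 ?powR_ge0 ?mulr_ge0 ?ltW.
Unshelve. all: end_near. Qed.

(** On the cut, Im (z^a / (1 + z^a)) is the spectral density, and 1 / (p - z) becomes
    1 / (p + r).  This is the Cauchy integral formula at the point p for the
    function z^a / (1 + z^a), which is holomorphic off the negative axis. *)
Lemma stieltjes :
  (\int[mu]_(r in Rpos R) (frac_im a (r, pi) / (r * (p + r)))%:E = (pi * (frac_pos a p / p))%:E)%E.
Proof.
have kE (r : R) : 0 < r -> prod_im a p (r, pi) / r = frac_im a (r, pi) / (r * (p + r)).
  move=> r0; rewrite /prod_im /ker_im /ker_re /sqabsB/= sinpi cospi !mulr0 mul0r mulr0 add0r mulrN1 opprK expr0n/= addr0.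
  by field; rewrite !gt_eqF// addr_gt0.
have c1 (r : R) : 0 < r -> {for r, continuous (fun r => prod_im a p (r, pi) / r)}.
  by move=> r0; apply: prod_im_continuous => //; rewrite pi_gt0 lexx.
have f0 (r : R) : 0 < r -> 0 <= prod_im a p (r, pi) / r.
  move=> r0; rewrite kE//; apply: divr_ge0; last by rewrite mulr_ge0 ?addr_ge0 ?ltW.
  have s0 := sin_mulpi_gt0 a0 a1.
  rewrite /frac_im/= divr_ge0 ?mulr_ge0 ?powR_ge0 ?(ltW s0)// sqabs1E2.
  by rewrite addr_ge0 ?sqr_ge0.
have -> : (\int[mu]_(r in Rpos R) (frac_im a (r, pi) / (r * (p + r)))%:E =
    \int[mu]_(r in Rpos R) (prod_im a p (r, pi) / r)%:E)%E.
  by apply: eq_integral => r; rewrite inE/= in_itv/= andbT => r0; rewrite kE.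
have h1 := cvg_integral_oy (@ltr01 R) (measurable_oy c1) f0.
apply: (cvg_unique _ h1); rewrite //=.
rewrite (_ : pi * (frac_pos a p / p) = frac_pos a p * (pi / p)); last by ring.
have : (\int[mu]_(r in J n) (prod_im a p (r, pi) / r))%:E @[n --> \oo] --> (frac_pos a p * (pi / p))%:E.
  by apply: cvg_EFin; [exact: nearW|exact: cvg_Rintegral_prod_im_pi].
apply: cvg_trans; apply: near_eq_cvg; apply: nearW => n /=.
by rewrite /Rintegral fineK//; apply: integrable_fin_num; [exact: measurable_itv|exact: integrable_itv_invSn].
Qed.

End StieltjesFormula.

(** * Uniqueness through concentrating kernels *)

Section Concentration.
Context {R : realType}.

(** Powers of a kernel that exceeds 1 near a point where G > 0, and that has
    modulus at most 1 wherever G or the kernel may be negative, make the integral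
    of G * kap^k blow up: the good interval contributes c q^k (v - u), and the bad
    set at most the integral of |G|.  So if these integrals are known to be
    bounded, then G is not positive at that point.  This is applied to the
    uniqueness of Laplace transforms and to the completeness of the sines. *)
Lemma concentration (D : set (measurableTypeR R)) (G kap : R -> R) (u v c q K : R) :
  measurable D -> mu.-integrable D (EFin \o G) -> measurable_fun D kap ->
  (forall x : R, D x -> `|kap x| <= K) ->
  (forall x : R, D x -> `|kap x| <= 1 \/ 0 <= G x /\ 0 <= kap x) ->
  u < v -> `]u, v[%classic `<=` D ->
  (forall x : R, u < x < v -> c <= G x /\ q <= kap x) -> 0 < c -> 1 < q ->
  (forall k, mu.-integrable D (EFin \o (fun x => G x * kap x ^+ k))) /\
  forall M, exists k, M < \int[mu]_(x in D) (G x * kap x ^+ k).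
Proof.
move=> mD iG mk kK hk uv uvD hC c0 q1.
have mG : measurable_fun D G by case/integrableP : iG => /measurable_EFinP.
have iN : mu.-integrable D (EFin \o (fun x => `|G x|)) by exact: integrable_norm.
have ik k : mu.-integrable D (EFin \o (fun x => G x * kap x ^+ k)).
  apply: (le_integrableR (g := fun x => K ^+ k * `|G x|)) => //; last exact: integrableZR.
    by apply: measurable_funM => //; exact: measurable_funX.
  move=> x Dx; rewrite normrM mulrC ler_wpM2r// normrX lerXn2r ?nnegrE//; last exact: kK.
  exact: le_trans (kK _ Dx).
split=> // M.
set I0 := \int[mu]_(x in D) `|G x|.
have low k : c * q ^+ k * (v - u) - I0 <= \int[mu]_(x in D) (G x * kap x ^+ k).
  (* Adding |G| makes the integrand nonnegative on all of D. *)
  rewrite lerBlDr -RintegralD//; apply: Rintegral_ge_itv => //.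
  - exact: integrableDR.
  - move=> x Dx; have [h|[h1 h2]] := hk x Dx; last by rewrite addr_ge0// mulr_ge0// exprn_ge0.
    rewrite -lerBlDr sub0r lerNl (le_trans (ler_norm _))// normrN normrM ler_piMr// normrX.
    by rewrite exprn_ile1.
  - move=> x /hC[h1 h2]; rewrite (@le_trans _ _ (G x * kap x ^+ k))// ?lerDl//.
    apply: ler_pM => //; [exact: ltW|by rewrite exprn_ge0// ltW// (lt_trans ltr01)|].
    by rewrite lerXn2r ?nnegrE// ?(le_trans _ h2)// ltW// (lt_trans ltr01).
have [k hk'] : exists k, (M + I0) / (c * (v - u)) < q ^+ k.
  have : `|q^-1| < 1.
    by rewrite ger0_norm ?invr_ge0 ?(ltW (lt_trans ltr01 q1))// invf_lt1// (lt_trans ltr01).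
  move=> /cvg_expr h.
  pose e := (`|(M + I0) / (c * (v - u))| + 1)^-1.
  have e0 : 0 < e by rewrite invr_gt0 ltr_wpDl.
  have [k _ /(_ k (leqnn k))] := cvgr0_norm_lt _ h _ e0.
  have qk0 : 0 < q ^+ k by rewrite exprn_gt0// (lt_trans ltr01).
  rewrite /= exprVn ger0_norm ?invr_ge0 ?(ltW qk0)// ltf_pV2 ?posrE ?ltr_wpDl// => hq.
  by exists k; rewrite (le_lt_trans (ler_norm _))// (lt_trans _ hq)// ltrDl.
exists k; apply: (lt_le_trans _ (low k)).
rewrite ltrBrDr; move: hk'; rewrite ltr_pdivrMr ?mulr_gt0 ?subr_gt0// => h.
by rewrite (lt_le_trans h)// mulrA (mulrC (q ^+ k)).
Qed.

Lemma lerch_pos (g : R -> R) (t0 : R) : 0 < t0 ->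
  (forall t : R, 0 < t -> {for t, continuous g}) ->
  (forall k, mu.-integrable (Rpos R) (EFin \o (fun t => g t * expR (- t) ^+ k.+2))) ->
  (forall k, \int[mu]_(t in Rpos R) (g t * expR (- t) ^+ k.+2) = 0) ->
  g t0 <= 0.
Proof.
move=> t00 cg ig g0; rewrite leNgt; apply/negP => gt0.
have [d d0 hd] : exists2 d, 0 < d & forall t, `|t - t0| < d -> 0 < t /\ g t0 / 2 < g t.
  have h1 : \forall t \near t0, g t0 / 2 < g t.
    have lt2 : g t0 / 2 < g t0 by rewrite ltr_pdivrMr// ltr_pMr// ltr1n.
    exact: (cvgr_gt _ (cg _ t00) _ lt2).
  have h2 : \forall t \near t0, 0 < t by exact: lt_nbhsr.
  have /nbhs_ballP[d /= d0 hd] : \forall t \near t0, 0 < t /\ g t0 / 2 < g t.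
    by near=> t; split; near: t.
  by exists d => // t td; apply: hd; rewrite /ball/= distrC.
pose y0 := expR (- t0).
pose eta := Num.min (expR (- (t0 - d)) - y0) (y0 - expR (- (t0 + d))).
have eta0 : 0 < eta.
  by rewrite lt_min !subr_gt0 !ltr_expR !ltrN2 ltrDl gtrDl oppr_lt0 d0.
have heta t : `|expR (- t) - y0| < eta -> `|t - t0| < d.
  rewrite ltr_norml lt_min => /andP[].
  rewrite ltrNl lt_min !opprB => /andP[h1 h2] /andP[h3 h4].
  have : expR (- (t0 + d)) < expR (- t) by lra.
  have : expR (- t) < expR (d - t0) by lra.
  rewrite !ltr_expR ltrN2 => h5 h6.
  by rewrite ltr_norml; apply/andP; split; lra.
pose kap t := 1 + eta ^+ 2 - (expR (- t) - y0) ^+ 2 : R.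
pose G t := g t * expR (- t) ^+ 2.
pose w := Num.min d (eta / 2).
have w0 : 0 < w by rewrite lt_min d0 divr_gt0.
have e01 (t : R) : 0 < t -> 0 < expR (- t) < 1.
  by move=> h; rewrite expR_gt0 expR_lt1 oppr_lt0.
have y01 : 0 < y0 < 1 by exact: e01.
have [ik hM] : (forall k, mu.-integrable (Rpos R) (EFin \o (fun x => G x * kap x ^+ k))) /\
  forall M, exists k, M < \int[mu]_(x in Rpos R) (G x * kap x ^+ k).
  apply: (@concentration _ _ _ t0 (t0 + w) (g t0 / 2 * expR (- (t0 + d)) ^+ 2)
     (1 + 3 / 4 * eta ^+ 2) (1 + eta ^+ 2)).
  - exact: measurable_Rpos.
  - exact: (ig 0%N).
  - apply: measurable_funB => //; apply: measurable_funX; apply: measurable_funB => //.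
    by apply: measurableT_comp => //; exact: measurable_funN.
  - move=> t /=; rewrite in_itv/= andbT => h; rewrite /kap.
    have := e01 t h => /andP[x1 x2]; case/andP: y01 => y1 y2.
    have s0 := sqr_ge0 (expR (- t) - y0); have s2 := sqr_ge0 eta.
    have s1 : (expR (- t) - y0) ^+ 2 <= 1.
      by move: (expR (- t)) x1 x2 => x x1 x2; clear -x1 x2 y1 y2; nra.
    by rewrite ger0_norm; lra.
  - move=> t /=; rewrite in_itv/= andbT => h.
    have := e01 t h => /andP[x1 x2]; case/andP: y01 => y1 y2.
    have s2 := sqr_ge0 eta.
    have s1 : (expR (- t) - y0) ^+ 2 <= 1.
      by move: (expR (- t)) x1 x2 => x x1 x2; clear -x1 x2 y1 y2; nra.
    have k0 : 0 <= kap t by rewrite /kap; lra.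
    have [hlt|hge] := ltP (`|expR (- t) - y0|) eta.
      right; split=> //; have [_ h2] := hd t (heta t hlt).
      by rewrite mulr_ge0 ?exprn_ge0 ?expR_ge0// ltW// (lt_trans _ h2)// divr_gt0.
    left; rewrite ger0_norm// /kap.
    have : eta ^+ 2 <= `|expR (- t) - y0| ^+ 2 by rewrite lerXn2r ?nnegrE// ltW.
    by rewrite -normrX ger0_norm ?sqr_ge0//; lra.
  - by rewrite ltrDl.
  - move=> t /=; rewrite !in_itv/= andbT => /andP[h _]; exact: lt_trans h.
  - move=> t /andP[h1 h2]; have tp : 0 < t by exact: lt_trans h1.
    have td : t < t0 + d by rewrite (lt_le_trans h2)// lerD2l ge_min lexx.
    have te : t < t0 + eta / 2 by rewrite (lt_le_trans h2)// lerD2l ge_min lexx orbT.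
    have [_ h3] : 0 < t /\ g t0 / 2 < g t by apply: hd; rewrite ger0_norm; lra.
    split.
      apply: ler_pM; rewrite ?divr_ge0 ?(ltW gt0) ?exprn_ge0 ?expR_ge0//; first exact: ltW.
      by rewrite lerXn2r ?nnegrE ?expR_ge0// ler_expR lerN2 ltW.
    have : y0 - expR (- t) <= t - t0.
      have : 1 + (t0 - t) <= expR (t0 - t) by exact: expR_ge1Dx.
      have -> : expR (- t) = y0 * expR (t0 - t) by rewrite /y0 -expRD; congr expR; ring.
      case/andP: y01 => y1 y2 hh; nra.
    have : expR (- t) <= y0 by rewrite ler_expR lerN2 ltW.
    rewrite /kap; nra.
  - by rewrite mulr_gt0 ?divr_gt0 ?exprn_gt0 ?expR_gt0.
  - by rewrite ltrDl mulr_gt0 ?divr_gt0 ?exprn_gt0.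
have poly0 (P : {poly R}) m :
  mu.-integrable (Rpos R) (EFin \o (fun t => g t * expR (- t) ^+ m.+2 * P.[expR (- t)])) /\
  \int[mu]_(t in Rpos R) (g t * expR (- t) ^+ m.+2 * P.[expR (- t)]) = 0.
  have mR := @measurable_Rpos R.
  elim/poly_ind : P m => [|P c IH] m.
    have E : (fun t => g t * expR (- t) ^+ m.+2 * (0 : {poly R}).[expR (- t)]) = (fun=> 0).
      by apply/funext => t; rewrite horner0 mulr0.
    rewrite E; split; last by rewrite Rintegral_cst// mul0r.
    exact: integrable0.
  have [i1 e1] := IH m.+1.
  have E : (fun t => g t * expR (- t) ^+ m.+2 * (P * 'X + c%:P).[expR (- t)]) =
    (fun t => g t * expR (- t) ^+ m.+3 * P.[expR (- t)] + c * (g t * expR (- t) ^+ m.+2)).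
    by apply/funext => t; rewrite hornerMXaddC [_ ^+ m.+3]exprS; ring.
  have i2 := integrableZR c mR (ig m).
  rewrite E; split; first exact: integrableDR.
  by rewrite RintegralD// e1 RintegralZl// g0 mulr0 addr0.
have [k] := hM 0.
pose P : {poly R} := ((1 + eta ^+ 2)%:P - ('X - y0%:P) ^+ 2) ^+ k.
have [_ h] := poly0 P 0%N.
rewrite (_ : \int[mu]_(x in _) _ = 0) ?ltxx//.
rewrite -[RHS]h; apply: eq_Rintegral => t _.
by rewrite /P horner_exp hornerD hornerN horner_exp hornerXsubC hornerC.
Unshelve. all: end_near. Qed.

(** Lerch's uniqueness theorem: the Laplace transform at the integers determines a
    continuous function.  With y = exp(-t), the kernel 1 + eta^2 - (y - y0)^2 is a
    polynomial in y, so that its powers integrate to 0 against g. *)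
Lemma lerch (g : R -> R) (t0 : R) : 0 < t0 ->
  (forall t : R, 0 < t -> {for t, continuous g}) ->
  (forall k, mu.-integrable (Rpos R) (EFin \o (fun t => g t * expR (- t) ^+ k.+2))) ->
  (forall k, \int[mu]_(t in Rpos R) (g t * expR (- t) ^+ k.+2) = 0) ->
  g t0 = 0.
Proof.
move=> t00 cg ig g0; have mR := @measurable_Rpos R.
apply/eqP; rewrite eq_le (lerch_pos t00 cg ig g0)/=.
rewrite -oppr_le0; apply: (@lerch_pos (fun t => - g t)) => //.
- by move=> t tp; apply: cvgN; exact: cg.
- move=> k; have := integrableZR (-1) mR (ig k).
  by apply: eq_integrable => // t _ /=; rewrite mulN1r mulNr.
- move=> k.
  transitivity (-1 * \int[mu]_(t in Rpos R) (g t * expR (- t) ^+ k.+2)); last by rewrite g0 mulr0.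
  rewrite -RintegralZl//.
  by apply: eq_Rintegral => t _; rewrite mulN1r mulNr.
Qed.

End Concentration.

(** * Series of functions *)

Section SeriesTools.
Context {R : realType}.

Lemma series_tail (u M : R^nat) : (forall i, `|u i| <= M i) -> cvgn (series M) ->
  cvgn (series u) /\
  forall N, `|limn (series u) - series u N| <= limn (series M) - series M N.
Proof.
move=> uM cM; have cu : cvgn (series u).
  by apply: normed_cvg; apply: series_le_cvg cM => n //=; exact: le_trans (uM n).
split=> // N.
have h : \forall n \near \oo, `|series u n - series u N| <= series M n - series M N.
  near=> n; have Nn : (N <= n)%N by near: n; exact: nbhs_infty_ge.
  rewrite !sub_series Nn (le_trans (ler_norm_sum _ _ _))// ler_sum//.
have c1 : `|series u n - series u N| @[n --> \oo] --> `|limn (series u) - series u N|.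
  by apply: cvg_norm; apply: cvgB => //; exact: cvg_cst.
have c2 : series M n - series M N @[n --> \oo] --> limn (series M) - series M N.
  by apply: cvgB => //; exact: cvg_cst.
exact: (ler_cvg_to c1 c2 h).
Unshelve. all: end_near. Qed.

Lemma Mtest_continuous (f : nat -> R -> R) (M : R^nat) (x0 : R) :
  cvgn (series M) -> (\forall x \near x0, forall i, `|f i x| <= M i) ->
  (forall i, {for x0, continuous (f i)}) ->
  {for x0, continuous (fun x => limn (series (f ^~ x)))}.
Proof.
move=> cM fM cf; apply/cvgrPdist_le => e e0.
have e3 : 0 < e / 3 by rewrite divr_gt0.
have hN : \forall N \near \oo, `|limn (series M) - series M N| <= e / 3.
  by move/cvgrPdist_le : (cM); apply.
have [N _ /(_ N (leqnn N))/= hN'] := hN.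
have cs : {for x0, continuous (fun x => series (f ^~ x) N)}.
  elim: N {hN'} => [|N IH].
    rewrite (_ : (fun x => _) = (fun=> 0)); first exact: cvg_cst.
    by apply/funext => x; rewrite /series/= big_geq.
  rewrite (_ : (fun x => _) = (fun x => series (f ^~ x) N + f N x)).
    by apply: cvgD => //; exact: cf.
  by apply/funext => x; rewrite seriesSr.
have h2 : \forall x \near x0, `|series (f ^~ x0) N - series (f ^~ x) N| <= e / 3.
  by move/cvgrPdist_le : cs; apply.
have fM0 := nbhs_singleton fM.
have [_ t0] := series_tail fM0 cM.
near=> x.
have hx : forall i, `|f i x| <= M i by near: x.
have [_ tx] := series_tail hx cM.
have := t0 N; have := tx N; have : `|series (f ^~ x0) N - series (f ^~ x) N| <= e / 3 by near: x.
have TM : limn (series M) - series M N <= e / 3 by apply: le_trans hN'; exact: ler_norm.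
move: (limn (series (f ^~ x0))) (limn (series (f ^~ x))) (series (f ^~ x0) N) (series (f ^~ x) N)
  => l0 lx s0 sx h3 h4 h5.
have -> : l0 - lx = (l0 - s0) + (s0 - sx) - (lx - sx) by ring.
rewrite (le_trans (ler_normB _ _))//.
have := ler_normD (l0 - s0) (s0 - sx); lra.
Unshelve. all: end_near. Qed.

Lemma Rmonotone_integrable (D : set (measurableTypeR R)) (g_ : nat -> R -> R) (G : R -> R) (K : R) :
  measurable D -> (forall n (x : R), D x -> 0 <= g_ n x) ->
  (forall (x : R), D x -> nondecreasing_seq (g_^~ x)) ->
  (forall (x : R), D x -> g_ n x @[n --> \oo] --> G x) ->
  (forall n, mu.-integrable D (EFin \o g_ n)) ->
  (forall n, \int[mu]_(x in D) g_ n x <= K) ->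
  mu.-integrable D (EFin \o G).
Proof.
move=> mD g0 nd gG ig gK.
have mg n : measurable_fun D (g_ n) by case/integrableP : (ig n) => /measurable_EFinP.
have mgE n : measurable_fun D (EFin \o g_ n) by exact/measurable_EFinP.
have cE (x : R) : D x -> (g_ n x)%:E @[n --> \oo] --> (G x)%:E.
  by move=> Dx; apply: cvg_EFin; [exact: nearW|exact: gG].
have mG : measurable_fun D G by apply: (measurable_fun_cvg (h := g_)).
apply/integrableP; split; first exact/measurable_EFinP.
have -> : (\int[mu]_(x in D) `|(EFin \o G) x| = \int[mu]_(x in D) limn (fun n => (EFin \o g_ n) x))%E.
  apply: eq_integral => x; rewrite inE => Dx /=; rewrite (cvg_lim _ (cE x Dx))//.
  by rewrite ger0_norm//; apply: (cvgr_to_ge (gG x Dx)); apply: nearW => n; exact: g0.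
have h1 n (x : R) : D x -> (0 <= (EFin \o g_ n) x)%E by move=> Dx; rewrite /= lee_fin g0.
have h2 (x : R) : D x -> nondecreasing_seq (fun n => (EFin \o g_ n) x).
  by move=> Dx m n mn; rewrite /= lee_fin; exact: nd.
rewrite (@monotone_convergence _ _ _ mu D mD (fun n => EFin \o g_ n) mgE h1 h2).
apply: (@le_lt_trans _ _ K%:E); last exact: ltry.
apply: lime_le.
  apply: ereal_nondecreasing_is_cvgn => m n mn; apply: ge0_le_integral => //.
  - exact: h1.
  - by move=> x Dx; exact: h2.
apply: nearW => n; rewrite -(fineK (integrable_fin_num mD (ig n))) lee_fin.
exact: gK.
Qed.

Lemma Rseries_integral (D : set (measurableTypeR R)) (f : nat -> R -> R) (m : R^nat) :
  measurable D -> (forall i, mu.-integrable D (EFin \o f i)) ->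
  (forall i, \int[mu]_(x in D) `|f i x| <= m i) -> cvgn (series m) ->
  (forall x : R, D x -> cvgn (series (fun i => `|f i x|))) ->
  mu.-integrable D (EFin \o (fun x => limn (series (f ^~ x)))) /\
  series (fun i => \int[mu]_(x in D) f i x) @ \oo --> \int[mu]_(x in D) limn (series (f ^~ x)).
Proof.
move=> mD fi fm cm cf.
have ia i : mu.-integrable D (EFin \o (fun x => `|f i x|)) by exact: integrable_norm.
have sumI (h : nat -> R -> R) N : (forall i, mu.-integrable D (EFin \o h i)) ->
    mu.-integrable D (EFin \o (fun x => series (h ^~ x) N)) /\
    \int[mu]_(x in D) series (h ^~ x) N = series (fun i => \int[mu]_(x in D) h i x) N.
  move=> hi; elim: N => [|N [IH1 IH2]].
    have E : (fun x => series (h ^~ x) 0%N) = (fun=> 0) by apply/funext => x; rewrite /series/= big_geq.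
    rewrite E; split; first exact: integrable0.
    by rewrite Rintegral_cst// mul0r /series/= big_geq.
  have E : (fun x => series (h ^~ x) N.+1) = (fun x => series (h ^~ x) N + h N x).
    by apply/funext => x; rewrite seriesSr.
  rewrite E; split; first exact: integrableDR.
  by rewrite RintegralD// IH2 seriesSr.
have m0 i : 0 <= m i by apply: le_trans (fm i); exact: Rintegral_ge0.
have iG : mu.-integrable D (EFin \o (fun x => limn (series (fun i => `|f i x|)))).
  apply: (@Rmonotone_integrable _ (fun n x => series (fun i => `|f i x|) n) _ (limn (series m))) => //.
  - by move=> n x Dx; apply: sumr_ge0.
  - by move=> x Dx; apply: nondecreasing_series => i _ _.
  - by move=> n; have [] := sumI (fun i x => `|f i x|) n ia.
  - move=> n; have [_ ->] := sumI (fun i x => `|f i x|) n ia.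
    apply: (@le_trans _ _ (series m n)).
      by rewrite /series/= ler_sum.
    apply: (nondecreasing_cvgn_le) => //.
    exact: nondecreasing_series.
have tail (x : R) : D x -> cvgn (series (f ^~ x)).
  by move=> Dx; have [] := series_tail (fun i => lexx `|f i x|) (cf x Dx).
have mfn n : measurable_fun D (fun x => series (f ^~ x) n).
  by have [/integrableP[/measurable_EFinP]] := sumI f n fi.
have dom n (x : R) : D x -> `|series (f ^~ x) n| <= limn (series (fun i => `|f i x|)).
  move=> Dx; apply: (@le_trans _ _ (series (fun i => `|f i x|) n)).
    by rewrite /series/= ler_norm_sum.
  by apply: nondecreasing_cvgn_le; [apply: nondecreasing_series|exact: cf].
have [h1 h2] := Rdominated_cvg mD mfn tail dom iG.
split=> //; apply: cvg_trans h2; apply: near_eq_cvg; apply: nearW => n.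
by have [_ ->] := sumI f n fi.
Qed.

End SeriesTools.

(** * The Gamma function and the Laplace transform of the Mittag-Leffler function *)

Section GammaML.
Context {R : realType}.

Lemma powR_le_expR (s : R) : 0 <= s -> exists2 C : R, 0 < C & forall r, 0 < r -> r `^ s <= C * expR r.
Proof.
move=> s0; pose N := (Num.truncn s).+1.
have sN : s <= N%:R by rewrite ltW// truncnS_gt.
exists (N`!%:R + 1) => [|r r0]; first by rewrite ltr_wpDl.
have [r1|r1] := leP r 1.
  have : r `^ s <= 1.
    have E1 : 1 = 1 `^ s :> R by rewrite powR1.
    by rewrite [leRHS]E1 ge0_ler_powR// ?nnegrE ltW.
  have : 1 <= expR r by rewrite -expR0 ler_expR ltW.
  have : 0 <= N`!%:R :> R by [].
  move: (N`!%:R) (expR r) (r `^ s) => x y z; nra.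
apply: (@le_trans _ _ (r ^+ N)).
  by rewrite -powR_mulrn ?(ltW r0)// ler_powR// ltW.
have h := expR_ge1Dxn (Num.truncn s) (ltW r0).
have N0 : 0 < N`!%:R :> R by rewrite ltr0n fact_gt0.
have : r ^+ N <= N`!%:R * expR r.
  rewrite -ler_pdivrMl// mulrC; apply: le_trans h.
  by rewrite lerDr.
have := expR_gt0 r; rewrite mulrDl mul1r; lra.
Qed.

Lemma measurable_powR_expR (s : R) : measurable_fun (Rpos R) (fun t : R => t `^ s * expR (- t)).
Proof.
apply: measurable_oy => x x0; apply: cvgM; first exact: continuous_powR_pos.
by apply: continuous_comp; [exact: cvgN|exact: continuous_expR].
Qed.

Lemma integrable_gamma (s : R) : 0 < s ->
  mu.-integrable (Rpos R) (EFin \o (fun t => t `^ (s - 1) * expR (- t))).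
Proof.
move=> s0; have [|C C0 hC] := @powR_le_expR (2 * s); first by rewrite mulr_ge0// ltW.
apply: (@integrable_oy _ s (1 + C)) => //; first exact: measurable_powR_expR.
- move=> r /andP[r0 r1]; rewrite ger0_norm ?mulr_ge0 ?powR_ge0 ?expR_ge0//.
  rewrite mulrC ler_wpM2r ?powR_ge0//.
  by apply: (@le_trans _ _ 1); [rewrite expR_le1 oppr_le0 ltW|rewrite lerDl ltW].
- move=> r r1; have r0 := lt_le_trans ltr01 r1.
  rewrite ger0_norm ?mulr_ge0 ?powR_ge0 ?expR_ge0//.
  have -> : r `^ (s - 1) = r `^ (2 * s) * r `^ (- s - 1).
    by rewrite -powRD ?(gt_eqF r0) ?implybT//; congr powR; ring.
  rewrite mulrAC ler_wpM2r ?powR_ge0// expRN ler_pdivrMr ?expR_gt0//.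
  by rewrite (le_trans (hC r r0))// ler_wpM2r ?expR_ge0// lerDr.
Qed.

(** Restrict the integral to [M, M + 1].  As M is arbitrary, Gamma (a i + 1) beats
    any geometric sequence, which is all that the convergence of the
    Mittag-Leffler series needs. *)
Lemma Gamma_ge (s M : R) : 0 <= s -> 0 < M ->
  M `^ s * expR (- (M + 1)) <= Gamma (s + 1).
Proof.
move=> s0 M0; rewrite /Gamma addrK.
have ig : mu.-integrable (Rpos R) (EFin \o (fun t => t `^ s * expR (- t))).
  by have := @integrable_gamma (s + 1); rewrite addrK; apply; rewrite ltr_wpDl.
have MM : M < M + 1 by rewrite ltrDl.
rewrite -[leLHS]mulr1 [X in _ * X <= _](_ : _ = M + 1 - M); last by rewrite addrAC subrr add0r.
apply: (Rintegral_ge_itv measurable_Rpos ig _ MM).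
- by move=> t _; rewrite mulr_ge0 ?powR_ge0 ?expR_ge0.
- by move=> x /=; rewrite !in_itv/= andbT => /andP[/(lt_trans M0)].
- move=> x /andP[h1 h2]; apply: ler_pM; rewrite ?powR_ge0 ?expR_ge0//.
    by rewrite ge0_ler_powR// ?nnegrE ltW// (lt_trans M0).
  by rewrite ler_expR lerN2 ltW.
Qed.

Lemma Gamma_gt0 (s : R) : 0 <= s -> 0 < Gamma (s + 1).
Proof.
move=> s0; apply: lt_le_trans (Gamma_ge s0 (@ltr01 R)).
by rewrite mulr_gt0 ?powR_gt0 ?expR_gt0.
Qed.

Lemma laplace_powR (s p : R) : 0 <= s -> 0 < p ->
  mu.-integrable (Rpos R) (EFin \o (fun t => t `^ s * expR (- (p * t)))) /\
  \int[mu]_(t in Rpos R) (t `^ s * expR (- (p * t))) = p `^ (- (s + 1)) * Gamma (s + 1).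
Proof.
move=> s0 p0; have mR := @measurable_Rpos R.
pose f t := t `^ s * expR (- t) : R.
have cf (x : R) : 0 < x -> {for x, continuous f}.
  move=> x0; apply: cvgM; first exact: continuous_powR_pos.
  by apply: continuous_comp; [exact: cvgN|exact: continuous_expR].
have f0 (x : R) : 0 < x -> 0 <= f x by move=> x0; rewrite mulr_ge0 ?powR_ge0 ?expR_ge0.
have ig : mu.-integrable (Rpos R) (EFin \o f).
  by have := @integrable_gamma (s + 1); rewrite addrK; apply; rewrite ltr_wpDl.
have sc := integral_scale p0 cf f0.
have fE (t : R) : 0 < t -> t `^ s * expR (- (p * t)) = p `^ (- (s + 1)) * (p * f (p * t)).
  move=> t0; rewrite /f powRM ?(ltW p0) ?(ltW t0)// powRN.
  have -> : p `^ (s + 1) = p `^ s * p by rewrite powRD ?(gt_eqF p0) ?implybT// powRr1// ltW.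
  by field; rewrite !gt_eqF// powR_gt0.
have mpf : measurable_fun (Rpos R) (fun t => p * f (p * t)).
  apply: measurable_oy => x x0; apply: cvgMr; apply: continuous_comp => /=.
    by apply: cvgMr; exact: cvg_id.
  by apply: cf; rewrite mulr_gt0.
have ipf : mu.-integrable (Rpos R) (EFin \o (fun t => p * f (p * t))).
  apply/integrableP; split; first exact/measurable_EFinP.
  have -> : (\int[mu]_(x in Rpos R) `|(EFin \o (fun t => (p * f (p * t))%R)) x| =
    \int[mu]_(x in Rpos R) (p * f (p * x)%R)%:E)%E.
    apply: eq_integral => x; rewrite inE/= in_itv/= andbT => x0.
    by rewrite ger0_norm// mulr_ge0 ?f0 ?mulr_gt0// ltW.
  by rewrite -sc; exact: integrable_lty.
split.
  have := integrableZR (p `^ (- (s + 1))) mR ipf; apply: eq_integrable => // t.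
  by rewrite inE/= in_itv/= andbT => t0; rewrite /= fE.
transitivity (\int[mu]_(t in Rpos R) (p `^ (- (s + 1)) * (p * f (p * t)))).
  by apply: eq_Rintegral => t; rewrite inE/= in_itv/= andbT => t0; rewrite fE.
rewrite RintegralZl//; congr (_ * _); rewrite /Gamma addrK.
by rewrite /Rintegral -sc.
Qed.

Variable (a : R).
Hypothesis (a0 : 0 < a).

Lemma ml_summable (x : R) : 0 <= x -> cvgn (series (fun i => x ^+ i / Gamma (a * i%:R + 1))).
Proof.
move=> x0.
(* With this M the lower bound for the Gamma function contains (2 x + 1)^i, and the
   series is dominated by a geometric one of ratio x / (2 x + 1). *)
pose M := (2 * x + 1) `^ a^-1.
have b0 : 0 < 2 * x + 1 by rewrite ltr_wpDl// mulr_ge0.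
have M0 : 0 < M by rewrite powR_gt0.
apply: (@series_le_cvg _ _ (geometric (expR (M + 1)) (x / (2 * x + 1)))) => [i|i|i|].
- by rewrite divr_ge0 ?exprn_ge0// ltW// Gamma_gt0// mulr_ge0// ltW.
- by rewrite /geometric/= mulr_ge0 ?expR_ge0 ?exprn_ge0// divr_ge0// ltW.
- have ai : 0 <= a * i%:R by rewrite mulr_ge0// ltW.
  have h := Gamma_ge ai M0.
  rewrite /geometric/= expr_div_n mulrCA ler_wpM2l ?exprn_ge0//.
  have E : M `^ (a * i%:R) = (2 * x + 1) ^+ i.
    by rewrite /M -powRrM mulrA mulVf ?gt_eqF// mul1r powR_mulrn// ltW.
  rewrite E expRN in h.
  rewrite -[leRHS]invrK lef_pV2 ?posrE ?Gamma_gt0 ?invr_gt0 ?divr_gt0 ?expR_gt0 ?exprn_gt0//.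
  by rewrite invf_div.
- apply: is_cvg_geometric_series; rewrite ger0_norm ?divr_ge0 ?(ltW b0)//.
  by rewrite ltr_pdivrMr// mul1r; lra.
Qed.

Lemma ml_continuous : continuous (mittag_leffler a 1).
Proof.
move=> z0; apply: (@Mtest_continuous _ (fun i z => z ^+ i / Gamma (a * i%:R + 1))
  (fun i => (`|z0| + 1) ^+ i / Gamma (a * i%:R + 1))).
- by apply: ml_summable; rewrite addr_ge0.
- have : \forall z \near z0, `|z| < `|z0| + 1.
    have c : `|z| @[z --> z0] --> `|z0| by apply: cvg_norm; exact: cvg_id.
    have lt1 : `|z0| < `|z0| + 1 by rewrite ltrDl.
    exact: (cvgr_lt _ c _ lt1).
  apply: filterS => z zb i; rewrite normrM normrX.
  have G0 : 0 < Gamma (a * i%:R + 1) by rewrite Gamma_gt0// mulr_ge0// ltW.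
  rewrite (gtr0_norm (x := _^-1)) ?invr_gt0// ler_wpM2r ?invr_ge0 ?(ltW G0)//.
  by rewrite lerXn2r ?nnegrE ?addr_ge0// ltW.
- move=> i; apply: cvgM; last exact: cvg_cst.
  exact: exprn_continuous.
Qed.

(** Termwise integration of the series: for p > 1 the result is the geometric series
    of ratio -p^(-a), and it is dominated by the one of ratio p^(-a). *)
Lemma ml_laplace (p : R) : 1 < p ->
  mu.-integrable (Rpos R) (EFin \o (fun t => mittag_leffler a 1 (- t `^ a) * expR (- (p * t)))) /\
  \int[mu]_(t in Rpos R) (mittag_leffler a 1 (- t `^ a) * expR (- (p * t))) =
    p^-1 / (1 + p `^ (- a)).
Proof.
move=> p1; have p0 := lt_trans ltr01 p1; have mR := @measurable_Rpos R.
pose f i t := (- t `^ a) ^+ i / Gamma (a * i%:R + 1) * expR (- (p * t)) : R.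
pose q := p `^ (- a).
have q0 : 0 < q by rewrite powR_gt0.
have q1 : q < 1.
  rewrite /q powRN invf_lt1 ?powR_gt0//.
  have E1 : 1 = 1 `^ a :> R by rewrite powR1.
  by rewrite [ltLHS]E1 gt0_ltr_powR// ?nnegrE// ltW.
have G0 i : 0 < Gamma (a * i%:R + 1) by rewrite Gamma_gt0// mulr_ge0// ltW.
have ai i : 0 <= a * i%:R by rewrite mulr_ge0// ltW.
have fE i (t : R) : 0 < t -> f i t = ((-1) ^+ i / Gamma (a * i%:R + 1)) * (t `^ (a * i%:R) * expR (- (p * t))).
  move=> t0; rewrite /f powRrM powR_mulrn ?powR_ge0// (exprNn (t `^ a)); ring.
have qE i : p `^ (- (a * i%:R + 1)) = p^-1 * q ^+ i.
  rewrite opprD powRD ?(gt_eqF p0) ?implybT// powR_inv1 ?(ltW p0)// mulrC; congr (_ * _).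
  by rewrite -mulNr powRrM powR_mulrn// ltW.
have fi i : mu.-integrable (Rpos R) (EFin \o f i).
  have [h _] := laplace_powR (ai i) p0.
  have := integrableZR ((-1) ^+ i / Gamma (a * i%:R + 1)) mR h; apply: eq_integrable => // t.
  by rewrite inE/= in_itv/= andbT => t0; rewrite /= fE.
have ifi i : \int[mu]_(t in Rpos R) f i t = geometric p^-1 (- q) i.
  have [h hh] := laplace_powR (ai i) p0.
  transitivity (\int[mu]_(t in Rpos R) (((-1) ^+ i / Gamma (a * i%:R + 1)) * (t `^ (a * i%:R) * expR (- (p * t))))).
    by apply: eq_Rintegral => t; rewrite inE/= in_itv/= andbT => t0; rewrite fE.
  rewrite RintegralZl// hh qE /geometric/= (exprNn q); by field; rewrite ?(gt_eqF p0) (gt_eqF (G0 i)).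
have iafi i : \int[mu]_(t in Rpos R) `|f i t| <= geometric p^-1 q i.
  have [h hh] := laplace_powR (ai i) p0.
  have -> : \int[mu]_(t in Rpos R) `|f i t| = \int[mu]_(t in Rpos R) ((Gamma (a * i%:R + 1))^-1 * (t `^ (a * i%:R) * expR (- (p * t)))).
    apply: eq_Rintegral => t; rewrite inE/= in_itv/= andbT => t0; rewrite fE// normrM.
    rewrite normrM normrX normrN1 expr1n mul1r.
    by rewrite !ger0_norm ?mulr_ge0 ?powR_ge0 ?expR_ge0 ?invr_ge0 ?(ltW (G0 i)).
  rewrite RintegralZl// hh qE /geometric/= le_eqVlt; apply/orP; left; apply/eqP.
  by field; rewrite ?(gt_eqF p0) (gt_eqF (G0 i)).
have cg : cvgn (series (geometric p^-1 q)).
  by apply: is_cvg_geometric_series; rewrite gtr0_norm.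
have serE (t : R) : series (f ^~ t) =
   (fun n => series (fun i => (- t `^ a) ^+ i / Gamma (a * i%:R + 1)) n * expR (- (p * t))).
  by apply/funext => n; rewrite /series/= big_distrl.
have cf (t : R) : Rpos R t -> cvgn (series (fun i => `|f i t|)).
  rewrite /= in_itv/= andbT => t0.
  have h := @ml_summable (t `^ a) (powR_ge0 _ _).
  have E : series (fun i => `|f i t|) =
   (fun n => series (fun i => (t `^ a) ^+ i / Gamma (a * i%:R + 1)) n * expR (- (p * t))).
    apply/funext => n; rewrite /series/= big_distrl; apply: eq_bigr => i _.
    rewrite /f !normrM normrX normrN (ger0_norm (powR_ge0 t a)) (ger0_norm (expR_ge0 _)).
    by rewrite (ger0_norm (x := (Gamma _)^-1)) ?invr_ge0 ?(ltW (G0 i)).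
  by rewrite E; apply: is_cvgM => //; exact: is_cvg_cst.
have limE (t : R) : Rpos R t -> limn (series (f ^~ t)) = mittag_leffler a 1 (- t `^ a) * expR (- (p * t)).
  rewrite /= in_itv/= andbT => t0; rewrite serE; apply/cvg_lim => //.
  apply: cvgM; last exact: cvg_cst.
  have h := @ml_summable (t `^ a) (powR_ge0 _ _).
  have [|h1 _] := @series_tail _ (fun i => (- t `^ a) ^+ i / Gamma (a * i%:R + 1)) _ _ h; last exact: h1.
  move=> i; rewrite normrM normrX normrN (ger0_norm (powR_ge0 _ _)).
  by rewrite (ger0_norm (x := _^-1)) ?invr_ge0 ?(ltW (G0 i)).
have [i1 i2] := Rseries_integral mR fi iafi cg cf.
split.
  move: i1; apply: eq_integrable => // t; rewrite inE => /limE h.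
  by rewrite /= h.
transitivity (\int[mu]_(t in Rpos R) limn (series (f ^~ t))).
  by apply: eq_Rintegral => t; rewrite inE => /limE.
apply: (cvg_unique _ i2); rewrite //=.
rewrite (_ : (fun i => \int[mu]_(x in Rpos R) f i x) = geometric p^-1 (- q)); last first.
  by apply/funext => i; exact: ifi.
rewrite (_ : 1 + p `^ (- a) = 1 - - q); last by rewrite opprK.
by apply: cvg_geometric_series; rewrite normrN gtr0_norm.
Qed.

End GammaML.

(** * Uniform estimates for the Mittag-Leffler profile *)

Section Lipschitz.
Context {R : realType}.

Lemma expR_lip (x y : R) : `|expR x - expR y| <= `|x - y| * (expR x + expR y).
Proof.
wlog xy : x y / y <= x => [H|].
  have [h|/ltW h] := leP y x; first exact: H.
  by rewrite distrC (distrC x) (addrC (expR x)); exact: H.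
rewrite !ger0_norm ?subr_ge0 ?ler_expR//.
have h := expR_ge1Dx (y - x).
have e : expR y = expR x * expR (y - x) by rewrite -expRD addrC subrK.
have x0 := expR_gt0 x; have y0 := expR_gt0 y.
have : expR x - expR y <= (x - y) * expR x.
  by rewrite e; have := ler_wpM2l (ltW x0) h; lra.
have := mulr_ge0 (_ : 0 <= x - y) (ltW y0); rewrite subr_ge0 => /(_ xy); lra.
Qed.

Lemma powR_lip_exp (t a b : R) : 0 < t ->
  `|t `^ a - t `^ b| <= `|a - b| * (`|ln t| * (t `^ a + t `^ b)).
Proof.
move=> t0; rewrite /powR (gt_eqF t0); apply: (le_trans (expR_lip _ _)).
by rewrite -mulrBl normrM mulrA.
Qed.

Lemma ln_le_powR (t g : R) : 0 < t -> 0 < g -> `|ln t| <= (t `^ g + t `^ (- g)) / g.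
Proof.
move=> t0 g0; rewrite ler_pdivlMr// mulrC -{1}(gtr0_norm g0) -normrM -ln_powR.
have p1 : 0 < t `^ g by rewrite powR_gt0.
have p2 : 0 < t `^ (- g) by rewrite powR_gt0.
have h1 := ln_sublinear p1.
have h2 := ln_sublinear p2.
have e : ln (t `^ (- g)) = - ln (t `^ g) by rewrite !ln_powR mulNr.
by rewrite ler_norml; apply/andP; split; lra.
Qed.

Variables (al0 al1 X : R).
Hypotheses (h0 : 0 < al0) (h01 : al0 <= al1) (h1 : al1 < 1) (X0 : 0 <= X).

Definition ml_integral (a xi : R) : R :=
  \int[mu]_(t in Rpos R) (t `^ (a - 1) * expR (- t) *
     (1 + 2 * (t `^ a * xi) * cos (a * pi) + (t `^ a * xi) ^+ 2)^-1).

(** The profile of the Mittag-Leffler function: E_a(-x) = ml_profile a (1/x) / x.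
    Contrary to E_a itself, it is Lipschitz in (a, xi) up to xi = 0, where the
    value sin(a pi) Gamma(a) / pi = 1 / Gamma(1 - a) is the leading coefficient of the
    asymptotic expansion at infinity. *)
Definition ml_profile (a xi : R) : R := sin (a * pi) / pi * ml_integral a xi.

Lemma sin_pi_ge : exists2 s : R, 0 < s <= 1 & forall a, al0 <= a <= al1 -> s <= sin (a * pi).
Proof.
have cs : {within `[al0, al1], continuous (fun a : R => sin (a * pi))}.
  apply: continuous_subspaceT => x; apply: continuous_comp; last exact: continuous_sin.
  by apply: cvgM; [exact: cvg_id|exact: cvg_cst].
have [c cI hc] := EVT_min h01 cs.
exists (sin (c * pi)); last by move=> a ha; apply: hc; rewrite in_itv.
rewrite sin_le1 andbT; move: cI; rewrite in_itv/= => /andP[c0 c1].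
apply: sin_gt0_pi; rewrite mulr_gt0 ?pi_gt0 ?(lt_le_trans h0)//= gtr_pMl ?pi_gt0//.
exact: le_lt_trans c1 h1.
Qed.

Let dlt (a z : R) := 1 + 2 * z * cos (a * pi) + z ^+ 2.

Lemma density_den_ge (s a z : R) : s <= sin (a * pi) -> 0 < s -> s ^+ 2 <= dlt a z.
Proof.
move=> hs s0; rewrite /dlt; have := cos2Dsin2 (a * pi) => h.
have := sqr_ge0 (z + cos (a * pi)).
have : s ^+ 2 <= sin (a * pi) ^+ 2 by rewrite lerXn2r// nnegrE ltW// (lt_le_trans s0).
lra.
Qed.

(* The majorant g is integrable for the whole interval of orders at once: v
   dominates the powers t^(a-1), w the powers t^a, and L the logarithm. *)
Let v (t : R) := t `^ (al0 - 1) + 1.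
Let w (t : R) := 1 + t.
Let L (t : R) := 1 + `|ln t|.
Let g t := L t * (v t * (w t ^+ 2 * expR (- t))).

Lemma majorant_ge0 r : [/\ 0 <= L r, 0 <= v r, 0 <= w r ^+ 2 * expR (- r) & 0 <= g r].
Proof.
have L0 : 0 <= L r by rewrite addr_ge0.
have v0 : 0 <= v r by rewrite addr_ge0 ?powR_ge0.
have W0 : 0 <= w r ^+ 2 * expR (- r) by rewrite mulr_ge0 ?sqr_ge0 ?expR_ge0.
by split=> //; rewrite mulr_ge0// mulr_ge0.
Qed.

Lemma majorant_int : mu.-integrable (Rpos R) (EFin \o g).
Proof.
pose ga := al0 / 2; have ga0 : 0 < ga by rewrite divr_gt0.
have [|C C0 hC] := @powR_le_expR R (2 * ga + 3); first by rewrite addr_ge0// mulr_ge0// ltW.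
pose K := (1 + 2 / ga) * 8 * (1 + C).
have k0 : 0 < 1 + 2 / ga by rewrite addr_gt0// divr_gt0.
apply: (@integrable_oy _ ga K) => //.
- apply: measurable_oy => x x0; apply: cvgM.
    apply: cvgD; first exact: cvg_cst.
    by apply: cvg_norm; exact: continuous_ln.
  apply: cvgM; first by apply: cvgD; [exact: continuous_powR_pos|exact: cvg_cst].
  apply: cvgM; last by apply: continuous_comp; [exact: cvgN|exact: continuous_expR].
  apply: (@continuous_comp _ _ _ w (fun y => y ^+ 2)); last exact: exprn_continuous.
  by apply: cvgD; [exact: cvg_cst|exact: cvg_id].
- move=> r /andP[r0 r1].
  have [L0 v0 W0 g0] := majorant_ge0 r.
  rewrite ger0_norm//.
  have pp : r `^ ga <= 1 by rewrite powR_le1// ltW.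
  have pn : 1 <= r `^ (- ga) by rewrite powRN -[leLHS]invr1 lef_pV2 ?posrE ?powR_gt0.
  have b1 : L r <= (1 + 2 / ga) * r `^ (- ga).
    have l1 := ln_le_powR r0 ga0.
    have l2 : (r `^ ga + r `^ (- ga)) / ga <= 2 * r `^ (- ga) / ga.
      by rewrite ler_wpM2r ?invr_ge0 ?(ltW ga0)//; lra.
    rewrite /L [leRHS](_ : _ = r `^ (- ga) + 2 * r `^ (- ga) / ga); [lra|ring].
  have b2 : v r <= 2 * r `^ (al0 - 1).
    have : 1 <= r `^ (al0 - 1).
      rewrite -[leLHS](powRr0 r); apply: ger_powR; first by rewrite r0.
      by rewrite subr_le0 (le_trans h01)// ltW.
    by rewrite /v; lra.
  have b3 : w r ^+ 2 * expR (- r) <= 4.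
    have : expR (- r) <= 1 by rewrite expR_le1 oppr_le0 ltW.
    have := expR_ge0 (- r).
    have : w r ^+ 2 <= 4 by rewrite /w; nra.
    have := sqr_ge0 (w r); nra.
  have e : r `^ (ga - 1) = r `^ (- ga) * r `^ (al0 - 1).
    by rewrite -powRD ?(gt_eqF r0) ?implybT//; congr powR; rewrite /ga; field.
  apply: (@le_trans _ _ ((1 + 2 / ga) * r `^ (- ga) * (2 * r `^ (al0 - 1) * 4))).
    by apply: ler_pM => //; [exact: mulr_ge0|exact: ler_pM].
  rewrite e /K.
  have -> : (1 + 2 / ga) * r `^ (- ga) * (2 * r `^ (al0 - 1) * 4) =
     (1 + 2 / ga) * 8 * 1 * (r `^ (- ga) * r `^ (al0 - 1)) by ring.
  rewrite ler_wpM2r ?mulr_ge0 ?powR_ge0// ler_wpM2l ?mulr_ge0 ?(ltW k0)// lerDl ltW//.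
- move=> r r1; have r0 := lt_le_trans ltr01 r1.
  have [L0 v0 W0 g0] := majorant_ge0 r.
  rewrite ger0_norm//.
  have pp : 1 <= r `^ ga by rewrite powR_ge1// ltW.
  have pn : r `^ (- ga) <= 1 by rewrite powRN invf_le1 ?powR_gt0.
  have b1 : L r <= (1 + 2 / ga) * r `^ ga.
    have l1 := ln_le_powR r0 ga0.
    have l2 : (r `^ ga + r `^ (- ga)) / ga <= 2 * r `^ ga / ga.
      by rewrite ler_wpM2r ?invr_ge0 ?(ltW ga0)//; lra.
    rewrite /L [leRHS](_ : _ = r `^ ga + 2 * r `^ ga / ga); [lra|ring].
  have b2 : v r <= 2.
    have : r `^ (al0 - 1) <= 1.
      rewrite -[leRHS](powRr0 r); apply: ler_powR => //.
      by rewrite subr_le0 (le_trans h01)// ltW.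
    by rewrite /v; lra.
  have b3 : w r ^+ 2 * expR (- r) <= 4 * C * r `^ (- 2 * ga - 1).
    rewrite expRN ler_pdivrMr ?expR_gt0//.
    apply: (@le_trans _ _ (4 * r ^+ 2)); first by rewrite /w; nra.
    have e : r ^+ 2 = r `^ (- 2 * ga - 1) * r `^ (2 * ga + 3).
      rewrite -powRD ?(gt_eqF r0) ?implybT// -powR_mulrn ?ltW//; congr powR; ring.
    rewrite e.
    have -> : 4 * C * r `^ (- 2 * ga - 1) * expR r = 4 * (r `^ (- 2 * ga - 1) * (C * expR r)) by ring.
    by rewrite ler_pM2l// ler_pM2l ?powR_gt0// hC.
  have e : r `^ (- ga - 1) = r `^ ga * r `^ (- 2 * ga - 1).
    by rewrite -powRD ?(gt_eqF r0) ?implybT//; congr powR; ring.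
  apply: (@le_trans _ _ ((1 + 2 / ga) * r `^ ga * (2 * (4 * C * r `^ (- 2 * ga - 1))))).
    by apply: ler_pM => //; [exact: mulr_ge0|exact: ler_pM].
  rewrite e /K.
  have -> : (1 + 2 / ga) * r `^ ga * (2 * (4 * C * r `^ (- 2 * ga - 1))) =
     (1 + 2 / ga) * 8 * C * (r `^ ga * r `^ (- 2 * ga - 1)) by ring.
  by rewrite ler_wpM2r ?mulr_ge0 ?powR_ge0// ler_wpM2l ?mulr_ge0 ?(ltW k0)// lerDr.
Qed.

Let phi (a xi t : R) := t `^ (a - 1) * expR (- t) * (dlt a (t `^ a * xi))^-1.

Lemma powR_bounds (a t : R) : al0 <= a <= al1 -> 0 < t ->
  [/\ 0 <= t `^ a <= w t, 0 <= t `^ (a - 1) <= v t, 1 <= w t & 1 <= L t].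
Proof.
move=> /andP[a0 a1] t0; rewrite !powR_ge0 /v /w /L /= lerDl (ltW t0) lerDl normr_ge0.
have a1' : a <= 1 by rewrite (le_trans a1)// ltW.
have ap : 0 <= a by rewrite (le_trans (ltW h0)).
split=> //.
  have [t1|t1] := leP t 1.
    by rewrite (le_trans (powR_le1 t0 t1 ap))// lerDl ltW.
  rewrite (@le_trans _ _ t)// ?lerDr//.
  by apply: ler1_powR => //; exact: ltW.
have [t1|t1] := leP t 1.
  by rewrite (@le_trans _ _ (t `^ (al0 - 1)))// ?lerDl// ger_powR ?t0// lerD2r.
rewrite (@le_trans _ _ 1)// ?lerDr ?powR_ge0//.
by rewrite -[leRHS](powRr0 t) ler_powR ?(ltW t1)// subr_le0.
Qed.

Lemma powR_diff (a b t c M : R) : 0 < t -> t `^ (a - c) <= M -> t `^ (b - c) <= M ->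
  `|t `^ (a - c) - t `^ (b - c)| <= `|a - b| * (2 * L t * M).
Proof.
move=> t0 h2 h3; apply: (le_trans (powR_lip_exp _ _ t0)).
have -> : a - c - (b - c) = a - b by ring.
rewrite ler_wpM2l// (mulrC 2) -mulrA; apply: ler_pM => //; rewrite ?addr_ge0 ?powR_ge0//.
  by rewrite /L lerDr.
by rewrite mulr_natl mulr2n lerD.
Qed.

Section Pointwise.
Variables (s : R).
Hypotheses (s0 : 0 < s) (hs : forall a, al0 <= a <= al1 -> s <= sin (a * pi)).

Lemma density_den_gt0 a z : al0 <= a <= al1 -> 0 < dlt a z.
Proof. by move=> ha; apply: lt_le_trans (density_den_ge z (hs ha) s0); rewrite exprn_gt0. Qed.

Lemma density_le a xi t : al0 <= a <= al1 -> 0 < t -> 0 <= phi a xi t <= g t / s ^+ 2.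
Proof.
move=> ha t0; have [/andP[_ b1] /andP[b2 b3] b4 b5] := powR_bounds ha t0.
have d0 := density_den_gt0 (t `^ a * xi) ha.
have e0 := expR_ge0 (- t).
rewrite /phi !mulr_ge0 ?invr_ge0 ?(ltW d0)//=.
apply: ler_pM; rewrite ?mulr_ge0 ?invr_ge0 ?(ltW d0)//.
  have [L0 v0 W0 g0] := majorant_ge0 t.
  rewrite /g (@le_trans _ _ (v t * (w t ^+ 2 * expR (- t))))//.
    apply: ler_pM => //; rewrite ler_peMl//; nra.
  by rewrite ler_peMl// mulr_ge0.
by rewrite lef_pV2 ?posrE ?exprn_gt0//; apply: density_den_ge; [exact: hs|].
Qed.

Let K := 2 * (2 * X + 1) + 2 * X * pi + 2 * X * (2 * X + 1).
Let K1 := 2 / s ^+ 2 + K / s ^+ 4.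

(** All the derivatives in a and xi are bounded, up to the lower bound s of
    sin(a pi), by one majorant; the factor L t accounts for d/da t^a = t^a ln t. *)
Lemma density_lip a b xi eta t : al0 <= a <= al1 -> al0 <= b <= al1 ->
  0 <= xi <= X -> 0 <= eta <= X -> 0 < t ->
  `|phi a xi t - phi b eta t| <= (`|a - b| + `|xi - eta|) * (K1 * g t).
Proof.
move=> ha hb /andP[x0 x1] /andP[y0 y1] t0.
have [/andP[a1 a2] /andP[a3 a4] w1 L1] := powR_bounds ha t0.
have [/andP[b1 b2] /andP[b3 b4] _ _] := powR_bounds hb t0.
set E := `|a - b| + `|xi - eta|.
have Ea : `|a - b| <= E by rewrite lerDl.
have Ex : `|xi - eta| <= E by rewrite lerDr.
have E0 : 0 <= E by rewrite addr_ge0.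
have v0 : 0 <= v t by exact: le_trans a4.
have w0 : 0 <= w t by exact: le_trans a2.
have L0 : 0 <= L t by exact: le_trans L1.
have pi0 := pi_gt0 R.
have d1 : `|t `^ (a - 1) - t `^ (b - 1)| <= E * (2 * L t * v t).
  apply: le_trans (powR_diff t0 a4 b4) _.
  by rewrite ler_wpM2r// !mulr_ge0.
have d2 : `|t `^ a - t `^ b| <= E * (2 * L t * w t).
  have := @powR_diff a b t 0 (w t) t0; rewrite !subr0 => /(_ a2 b2) h.
  by apply: le_trans h _; rewrite ler_wpM2r// !mulr_ge0.
set z := t `^ a * xi; set z' := t `^ b * eta.
have zb : 0 <= z <= X * w t by rewrite mulr_ge0//= mulrC ler_pM.
have zb' : 0 <= z' <= X * w t by rewrite mulr_ge0//= mulrC ler_pM.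
have LwE : w t * E <= L t * w t * E by rewrite ler_wpM2r// ler_peMl.
have dz : `|z - z'| <= (2 * X + 1) * (L t * w t * E).
  have -> : z - z' = (t `^ a - t `^ b) * xi + t `^ b * (xi - eta) by rewrite /z /z'; ring.
  rewrite (le_trans (ler_normD _ _))// !normrM (ger0_norm x0) (ger0_norm b1).
  have h2 : `|t `^ a - t `^ b| * xi <= E * (2 * L t * w t) * X by rewrite ler_pM.
  have h3 : t `^ b * `|xi - eta| <= w t * E by rewrite ler_pM.
  lra.
have cc : `|cos (a * pi) - cos (b * pi)| <= pi * E.
  apply: (le_trans (cos_lip _ _)); rewrite -mulrBl normrM (gtr0_norm pi0) mulrC.
  by rewrite ler_wpM2l// ltW.
have dD : `|dlt a z - dlt b z'| <= K * (L t * w t ^+ 2 * E).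
  have -> : dlt a z - dlt b z' = 2 * (z - z') * cos (a * pi) + 2 * z' * (cos (a * pi) - cos (b * pi))
      + (z - z') * (z + z') by rewrite /dlt; ring.
  rewrite (le_trans (ler_normD _ _))//.
  case/andP: zb => z0 z1; case/andP: zb' => z0' z1'.
  have W : L t * w t * E <= L t * w t ^+ 2 * E.
    by rewrite ler_wpM2r// ler_wpM2l// expr2 ler_peMl.
  have W2 : w t * E <= L t * w t ^+ 2 * E by exact: le_trans W.
  have h4 : `|2 * (z - z') * cos (a * pi)| <= 2 * (2 * X + 1) * (L t * w t ^+ 2 * E).
    rewrite !normrM (ger0_norm (x := 2))//.
    apply: (@le_trans _ _ (2 * `|z - z'|)); first by rewrite ler_piMr ?mulr_ge0// cos_max.
    rewrite -mulrA ler_wpM2l// (le_trans dz)// ler_wpM2l// addr_ge0// mulr_ge0//.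
  have h5 : `|2 * z' * (cos (a * pi) - cos (b * pi))| <= 2 * X * pi * (L t * w t ^+ 2 * E).
    rewrite (normrM (2 * z')) (normrM 2 z') (ger0_norm (x := 2))// (ger0_norm z0').
    apply: (@le_trans _ _ (2 * (X * w t) * (pi * E))).
      by apply: ler_pM => //; rewrite ?mulr_ge0// ler_wpM2l.
    have -> : 2 * (X * w t) * (pi * E) = 2 * X * pi * (w t * E) by ring.
    by rewrite ler_wpM2l// !mulr_ge0// ltW.
  have h6 : `|(z - z') * (z + z')| <= 2 * X * (2 * X + 1) * (L t * w t ^+ 2 * E).
    rewrite normrM (ger0_norm (x := z + z')) ?addr_ge0//.
    apply: (@le_trans _ _ ((2 * X + 1) * (L t * w t * E) * (2 * (X * w t)))).
      by apply: ler_pM => //; [rewrite addr_ge0|lra].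
    by rewrite le_eqVlt; apply/orP; left; apply/eqP; ring.
  have := ler_normD (2 * (z - z') * cos (a * pi)) (2 * z' * (cos (a * pi) - cos (b * pi))).
  rewrite /K; lra.
have p1 := density_den_ge z (hs ha) s0; have p2 := density_den_ge z' (hs hb) s0.
have q1 := density_den_gt0 z ha; have q2 := density_den_gt0 z' hb.
have s2 : 0 < s ^+ 2 by rewrite exprn_gt0.
have dV : `|(dlt a z)^-1 - (dlt b z')^-1| <= K * (L t * w t ^+ 2 * E) / s ^+ 4.
  have -> : (dlt a z)^-1 - (dlt b z')^-1 = - (dlt a z - dlt b z') / (dlt a z * dlt b z').
    by field; rewrite !gt_eqF.
  rewrite normrM normrN (gtr0_norm (x := _^-1)) ?invr_gt0 ?mulr_gt0//.
  apply: ler_pM => //; first by rewrite invr_ge0 ltW// mulr_gt0.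
  rewrite lef_pV2 ?posrE ?mulr_gt0 ?exprn_gt0//.
  by rewrite (exprD s 2 2) ler_pM// ltW.
have e0 := expR_ge0 (- t).
have -> : phi a xi t - phi b eta t = expR (- t) * ((t `^ (a - 1) - t `^ (b - 1)) * (dlt a z)^-1
   + t `^ (b - 1) * ((dlt a z)^-1 - (dlt b z')^-1)) by rewrite /phi -/z -/z'; ring.
rewrite normrM (ger0_norm e0).
have i1 : (dlt a z)^-1 <= (s ^+ 2)^-1 by rewrite lef_pV2 ?posrE.
have t1 : `|(t `^ (a - 1) - t `^ (b - 1)) * (dlt a z)^-1| <= E * (2 * L t * v t) * (s ^+ 2)^-1.
  by rewrite normrM (gtr0_norm (x := _^-1)) ?invr_gt0// ler_pM// invr_ge0 ltW.
have t2 : `|t `^ (b - 1) * ((dlt a z)^-1 - (dlt b z')^-1)| <= v t * (K * (L t * w t ^+ 2 * E) / s ^+ 4).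
  by rewrite normrM (ger0_norm b3) ler_pM.
have w2 : 1 <= w t ^+ 2 by rewrite exprn_ege1.
have t3 : E * (2 * L t * v t) * (s ^+ 2)^-1 <= E * (2 * L t * v t) * (s ^+ 2)^-1 * w t ^+ 2.
  by rewrite ler_peMr// !mulr_ge0 ?invr_ge0// ltW.
have -> : E * (K1 * g t) = expR (- t) * (E * (2 * L t * v t) * (s ^+ 2)^-1 * w t ^+ 2
    + v t * (K * (L t * w t ^+ 2 * E) / s ^+ 4)) by rewrite /K1 /g; ring.
by rewrite ler_wpM2l// (le_trans (ler_normD _ _))// lerD// (le_trans t1).
Qed.

Lemma density_continuous a xi (t : R) : al0 <= a <= al1 -> 0 < t -> {for t, continuous (phi a xi)}.
Proof.
move=> ha t0.
have cp (b : R) : {for t, continuous (fun t => t `^ b)} by exact: continuous_powR_pos.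
have cz : {for t, continuous (fun t => t `^ a * xi)} by apply: cvgM; [exact: cp|exact: cvg_cst].
apply: cvgM.
  apply: cvgM; first exact: cp.
  by apply: continuous_comp; [exact: cvgN|exact: continuous_expR].
apply: cvgV; first by rewrite gt_eqF// density_den_gt0.
apply: cvgD.
  apply: cvgD; first exact: cvg_cst.
  by apply: cvgM; [apply: cvgM; [exact: cvg_cst|exact: cz]|exact: cvg_cst].
by apply: (@continuous_comp _ _ _ (fun t => t `^ a * xi) (fun y => y ^+ 2)); [exact: cz|exact: exprn_continuous].
Qed.

Lemma density_int a xi : al0 <= a <= al1 -> mu.-integrable (Rpos R) (EFin \o phi a xi).
Proof.
move=> ha; apply: (le_integrableR (g := fun t => (s ^+ 2)^-1 * g t)).
- exact: measurable_Rpos.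
- by apply: measurable_oy => t; exact: density_continuous.
- move=> t /=; rewrite in_itv/= andbT => t0; have /andP[p0 p1] := density_le xi ha t0.
  by rewrite ger0_norm// mulrC.
- by apply: integrableZR majorant_int; exact: measurable_Rpos.
Qed.

Lemma ml_integral_lip : exists2 C, 0 <= C & forall a b xi eta, al0 <= a <= al1 -> al0 <= b <= al1 ->
  0 <= xi <= X -> 0 <= eta <= X ->
  `|ml_integral a xi| <= C /\ `|ml_integral a xi - ml_integral b eta| <= C * (`|a - b| + `|xi - eta|).
Proof.
have mR := @measurable_Rpos R.
have pi0 := pi_gt0 R.
pose G := \int[mu]_(t in Rpos R) g t.
have G0 : 0 <= G by apply: Rintegral_ge0 => t _; have [] := majorant_ge0 t.
have s2 : 0 <= (s ^+ 2)^-1 by rewrite invr_ge0 exprn_ge0// ltW.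
have pi0' := ltW pi0.
have K0 : 0 <= K by rewrite /K; repeat (done || (apply: addr_ge0) || (apply: mulr_ge0)).
have K10 : 0 <= K1 by apply: addr_ge0; apply: divr_ge0 => //; rewrite exprn_ge0// ltW.
have SK0 : 0 <= (s ^+ 2)^-1 + K1 by exact: addr_ge0.
exists (((s ^+ 2)^-1 + K1) * G); first exact: mulr_ge0.
move=> a b xi eta ha hb hx hy; split.
  apply: (le_trans (le_normr_Rintegral mR (density_int xi ha))).
  apply: (@le_trans _ _ ((s ^+ 2)^-1 * G)); last by rewrite ler_wpM2r// lerDl.
  rewrite -RintegralZl//; last exact: majorant_int.
  apply: le_Rintegral => //.
  - exact: integrable_norm (density_int _ _).
  - exact: integrableZR mR majorant_int.
  - move=> t /=; rewrite in_itv/= andbT => t0; have /andP[p0 p1] := density_le xi ha t0.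
    by rewrite [X in X <= _]ger0_norm// mulrC.
rewrite -RintegralB//; [|exact: density_int..].
apply: (le_trans (le_normr_Rintegral mR (integrableBR mR (density_int xi ha) (density_int eta hb)))).
apply: (@le_trans _ _ ((`|a - b| + `|xi - eta|) * K1 * G)); last first.
  rewrite [leRHS](_ : _ = (`|a - b| + `|xi - eta|) * ((s ^+ 2)^-1 + K1) * G); last by ring.
  by rewrite ler_wpM2r// ler_wpM2l ?addr_ge0// lerDr.
rewrite -RintegralZl//; last exact: majorant_int.
apply: le_Rintegral => //.
- exact: integrable_norm (integrableBR mR (density_int xi ha) (density_int eta hb)).
- exact: integrableZR mR majorant_int.
- move=> t /=; rewrite in_itv/= andbT => t0.
  by rewrite -mulrA; exact: density_lip.
Qed.

End Pointwise.

End Lipschitz.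

Section MLdensity.
Context {R : realType}.
Variables (al0 al1 X : R).
Hypotheses (h0 : 0 < al0) (h01 : al0 <= al1) (h1 : al1 < 1) (X0 : 0 <= X).

Lemma ml_profile_lip : exists2 C, 0 <= C & forall a b xi eta, al0 <= a <= al1 -> al0 <= b <= al1 ->
  0 <= xi <= X -> 0 <= eta <= X ->
  `|ml_profile a xi| <= C /\ `|ml_profile a xi - ml_profile b eta| <= C * (`|a - b| + `|xi - eta|).
Proof.
have [s /andP[s0 _] hs] := sin_pi_ge h0 h01 h1.
have [C C0 hC] := ml_integral_lip h0 h01 h1 X0 s0 hs.
have pi0 := pi_gt0 R; have pi0' := ltW pi0.
have ipi0 : 0 <= pi^-1 :> R by rewrite invr_ge0.
exists ((pi^-1 + 1) * C); first by rewrite mulr_ge0// addr_ge0.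
move=> a b xi eta ha hb hx hy; rewrite /ml_profile.
have [B1 D1] := hC a b xi eta ha hb hx hy.
have [B2 _] := hC b a eta xi hb ha hy hx.
have sb (c : R) : `|sin (c * pi) / pi| <= pi^-1.
  by rewrite normrM (ger0_norm ipi0) ler_piMl// sin_max.
have sd : `|sin (a * pi) / pi - sin (b * pi) / pi| <= `|a - b|.
  rewrite -mulrBl normrM (ger0_norm ipi0) ler_pdivrMr//.
  apply: (le_trans (sin_lip _ _)); rewrite -mulrBl normrM (ger0_norm pi0')//.
move: B1 B2 D1 sd (sb a) (sb b).
move: (ml_integral a xi) (ml_integral b eta) (sin (a * pi) / pi) (sin (b * pi) / pi) => p q u v B1 B2 D1 sd su sv.
split.
  rewrite normrM mulrDl mul1r (@le_trans _ _ (pi^-1 * C))//; first exact: ler_pM.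
  by rewrite lerDl.
have -> : u * p - v * q = u * (p - q) + (u - v) * q by ring.
apply: (le_trans (ler_normD _ _)); rewrite !normrM.
have e1 : `|u| * `|p - q| <= pi^-1 * (C * (`|a - b| + `|xi - eta|)) by exact: ler_pM.
have e2 : `|u - v| * `|q| <= `|a - b| * C by exact: ler_pM.
have e3 : 0 <= C * `|xi - eta| by exact: mulr_ge0.
rewrite (_ : (_ + 1) * C * _ = pi^-1 * (C * (`|a - b| + `|xi - eta|)) + `|a - b| * C + C * `|xi - eta|); last by ring.
lra.
Qed.

(** This keeps the leading coefficient of the solution away from 0, uniformly in the
    order. *)
Lemma ml_profile0_ge : exists2 m, 0 < m & forall a, al0 <= a <= al1 -> m <= ml_profile a 0.
Proof.
have [s /andP[s0 _] hs] := sin_pi_ge h0 h01 h1.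
have pi0 := pi_gt0 R; have mR := @measurable_Rpos R.
(* The integrand at xi = 0 is at least exp(-2) / 2 on ]1, 2[, for every a < 1. *)
pose k : R := expR (- 2) / 2.
have k0 : 0 < k by rewrite divr_gt0// expR_gt0.
exists (s / pi * k); first by rewrite mulr_gt0// divr_gt0.
move=> a ha; rewrite /ml_profile; apply: ler_pM; rewrite ?divr_ge0 ?(ltW s0) ?(ltW pi0) ?(ltW k0)//.
  by rewrite ler_pM2r ?invr_gt0// hs.
have a0 : 0 < a by case/andP: ha => + _; exact: lt_le_trans.
have a1 : a < 1 by case/andP: ha => _ /le_lt_trans; apply.
have ig := integrable_gamma a0.
rewrite (_ : ml_integral a 0 = \int[mu]_(t in Rpos R) (t `^ (a - 1) * expR (- t))); last first.
  apply: eq_Rintegral => t _.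
  by rewrite mulr0 mulr0 mul0r expr0n/= !addr0 invr1 mulr1.
have e12 : 1 < 2 :> R by rewrite ltr1n.
rewrite (_ : k = k * (2 - 1)); last by rewrite (_ : 2 - 1 = 1 :> R) ?mulr1//; lra.
apply: (Rintegral_ge_itv mR ig _ e12).
- by move=> t _; rewrite mulr_ge0 ?powR_ge0 ?expR_ge0.
- by move=> x /=; rewrite !in_itv/= andbT => /andP[/(lt_trans ltr01)].
move=> x /andP[x1 x2]; have x0 := lt_trans ltr01 x1.
rewrite mulrC; apply: ler_pM; rewrite ?expR_ge0 ?invr_ge0//.
  by rewrite ler_expR lerN2 ltW.
apply: (@le_trans _ _ (x `^ (-1))).
  by rewrite powR_inv1 ?(ltW x0)// lef_pV2 ?posrE// ltW.
by rewrite ler_powR//; [exact: ltW|lra].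
Qed.

End MLdensity.

(** * The spectral representation of the Mittag-Leffler function *)

Section Representation.
Context {R : realType}.

Lemma integral_expR (p : R) : 0 < p ->
  (\int[mu]_(t in Rpos R) (expR (- (p * t)))%:E = (p^-1)%:E)%E.
Proof.
move=> p0; have mR := @measurable_Rpos R.
have h := integral_exponential_pdf p0.
have [hi hI] := @laplace_powR R 0 p (lexx 0) p0.
have mf : measurable_fun (Rpos R) (fun t : R => expR (- (p * t))).
  apply: measurable_oy => x x0; apply: continuous_comp; last exact: continuous_expR.
  by apply: cvgN; apply: cvgMr; exact: cvg_id.
have iE : mu.-integrable (Rpos R) (EFin \o (fun t : R => expR (- (p * t)))).
  move: hi; apply: eq_integrable => // t _ /=.
  by rewrite powRr0 mul1r.
have h2 : (\int[mu]_(x in Rpos R) (p * expR (- (p * x))%R)%:E = 1)%E.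
  rewrite -h integral_itv_obnd_cbnd; last first.
    by apply/measurable_EFinP; apply: measurable_funM => //; exact: measurable_cst.
  rewrite [LHS]integral_mkcond; apply: eq_integral => x _.
  by rewrite /exponential_pdf !patchE; case: ifP => // _; rewrite mulNr.
rewrite -(fineK (integrable_fin_num mR iE)); congr EFin.
apply: (@mulfI _ p); rewrite ?gt_eqF// divff ?gt_eqF//.
apply: EFin_inj; rewrite -h2 EFinM fineK ?(integrable_fin_num mR iE)//.
by rewrite -integralZl//; apply: eq_integral => x _; rewrite EFinM.
Qed.

Variables (a : R).
Hypotheses (a0 : 0 < a) (a1 : a < 1).

Let kap (r : R) := r `^ (a - 1) / (1 + 2 * r `^ a * cos (a * pi) + (r `^ a) ^+ 2).

Lemma spectral_den_gt0 (z : R) : 0 < 1 + 2 * z * cos (a * pi) + z ^+ 2.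
Proof.
have [s /andP[s0 _] hs] := sin_pi_ge a0 (lexx a) a1.
have haa : a <= a <= a by rewrite lexx.
by apply: lt_le_trans (density_den_ge z (hs _ haa) s0); rewrite exprn_gt0.
Qed.

Let kap_ge0 r : 0 <= kap r.
Proof. by rewrite divr_ge0 ?powR_ge0// ltW// spectral_den_gt0. Qed.

Let kap_continuous (r : R) : 0 < r -> {for r, continuous kap}.
Proof.
move=> r0; have c := @continuous_powR_pos _ a _ r0.
apply: cvgM; first exact: continuous_powR_pos.
apply: cvgV; first by rewrite gt_eqF// spectral_den_gt0.
apply: cvgD; first apply: cvgD; first exact: cvg_cst.
  by apply: cvgM; [apply: cvgM; [exact: cvg_cst|exact: c]|exact: cvg_cst].
by apply: (@continuous_comp _ _ _ (fun t => t `^ a) (fun y => y ^+ 2)); [exact: c|exact: exprn_continuous].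
Qed.

Let mf (t r : R) := expR (- (r * t)) * kap r.

(** The substitution t := t r shows that t^(-a) ml_integral a (t^(-a)) is the
    Laplace transform of the spectral density. *)
Lemma laplace_kernel_integral (t : R) : 0 < t ->
  (\int[mu]_(r in Rpos R) (mf t r)%:E = (t `^ (- a) * ml_integral a (t `^ (- a)))%:E)%E.
Proof.
move=> t0; have [s /andP[s0 _] hs] := sin_pi_ge a0 (lexx a) a1.
have haa : a <= a <= a by rewrite lexx.
have mR := @measurable_Rpos R.
set xi := t `^ (- a).
have ip := density_int a0 (lexx a) a1 s0 hs xi haa.
pose f x := x `^ (a - 1) * expR (- x) * (1 + 2 * (x `^ a * xi) * cos (a * pi) + (x `^ a * xi) ^+ 2)^-1.
have cf (x : R) : 0 < x -> {for x, continuous f} by move=> x0; exact: (density_continuous s0 hs).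
have f0 (x : R) : 0 < x -> 0 <= f x.
  by move=> x0; rewrite mulr_ge0 ?invr_ge0 ?(ltW (spectral_den_gt0 _))// mulr_ge0 ?powR_ge0 ?expR_ge0.
have sc := integral_scale t0 cf f0.
rewrite EFinM /ml_integral /Rintegral fineK; last exact: integrable_fin_num.
rewrite [X in (_ * X)%E]sc -ge0_integralZl//.
- apply: eq_integral => r; rewrite inE/= in_itv/= andbT => r0.
  rewrite -EFinM; congr EFin; rewrite /mf /kap /f.
  rewrite !powRM ?(ltW t0) ?(ltW r0)// [t * r]mulrC.
  have -> : t `^ (a - 1) = t `^ a / t by rewrite powRB ?(gt_eqF t0) ?implybT// powRr1// ltW.
  have e : t `^ a * r `^ a * xi = r `^ a.
    by rewrite /xi powRN mulrAC divff ?mul1r// gt_eqF// powR_gt0.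
  rewrite !e; rewrite /xi powRN.
  by field; rewrite !gt_eqF// ?powR_gt0 ?spectral_den_gt0.
- apply/measurable_EFinP; apply: measurable_oy => x x0; apply: cvgM; first exact: cvg_cst.
  by apply: continuous_comp => /=; [apply: cvgMr; exact: cvg_id|apply: cf; rewrite mulr_gt0].
- move=> x /=; rewrite in_itv/= andbT => x0; rewrite lee_fin mulr_ge0 ?(ltW t0)//.
  by rewrite f0// mulr_gt0.
- by rewrite lee_fin powR_ge0.
Qed.

(** Tonelli: the Laplace transform of a Laplace transform is a Stieltjes transform. *)
Lemma laplace_ml_integral (p : R) : 0 < p ->
  (\int[mu]_(t in Rpos R) (t `^ (- a) * ml_integral a (t `^ (- a)) * expR (- (p * t)))%:E =
   \int[mu]_(r in Rpos R) (kap r / (p + r))%:E)%E.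
Proof.
move=> p0; have mR := @measurable_Rpos R.
pose F (z : measurableTypeR R * measurableTypeR R) : \bar R :=
  (((fun t : R => expR (- (p * t))) \_ (Rpos R)) z.1 * (kap \_ (Rpos R)) z.2 * expR (- (z.2 * z.1)))%:E.
have res (f : R -> R) : (forall x : R, 0 < x -> {for x, continuous f}) ->
    measurable_fun setT (f \_ (Rpos R)).
  by move=> cf; apply/(measurable_restrict _ mR measurableT); rewrite setTI; exact: measurable_oy.
have ce (c : R) (x : R) : {for x, continuous (fun t : R => expR (- (c * t)))}.
  apply: continuous_comp; last exact: continuous_expR.
  by apply: cvgN; apply: cvgMr; exact: cvg_id.
have mF : measurable_fun setT F.
  apply/measurable_EFinP; apply: measurable_funM; first apply: measurable_funM.
  - apply: (measurableT_comp (f := (fun t : R => expR (- (p * t))) \_ (Rpos R)) (g := fst)) => //.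
    exact: res.
  - by apply: (measurableT_comp (f := kap \_ (Rpos R)) (g := snd)) => //; exact: res.
  - apply: measurableT_comp => //; apply: measurableT_comp => //.
    by apply: measurable_funM.
have pk (x : R) : 0 <= (kap \_ (Rpos R)) x by rewrite patchE; case: ifP.
have pe (x : R) : 0 <= ((fun t : R => expR (- (p * t))) \_ (Rpos R)) x.
  by rewrite patchE; case: ifP => // _; exact: expR_ge0.
have F0 z : (0 <= F z)%E by rewrite lee_fin mulr_ge0 ?expR_ge0// mulr_ge0.
have ft := fubini_tonelli (m1 := @lebesgue_measure R) (m2 := @lebesgue_measure R) F mF F0.
transitivity (\int[mu]_t \int[mu]_r F (t, r))%E.
  rewrite [LHS]integral_mkcond; apply: eq_integral => t _; rewrite patchE.
  case: ifPn => tR.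
    move: (tR); rewrite inE/= in_itv/= andbT => t0.
    have mm : measurable_fun (Rpos R) (fun r => (mf t r)%:E).
      apply/measurable_EFinP; apply: measurable_oy => r r0; apply: cvgM; last exact: kap_continuous.
      have : {for r, continuous (fun r : R => expR (- (r * t)))}.
        rewrite (_ : (fun r : R => _) = (fun r : R => expR (- (t * r)))); first exact: ce.
        by apply/funext => ?; rewrite mulrC.
      exact.
    have m0 (r : R) : Rpos R r -> (0 <= (mf t r)%:E)%E.
      by move=> _; rewrite lee_fin mulr_ge0 ?expR_ge0.
    have e0 : (0 <= (expR (- (p * t)))%:E)%E by rewrite lee_fin expR_ge0.
    rewrite EFinM -(laplace_kernel_integral t0) -(ge0_integralZr mu mR mm m0 e0).
    rewrite [LHS]integral_mkcond; apply: eq_integral => r _; rewrite /F /mf !patchE/= tR.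
    case: ifP => _; last by rewrite mulr0 mul0r.
    by rewrite -EFinM; congr EFin; ring.
  apply/esym/integral0_eq => r _; rewrite /F/= patchE (negbTE tR).
  by rewrite !mul0r.
rewrite ft [RHS]integral_mkcond; apply: eq_integral => r _; rewrite patchE.
case: ifPn => rR; last first.
  have kr : (kap \_ (Rpos R)) r = 0 by rewrite patchE (negbTE rR).
  by apply: integral0_eq => t _; rewrite /F kr mulr0 mul0r.
move: (rR); rewrite inE/= in_itv/= andbT => r0.
have pr : 0 < p + r by rewrite addr_gt0.
have me : measurable_fun (Rpos R) (fun t => (expR (- ((p + r) * t)))%:E).
  by apply/measurable_EFinP; apply: measurable_oy => x _; exact: ce.
have e0 (t : R) : Rpos R t -> (0 <= (expR (- ((p + r) * t)))%:E)%E.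
  by move=> _; rewrite lee_fin expR_ge0.
have k0 : (0 <= (kap r)%:E)%E by rewrite lee_fin.
rewrite EFinM -(integral_expR pr) -(ge0_integralZl mu mR me e0 k0).
rewrite [RHS]integral_mkcond; apply: eq_integral => t _; rewrite /F/= !patchE rR.
case: ifP => _; last by rewrite !mul0r.
rewrite -EFinM; congr EFin; rewrite mulrDl opprD expRD; ring.
Qed.

Lemma ml_integral_ge0 (xi : R) : 0 <= ml_integral a xi.
Proof.
apply: Rintegral_ge0 => t _; rewrite mulr_ge0 ?invr_ge0 ?(ltW (spectral_den_gt0 _))//.
by rewrite mulr_ge0 ?powR_ge0 ?expR_ge0.
Qed.

Lemma ml_profile_continuous (x : R) : 0 < x -> {for x, continuous (ml_profile a)}.
Proof.
move=> x0; have X0 : 0 <= x + 1 by rewrite addr_ge0// ltW.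
have [C C0 hC] := ml_profile_lip a0 (lexx a) a1 X0.
apply/cvgrPdist_le => e e0.
have C1 : 0 < C + 1 by rewrite ltr_wpDl.
have d0 : 0 < Num.min x (Num.min 1 (e / (C + 1))).
  by rewrite !lt_min x0 ltr01 divr_gt0.
near=> y.
have : `|x - y| < Num.min x (Num.min 1 (e / (C + 1))).
  by near: y; exact: cvgr_dist_lt.
rewrite !lt_min => /and3P[h1 h2 h3].
have haa : a <= a <= a by rewrite lexx.
have hx : 0 <= x <= x + 1 by rewrite (ltW x0) lerDl ler01.
have hy : 0 <= y <= x + 1.
  by move: h1 h2; rewrite !ltr_norml => /andP[? ?] /andP[? ?]; apply/andP; split; lra.
have [_] := hC a a x y haa haa hx hy; rewrite subrr normr0 add0r => /le_trans; apply.
rewrite (@le_trans _ _ ((C + 1) * `|x - y|))//; first by rewrite ler_wpM2r// lerDl.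
by rewrite mulrC -ler_pdivlMr// ltW.
Unshelve. all: end_near. Qed.

Lemma ml_profile_powR_continuous (t : R) : 0 < t ->
  {for t, continuous (fun t : R => t `^ (- a) * ml_profile a (t `^ (- a)))}.
Proof.
move=> t0; have c := @continuous_powR_pos _ (- a) _ t0.
apply: cvgM; first exact: c.
by apply: (@continuous_comp _ _ _ (fun t => t `^ (- a)) (ml_profile a)); [exact: c|apply: ml_profile_continuous; rewrite powR_gt0].
Qed.

(** By the Stieltjes formula this is the Laplace transform of E_a(-t^a). *)
Lemma laplace_ml_profile (p : R) : 0 < p ->
  (\int[mu]_(t in Rpos R) (t `^ (- a) * ml_profile a (t `^ (- a)) * expR (- (p * t)))%:E =
   (p^-1 / (1 + p `^ (- a)))%:E)%E.
Proof.
move=> p0; have mR := @measurable_Rpos R.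
have st := stieltjes a0 a1 p0.
have [s /andP[s1 _] hs] := sin_pi_ge a0 (lexx a) a1.
have haa : a <= a <= a by rewrite lexx.
have s0 : 0 < sin (a * pi) by exact: lt_le_trans (hs _ haa).
have pi0 := pi_gt0 R; have spi : 0 <= sin (a * pi) / pi by rewrite divr_ge0// ltW.
have ce (x : R) : {for x, continuous (fun t : R => expR (- (p * t)))}.
  apply: continuous_comp; last exact: continuous_expR.
  by apply: cvgN; apply: cvgMr; exact: cvg_id.
have mL : measurable_fun (Rpos R) (fun t : R => t `^ (- a) * ml_integral a (t `^ (- a)) * expR (- (p * t))).
  rewrite (_ : (fun t => _) = fun t : R => pi / sin (a * pi) *
    (t `^ (- a) * ml_profile a (t `^ (- a))) * expR (- (p * t))).
    apply: measurable_oy => x x0; apply: cvgM; last exact: ce.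
    by apply: cvgMr; exact: ml_profile_powR_continuous.
  apply/funext => t; rewrite /ml_profile.
  move: (ml_integral _ _) (sin (a * pi)) (@pi R) s0 pi0 => m S P S0 P0; field.
  by rewrite !gt_eqF.
transitivity ((sin (a * pi) / pi)%:E * \int[mu]_(r in Rpos R) (kap r / (p + r))%:E)%E.
  rewrite -laplace_ml_integral// -ge0_integralZl//.
  - by apply: eq_integral => t _; rewrite -EFinM; congr EFin; rewrite /ml_profile; ring.
  - exact/measurable_EFinP.
  - by move=> t _; rewrite lee_fin mulr_ge0 ?expR_ge0// mulr_ge0 ?powR_ge0 ?ml_integral_ge0.
have mk : measurable_fun (Rpos R) (fun r => kap r / (p + r)).
  apply: measurable_oy => x x0; apply: cvgM; first exact: kap_continuous.
  apply: cvgV; first by rewrite gt_eqF// addr_gt0.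
  by apply: cvgD; [exact: cvg_cst|exact: cvg_id].
have kk : (\int[mu]_(r in Rpos R) (frac_im a (r, pi) / (r * (p + r)))%:E =
    (sin (a * pi))%:E * \int[mu]_(r in Rpos R) (kap r / (p + r))%:E)%E.
  rewrite -ge0_integralZl//; last 3 first.
  - exact/measurable_EFinP.
  - by move=> r /=; rewrite in_itv/= andbT => r0; rewrite lee_fin divr_ge0// ltW// addr_gt0.
  - by rewrite lee_fin ltW.
  apply: eq_integral => r; rewrite inE/= in_itv/= andbT => r0.
  rewrite -EFinM; congr EFin; rewrite /frac_im sqabs1E /kap/=.
  have -> : r `^ (a - 1) = r `^ a / r by rewrite powRB ?(gt_eqF r0) ?implybT// powRr1// ltW.
  by field; rewrite !gt_eqF ?spectral_den_gt0 ?(addr_gt0 p0 r0).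
rewrite (_ : sin (a * pi) / pi = pi^-1 * sin (a * pi)); last by rewrite mulrC.
rewrite EFinM -muleA -kk st -EFinM; congr EFin.
rewrite /frac_pos powRN; have pa : 0 < p `^ a by rewrite powR_gt0.
move: (p `^ a) (@pi R) pa pi0 => A P A0 P0; have A1 : 0 < 1 + A by rewrite addr_gt0.
by field; rewrite (addrC A) !gt_eqF.
Qed.

(** Both sides, taken at x = t^a, are continuous functions of t with the same Laplace
    transform. *)
Lemma ml_representation (x : R) : 0 < x -> mittag_leffler a 1 (- x) = x^-1 * ml_profile a x^-1.
Proof.
move=> x0; have mR := @measurable_Rpos R.
pose h t := t `^ (- a) * ml_profile a (t `^ (- a)) : R.
pose g t := mittag_leffler a 1 (- t `^ a) - h t : R.
have cml t : 0 < t -> {for t, continuous (fun t : R => mittag_leffler a 1 (- t `^ a))}.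
  move=> t0; apply: (@continuous_comp _ _ _ (fun t => - t `^ a) (mittag_leffler a 1)).
    by apply: cvgN; exact: continuous_powR_pos.
  exact: ml_continuous.
have h0 t : 0 <= h t.
  rewrite mulr_ge0 ?powR_ge0// /ml_profile mulr_ge0 ?ml_integral_ge0// divr_ge0 ?pi_ge0//.
  by apply: sin_ge0_pi; rewrite mulr_ge0 ?(ltW a0) ?pi_ge0//= ler_piMl ?pi_ge0// ltW.
have ih p : 0 < p -> mu.-integrable (Rpos R) (EFin \o (fun t => h t * expR (- (p * t)))).
  move=> p0; apply/integrableP; split.
    apply/measurable_EFinP; apply: measurable_oy => t t0; apply: cvgM.
      exact: ml_profile_powR_continuous.
    apply: continuous_comp; last exact: continuous_expR.
    by apply: cvgN; apply: cvgMr; exact: cvg_id.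
  have -> : (\int[mu]_(t in Rpos R) `|(EFin \o (fun t => (h t * expR (- (p * t)))%R)) t| =
    (p^-1 / (1 + p `^ (- a)))%:E)%E.
    rewrite -laplace_ml_profile//; apply: eq_integral => t _.
    by rewrite /= ger0_norm// mulr_ge0 ?expR_ge0.
  exact: ltry.
have gE k t : g t * expR (- t) ^+ k.+2 =
    mittag_leffler a 1 (- t `^ a) * expR (- (k.+2%:R * t)) - h t * expR (- (k.+2%:R * t)).
  by rewrite -expRM_natl -mulrN mulrBl.
have k1 k : 1 < k.+2%:R :> R by rewrite ltr1n.
have k0 k : 0 < k.+2%:R :> R by rewrite ltr0n.
pose t0 := x `^ a^-1.
have t00 : 0 < t0 by rewrite powR_gt0.
have t0a : t0 `^ a = x by rewrite /t0 -powRrM mulVf ?gt_eqF// powRr1// ltW.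
have /eqP : g t0 = 0.
  apply: lerch => //.
  - move=> t tt; apply: cvgB; [exact: cml|exact: ml_profile_powR_continuous].
  - move=> k; under [X in EFin \o X]eq_fun do rewrite gE.
    by apply: integrableBR; [exact: mR|have [] := ml_laplace a0 (k1 k)|exact: ih].
  - move=> k; under eq_Rintegral do rewrite gE.
    have [i1 e1] := ml_laplace a0 (k1 k).
    rewrite RintegralB//; last exact: ih.
    by rewrite e1 /Rintegral laplace_ml_profile//= subrr.
by rewrite subr_eq0 => /eqP; rewrite t0a /h powRN t0a.
Qed.

End Representation.

(** * Sine series on an interval *)

Section Sines.
Context {R : realType}.
Variable (L : R).
Hypothesis (L0 : 0 < L).

Local Notation II := (`]0%R, L[%classic : set (measurableTypeR R)).
Local Notation ef := (eigfun L).

Lemma sin_natpi n : sin (n%:R * pi) = 0 :> R.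
Proof.
elim: n => [|n IH]; first by rewrite mul0r sin0.
by rewrite -natr1 mulrDl mul1r sinD IH sinpi mul0r mulr0 addr0.
Qed.

Lemma eigfun0 x : ef 0%N x = 0.
Proof. by rewrite /eigfun !mul0r sin0 mulr0. Qed.

Lemma eigfun_le n x : `|ef n x| <= Num.sqrt (2 / L).
Proof. by rewrite /eigfun normrM ger0_norm ?sqrtr_ge0// ler_piMr ?sqrtr_ge0// sin_max. Qed.

Lemma derive_scaled (f f' : R -> R) (c x : R) : (forall x : R, is_derive x 1 f (f' x)) ->
  is_derive x 1 (fun x => f (c * x / L)) (f' (c * x / L) * (c / L)).
Proof.
move=> df.
have dg : is_derive x 1 (fun x : R => c * x / L) (c / L).
  rewrite (_ : (fun x : R => _) = (fun x => (c / L) * x)); last by apply/funext => y; rewrite mulrAC.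
  by apply: is_derive_eq; rewrite /GRing.scale/= mulr1.
by have := @is_derive1_comp _ f (fun x : R => c * x / L) x _ _ (df _) dg; rewrite mulrC.
Qed.

Lemma eigfun_derive n (x : R) : is_derive x 1 (ef n)
  (Num.sqrt (2 / L) * (cos (n%:R * pi * x / L) * (n%:R * pi / L))).
Proof.
have h := @derive_scaled sin cos (n%:R * pi) x (@is_derive_sin R).
by rewrite /eigfun; apply: is_derive_eq.
Qed.

Lemma eigfun_continuous n : continuous (ef n).
Proof. by move=> x; apply: is_derive_continuous (eigfun_derive n x). Qed.

Lemma cos_scaled_continuous (c d : R) : continuous (fun x : R => cos (c * x / L + d)).
Proof.
move=> x; apply: continuous_comp; last exact: continuous_cos.
apply: cvgD; last exact: cvg_cst.
by apply: cvgM; [apply: cvgMr; exact: cvg_id|exact: cvg_cst].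
Qed.

Lemma measurable_0L : measurable II. Proof. exact: measurable_itv. Qed.

Lemma lebesgue_0L : mu II = L%:E.
Proof. by rewrite lebesgue_measure_itv/= lte_fin L0 -EFinB/= subr0. Qed.

Lemma integrable_0L (f : R -> R) : {within `[0, L], continuous f} -> mu.-integrable II (EFin \o f).
Proof.
move=> cf; apply: (@integrableS _ _ _ mu `[0, L]%classic).
- exact: measurable_itv.
- exact: measurable_0L.
- by apply: subset_itv; rewrite bnd_simp.
- by apply: continuous_compact_integrable => //; exact: segment_compact.
Qed.

Lemma integrable_0LM (f g : R -> R) : {within `[0, L], continuous f} -> continuous g ->
  mu.-integrable II (EFin \o (fun x => f x * g x)).
Proof.
move=> cf cg; apply: integrable_0L => x.
by apply: cvgM; [exact: cf|exact: (continuous_subspaceT cg)].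
Qed.

Lemma Rintegral_0L_FTC (f F : R -> R) : (forall x : R, is_derive x 1 F (f x)) -> continuous f ->
  \int[mu]_(x in II) f x = F L - F 0.
Proof.
move=> dF cf; have mf : measurable_fun setT f by exact: continuous_measurable_fun.
rewrite /Rintegral integral_itv_bndo_bndc; last first.
  by apply/measurable_EFinP; exact: measurable_funTS.
rewrite integral_itv_obnd_cbnd; last first.
  by apply/measurable_EFinP; exact: measurable_funTS.
by rewrite (integral_FTC_cc (ltW L0) (fun x _ => dF x) (fun x _ => cf x)).
Qed.

Lemma integral_cos n : \int[mu]_(x in II) cos (n%:R * pi * x / L) = if n == 0%N then L else 0.
Proof.
case: eqP => [->|/eqP n0].
  under eq_Rintegral do rewrite !mul0r cos0.
  rewrite Rintegral_cst; last exact: measurable_0L.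
  by rewrite [X in fine X]lebesgue_0L mul1r.
have n0' : n%:R != 0 :> R by rewrite pnatr_eq0.
have pi0 := pi_gt0 R.
have dF (x : R) : is_derive x 1 (fun x : R => (n%:R * pi / L)^-1 * sin (n%:R * pi * x / L)) (cos (n%:R * pi * x / L)).
  have h := @derive_scaled sin cos (n%:R * pi) x (@is_derive_sin R).
  apply: is_derive_eq; rewrite /GRing.scale/=; move: (cos _) {h} => c.
  move: (@pi R) pi0 => P P0; field.
  by rewrite n0' !gt_eqF.
rewrite (Rintegral_0L_FTC dF).
  by rewrite -(mulrA _ L) divff ?gt_eqF// mulr1 sin_natpi !mulr0 mul0r sin0 mulr0 subrr.
move=> x; have := @cos_scaled_continuous (n%:R * pi) 0 x.
by under eq_fun do rewrite addr0.
Qed.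

Lemma eigfun_orthonormal m n : (0 < m)%N -> (0 < n)%N ->
  \int[mu]_(x in II) (ef m x * ef n x) = (m == n)%:R.
Proof.
wlog mn : m n / (n <= m)%N => [H m0 n0|].
  have [h|h] := leqP n m; first exact: H.
  under eq_Rintegral do rewrite mulrC.
  by rewrite H ?(ltnW h)// eq_sym.
move=> m0 n0.
have E x : ef m x * ef n x = L^-1 * (cos ((m - n)%:R * pi * x / L) - cos ((m + n)%:R * pi * x / L)).
  rewrite natrB// natrD !mulrDl mulNr !mulNr cosB cosD /eigfun.
  have sq : Num.sqrt (2 / L) * Num.sqrt (2 / L) = 2 / L.
    by rewrite -expr2 sqr_sqrtr// divr_ge0// ltW.
  rewrite mulrACA sq; ring.
have ic k : mu.-integrable II (EFin \o (fun x => cos (k%:R * pi * x / L))).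
  apply: integrable_0L; apply: continuous_subspaceT => x.
  have := @cos_scaled_continuous (k%:R * pi) 0 x.
  by under eq_fun do rewrite addr0.
under eq_Rintegral do rewrite E.
have mI := measurable_0L.
rewrite RintegralZl//; last exact: integrableBR.
rewrite RintegralB// !integral_cos addn_eq0 (gtn_eqF m0)/= subr0 subn_eq0.
rewrite eqn_leq mn andbT; case: ifP; rewrite ?mulr0// mulVf// gt_eqF//.
Qed.

Section Completeness.
Variable f : R -> R.
Hypotheses (cf : {within `[0, L], continuous f}) (f0 : forall n, coef L f n = 0).

Let y (x : R) := 1 * pi * x / L.

(** A kernel centred at y0 and its mirror image at -y0 have the same integral
    against f: their difference is an odd trigonometric polynomial, hence a
    combination of the sin (j y), whose integrals against f vanish.  The factor
    cos (j theta), for all j at once, makes the induction on k go through, by the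
    product formula for cosines. *)
Lemma coef0_kernel (c y0 : R) (k j : nat) :
  \int[mu]_(x in II) (f x * (cos (j%:R * (y x - y0)) * (c + cos (y x - y0)) ^+ k)) =
  \int[mu]_(x in II) (f x * (cos (j%:R * (y x + y0)) * (c + cos (y x + y0)) ^+ k)).
Proof.
have mI := measurable_0L.
have cy (d : R) i n : continuous (fun x : R => cos (i%:R * (y x + d)) * (c + cos (y x + d)) ^+ n).
  move=> x; have cc i' : {for x, continuous (fun x : R => cos (i'%:R * (y x + d)))}.
    have := @cos_scaled_continuous (i'%:R * pi) (i'%:R * d) x.
    rewrite (_ : (fun x : R => _) = (fun x : R => cos (i'%:R * (y x + d))))//.
    by apply/funext => z; congr cos; rewrite /y; ring.
  apply: cvgM; first exact: cc.
  apply: (@continuous_comp _ _ _ (fun x : R => c + cos (y x + d)) (fun y => y ^+ n)); last exact: exprn_continuous.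
  apply: cvgD; first exact: cvg_cst.
  have := cc 1%N; rewrite (_ : (fun x : R => cos (1 * (y x + d))) = (fun x : R => cos (y x + d)))//.
  by apply/funext => z; rewrite mul1r.
have iy d i n := integrable_0LM cf (cy d i n).
elim: k j => [|k IH] j.
  apply/eqP; rewrite -subr_eq0 -RintegralB//; try exact: iy; apply/eqP.
  rewrite (_ : \int[mu]_(x in II) _ = (2 * sin (j%:R * y0) / Num.sqrt (2 / L)) * coef L f j); first by rewrite f0 mulr0.
  rewrite /coef -RintegralZl//; last first.
    by apply: integrable_0LM => //; exact: eigfun_continuous.
  apply: eq_Rintegral => x _; rewrite !expr0 !mulr1 mulrBr mulrDr cosB cosD /eigfun /y.
  have s0 : 0 < Num.sqrt (2 / L) by rewrite sqrtr_gt0 divr_gt0.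
  rewrite mul1r (_ : j%:R * (pi * x / L) = j%:R * pi * x / L); last by ring.
  by field; rewrite gt_eqF.
have step (d : R) : \int[mu]_(x in II) (f x * (cos (j%:R * (y x + d)) * (c + cos (y x + d)) ^+ k.+1)) =
   c * \int[mu]_(x in II) (f x * (cos (j%:R * (y x + d)) * (c + cos (y x + d)) ^+ k)) +
   2^-1 * (\int[mu]_(x in II) (f x * (cos (j.+1%:R * (y x + d)) * (c + cos (y x + d)) ^+ k)) +
   \int[mu]_(x in II) (f x * (cos ((if j is j'.+1 then j' else 1%N)%:R * (y x + d)) * (c + cos (y x + d)) ^+ k))).
  have i1 := iy d j k; have i2 := iy d j.+1 k.
  have i3 := iy d (if j is j'.+1 then j' else 1%N) k.
  have i23 := integrableDR mI i2 i3.
  rewrite -(RintegralD mI i2 i3) -[c * _]RintegralZl// -[2^-1 * _]RintegralZl//.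
  rewrite -(RintegralD mI (integrableZR c mI i1) (integrableZR 2^-1 mI i23)).
  apply: eq_Rintegral => x _; rewrite exprS.
  have -> : cos ((if j is j'.+1 then j' else 1%N)%:R * (y x + d)) = cos (j%:R * (y x + d) - (y x + d)).
    case: (j) => [|j']; first by rewrite mul0r sub0r cosN mul1r.
    by congr cos; rewrite -natr1; ring.
  have -> : j.+1%:R * (y x + d) = j%:R * (y x + d) + (y x + d) by rewrite -natr1; ring.
  by move: (j%:R * (y x + d)) (y x + d) => A B; rewrite cosB cosD; field.
by rewrite !step !IH.
Qed.

Lemma cos_le_arc (d t : R) : 0 <= d <= pi -> d <= t <= pi *+ 2 - d -> cos t <= cos d.
Proof.
move=> /andP[d0 d1] /andP[t1 t2].
have mono (u : R) : d <= u <= pi -> cos u <= cos d.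
  move=> /andP[u1 u2].
  have /predU1P[->//|du] : (d == u) || (d < u) by rewrite -le_eqVlt.
  by rewrite ltW// ltr_cos// !in_itv/= ?d0 ?d1 ?u2// (le_trans d0 u1).
have [tp|/ltW tp] := leP t pi; first by apply: mono; rewrite t1.
have -> : cos t = cos (pi *+ 2 - t) by rewrite addrC cosD2pi cosN.
by apply: mono; rewrite mulr2n in t2 *; apply/andP; split; lra.
Qed.

(** The powers of kap = 1 - cos d + cos (y - y0) concentrate at y0, while on the
    interval the mirror image is bounded by 1, because -y0 is at distance at least d
    from [0, pi] mod 2 pi; so if f x0 > 0, then one of two equal integrals blows
    up and the other one does not. *)
Lemma sine_complete_le (x0 : R) : 0 < x0 < L -> f x0 <= 0.
Proof.
move=> /andP[x00 x0L]; rewrite leNgt; apply/negP => fx0.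
have mI := measurable_0L; have pi0 := pi_gt0 R.
have yE x : y x = pi / L * x by rewrite /y; ring.
have pL : 0 < pi / L by rewrite divr_gt0.
set y0 := y x0.
have y00 : 0 < y0 by rewrite /y0 yE mulr_gt0.
have y0p : y0 < pi by rewrite /y0 yE mulrAC ltr_pdivrMr// ltr_pM2l.
have cfx : {for x0, continuous f}.
  have /continuous_within_itvP[//|cf' _ _] := cf.
  by apply: cf'; rewrite in_itv/= x00.
have : \forall x \near x0, f x0 / 2 < f x.
  have lt : f x0 / 2 < f x0 by lra.
  exact: (cvgr_gt _ cfx _ lt).
move=> /nbhs_ballP[e /= e0 he].
(* f > f x0 / 2 as long as |y - y0| <= d, and d is at most the distance from y0 to the
   ends of [0, pi], which keeps the mirror image away from 0 mod 2 pi. *)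
pose d := Num.min (pi / L * (e / 2)) (Num.min y0 (pi - y0)).
have d0 : 0 < d by rewrite !lt_min y00 subr_gt0 y0p andbT/= andbT mulr_gt0// divr_gt0.
have de : d <= pi / L * (e / 2) by rewrite ge_min lexx.
have dy : d <= y0 by rewrite !ge_min lexx !orbT.
have dp : d <= pi - y0 by rewrite !ge_min lexx !orbT.
have dpi : d <= pi by rewrite (le_trans dy)// ltW.
pose c := 1 - cos d.
pose kap x := c + cos (y x - y0); pose kap' x := c + cos (y x + y0).
have yI x : II x -> 0 < y x < pi.
  by rewrite /= in_itv/= => /andP[h1 h2]; rewrite yE mulr_gt0//= mulrAC ltr_pdivrMr// ltr_pM2l.
have cd1 := cos_le1 d.
have kapE x : kap x = c + cos `|y x - y0| by rewrite /kap; have [h|h] := leP 0 (y x - y0); rewrite ?(ger0_norm h) ?(ltr0_norm h) ?cosN.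
have far x : II x -> d <= `|y x - y0| -> `|kap x| <= 1.
  move=> Ix h; rewrite kapE ler_norml /c.
  have := cos_geN1 `|y x - y0|.
  have : cos `|y x - y0| <= cos d.
    apply: cos_le_arc; rewrite ?(ltW d0)//= h/=.
    have /andP[? ?] := yI x Ix; rewrite mulr2n ler_norml; apply/andP; split; lra.
  by move=> ? ?; apply/andP; split; lra.
have near' x : `|y x - y0| <= d -> f x0 / 2 <= f x /\ 1 <= kap x.
  move=> h; split.
    apply/ltW/he; rewrite /ball/= distrC -(ltr_pM2l pL) -{1}(gtr0_norm pL) -normrM mulrBr -!yE.
    apply: (le_lt_trans h); apply: (le_lt_trans de); rewrite yE ltr_pM2l//; lra.
  rewrite kapE /c; have : cos d <= cos `|y x - y0|; last by lra.
  apply: cos_le_arc; first by rewrite normr_ge0/= (le_trans h).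
  rewrite h/= mulr2n; lra.
have ck : continuous kap.
  move=> x; apply: cvgD; first exact: cvg_cst.
  exact: (@cos_scaled_continuous (1 * pi) (- y0)).
have ck' : continuous kap'.
  move=> x; apply: cvgD; first exact: cvg_cst.
  exact: (@cos_scaled_continuous (1 * pi) y0).
have d2 : 0 < d / 2 < d by rewrite divr_gt0//= ltr_pdivrMr//; lra.
have iF : mu.-integrable II (EFin \o f) by exact: integrable_0L.
pose r := L / pi * (d / 2).
have r0 : 0 < r by rewrite mulr_gt0 ?divr_gt0.
have cd2 : cos d < cos (d / 2).
  move/andP: d2 => [d21 d22].
  by rewrite ltr_cos// !in_itv/= ?(ltW d0) ?(ltW d21) ?dpi//= (le_trans (ltW d22)).
have hr : pi / L * r = d / 2 by rewrite /r -(invf_div pi L) mulrA divff ?mul1r// gt_eqF.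
have rd x : x0 - r < x < x0 + r -> `|y x - y0| <= d / 2.
  move=> /andP[h1 h2]; rewrite /y0 !yE -mulrBr normrM gtr0_norm//.
  by rewrite -hr ler_pM2l// ler_norml; apply/andP; split; lra.
have subI : `]x0 - r, x0 + r[%classic `<=` II.
  have e1 : pi / L * (x0 - r) = y0 - d / 2 by rewrite mulrBr hr /y0 yE.
  have e2 : pi / L * (x0 + r) = y0 + d / 2 by rewrite mulrDr hr /y0 yE.
  apply: subset_itv; rewrite bnd_simp -(ler_pM2l pL) ?e1 ?e2 ?mulr0.
    by lra.
  by rewrite divfK ?gt_eqF//; lra.
have kK x : II x -> `|kap x| <= 3.
  move=> _; rewrite /kap /c; have := cos_le1 (y x - y0); have := cos_geN1 (y x - y0).
  by have := cos_geN1 d => *; rewrite ler_norml; apply/andP; split; lra.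
have mk : measurable_fun II kap by apply: measurable_funTS; exact: continuous_measurable_fun.
have dich x : II x -> `|kap x| <= 1 \/ 0 <= f x /\ 0 <= kap x.
  move=> Ix; have [h|h] := leP d `|y x - y0|; [by left; exact: far|right].
  by have [h1 h2] := near' x (ltW h); split; [lra|exact: le_trans ler01 _].
have low x : x0 - r < x < x0 + r -> f x0 / 2 <= f x /\ c + cos (d / 2) <= kap x.
  move=> hx; have h := rd x hx; have /andP[d21 d22] := d2.
  have [h1 _] := near' x (le_trans h (ltW d22)); split=> //.
  rewrite kapE /c lerD2l; have dp2 := le_trans (ltW d22) dpi.
  by apply: cos_le_arc; rewrite ?normr_ge0 ?h/= ?(le_trans h)// lerBrDr mulr2n lerD// (le_trans h).
have uv : x0 - r < x0 + r by lra.
have c0 : 0 < f x0 / 2 by lra.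
have q1 : 1 < c + cos (d / 2) by rewrite /c; lra.
have [_ /(_ (\int[mu]_(x in II) `|f x|))[k]] := concentration mI iF mk kK dich uv subI low c0 q1.
rewrite ltNge => /negP; apply.
have := coef0_kernel c y0 k 0%N.
under eq_Rintegral do rewrite mul0r cos0 mul1r.
under [in RHS]eq_Rintegral do rewrite mul0r cos0 mul1r.
move=> ->.
have ck'k : continuous (fun x => kap' x ^+ k).
  by move=> x; apply: (@continuous_comp _ _ _ kap' (fun y => y ^+ k)); [exact: ck'|exact: exprn_continuous].
have ikk := integrable_0LM cf ck'k.
apply: (le_trans (ler_norm _)); apply: (le_trans (le_normr_Rintegral mI ikk)).
apply: le_Rintegral => //; [exact: integrable_norm|exact: integrable_norm|].
move=> x Ix; rewrite normrM ler_piMr// normrX exprn_ile1//.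
have /andP[h1 h2] := yI x Ix.
rewrite /kap' ler_norml /c; have := cos_geN1 (y x + y0).
have : cos (y x + y0) <= cos d.
  by apply: cos_le_arc; rewrite ?(ltW d0)//= mulr2n; apply/andP; split; lra.
by move=> ? ?; apply/andP; split; lra.
Qed.

End Completeness.

Lemma integrable_0L_eigfun (f : R -> R) n : {within `[0, L], continuous f} ->
  mu.-integrable II (EFin \o (fun x => f x * ef n x)).
Proof. by move=> cf; apply: integrable_0LM => //; exact: eigfun_continuous. Qed.

(** Completeness of the sine system among continuous functions. *)
Lemma coef_inj (f g : R -> R) : {within `[0, L], continuous f} -> {within `[0, L], continuous g} ->
  (forall n, (0 < n)%N -> coef L f n = coef L g n) ->
  forall x, 0 < x < L -> f x = g x.
Proof.
move=> cf cg fg x xI; have mI := measurable_0L.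
have main (f1 f2 : R -> R) : {within `[0, L], continuous f1} -> {within `[0, L], continuous f2} ->
    (forall n, (0 < n)%N -> coef L f1 n = coef L f2 n) -> f1 x <= f2 x.
  move=> c1 c2 h; rewrite -subr_le0.
  apply: (@sine_complete_le (fun x => f1 x - f2 x)) => //.
    by move=> z; apply: cvgB; [exact: c1|exact: c2].
  move=> [|n]; rewrite /coef.
    under eq_Rintegral do rewrite eigfun0 mulr0.
    by rewrite Rintegral_cst// mul0r.
  under eq_Rintegral do rewrite mulrBl.
  rewrite RintegralB//; try exact: integrable_0L_eigfun.
  by apply/eqP; rewrite subr_eq0; apply/eqP; exact: h.
by apply/eqP; rewrite eq_le !main// => n n0; rewrite fg.
Qed.

Section SineSum.
Variable a : nat -> R.
Hypothesis ca : cvgn (series (fun n => `|a n|)).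

Definition sine_sum (x : R) : R := limn (series (fun n => a n * ef n x)).

Let M n := `|a n| * Num.sqrt (2 / L).

Let cM : cvgn (series M).
Proof.
have -> : series M = (fun n => series (fun n => `|a n|) n * Num.sqrt (2 / L)).
  by apply/funext => n; rewrite /series/= big_distrl.
by apply: is_cvgM => //; exact: is_cvg_cst.
Qed.

Let aM x n : `|a n * ef n x| <= M n.
Proof. by rewrite normrM ler_wpM2l// eigfun_le. Qed.

Lemma sine_sum_continuous : continuous sine_sum.
Proof.
move=> x; apply: (@Mtest_continuous _ (fun n x => a n * ef n x) M) => //.
  by near=> z => n; exact: aM.
by move=> n; apply: cvgMr; exact: eigfun_continuous.
Unshelve. all: end_near. Qed.

Lemma sine_sum_tail N x :
  `|sine_sum x - series (fun n => a n * ef n x) N| <= limn (series M) - series M N.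
Proof. by have [_] := series_tail (aM x) cM; apply. Qed.

Lemma sine_sum_tail_cvg : limn (series M) - series M N @[N --> \oo] --> 0.
Proof.
rewrite -(subrr (limn (series M))); apply: cvgB; [exact: cvg_cst|exact: cM].
Qed.

(** Orthonormality, and an exchange of sum and integral. *)
Lemma sine_sum_coef m : (0 < m)%N -> coef L sine_sum m = a m.
Proof.
move=> m0; have mI := measurable_0L.
pose f i x := a i * (ef i x * ef m x).
have cc i : continuous (fun x => ef i x * ef m x).
  by move=> x; apply: cvgM; exact: eigfun_continuous.
have ie i : mu.-integrable II (EFin \o (fun x => ef i x * ef m x)).
  by apply: integrable_0L; apply: continuous_subspaceT.
have fi i : mu.-integrable II (EFin \o f i) by exact: integrableZR.
have s0 : 0 <= Num.sqrt (2 / L) := sqrtr_ge0 _.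
have fb i x : `|f i x| <= `|a i| * (2 / L).
  rewrite /f (normrM (a i)) (normrM (ef i x)) ler_wpM2l// -[2 / L]sqr_sqrtr ?divr_ge0 ?(ltW L0)// expr2.
  by apply: ler_pM => //; exact: eigfun_le.
have fm i : \int[mu]_(x in II) `|f i x| <= `|a i| * 2.
  have -> : `|a i| * 2 = \int[mu]_(x in II) (`|a i| * (2 / L)).
    by rewrite Rintegral_cst// [X in fine X]lebesgue_0L/= -mulrA divfK ?gt_eqF.
  apply: le_Rintegral => //; first exact: integrable_norm.
  apply/integrableP; split; first exact: measurable_cst.
  by rewrite integral_cst// [X in (_ * X)%E]lebesgue_0L ltry.
have c2 (c : R) : cvgn (series (fun i => `|a i| * c)).
  have -> : series (fun i => `|a i| * c) = (fun n => series (fun n => `|a n|) n * c).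
    by apply/funext => n; rewrite /series/= big_distrl.
  by apply: is_cvgM => //; exact: is_cvg_cst.
have cf (x : R) : II x -> cvgn (series (fun i => `|f i x|)).
  by move=> _; apply: (@series_le_cvg _ _ (fun i => `|a i| * (2 / L))) => // i; rewrite mulr_ge0// divr_ge0// ltW.
have [_ h] := Rseries_integral mI fi fm (c2 2) cf.
have ifi i : \int[mu]_(x in II) f i x = if i == m then a m else 0.
  rewrite RintegralZl//; case: i => [|i].
    rewrite eq_sym gtn_eqF//.
    under eq_Rintegral do rewrite eigfun0 mul0r.
    by rewrite Rintegral_cst// mul0r mulr0.
  by rewrite eigfun_orthonormal//; case: eqP => [->|]; rewrite ?mulr1 ?mulr0.
transitivity (\int[mu]_(x in II) limn (series (f ^~ x))).
  apply: eq_Rintegral => x _; rewrite /sine_sum.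
  have [cs _] := series_tail (aM x) cM.
  apply/esym/cvg_lim => //.
  rewrite (_ : series (f ^~ x) = (fun n => series (fun i => a i * ef i x) n * ef m x)).
    by apply: cvgM => //; exact: cvg_cst.
  by apply/funext => n; rewrite /series/= big_distrl; apply: eq_bigr => i _; rewrite /= /f mulrA.
apply: (cvg_unique _ h); rewrite //=.
apply: cvg_near_cst; near=> n.
rewrite /series/= (eq_bigr (fun i => if i == m then a m else 0)) => [|i _]; last exact: ifi.
rewrite -big_mkcond (big_nat1_eq _ (fun=> a m)) leq0n/= ifT//.
near: n; exact: nbhs_infty_gt.
Unshelve. all: end_near. Qed.

End SineSum.

End Sines.

(** * Square-integrable functions on the interval *)

Section L2facts.
Context {R : realType}.
Variable (L : R).
Hypothesis (L0 : 0 < L).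
Local Notation II := (`]0%R, L[%classic : set (measurableTypeR R)).
Implicit Types f g : R -> R.

Lemma L2_measurable f : L2 L f -> measurable_fun II f.
Proof.
rewrite /L2/= => /sub_Lfun_mfun; rewrite inE => mf.
have := (measurable_restrict f (measurable_0L L) measurableT).2 mf.
by rewrite setTI.
Qed.

Lemma L2_sqr_integrable f : L2 L f -> mu.-integrable II (EFin \o (fun x => f x ^+ 2)).
Proof.
rewrite /L2/= => /Lfun2_integrable_sqr h.
have mI := measurable_0L L.
apply/integrable_mkcond => //; move: h; apply: eq_integrable => // x _.
by rewrite /= !patchE; case: ifP => // _; rewrite expr0n.
Qed.

Lemma integrable_0L_cst (c : R) : mu.-integrable II (EFin \o (fun=> c)).
Proof.
apply: integrable_0L; apply: continuous_subspaceT => x; exact: cvg_cst.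
Qed.

Lemma L2_integrable f : L2 L f -> mu.-integrable II (EFin \o f).
Proof.
move=> hf; have mI := measurable_0L L.
apply: (le_integrableR (g := fun x => 1 + f x ^+ 2)) => //.
- exact: L2_measurable.
- by move=> x _; rewrite ler_norml; apply/andP; split; nra.
- by apply: integrableDR => //; [exact: integrable_0L_cst|exact: L2_sqr_integrable].
Qed.

Lemma integrableM_bounded f (h : R -> R) (M : R) : mu.-integrable II (EFin \o f) -> measurable_fun II h ->
  (forall x, II x -> `|h x| <= M) -> mu.-integrable II (EFin \o (fun x => f x * h x)) /\
  `|\int[mu]_(x in II) (f x * h x)| <= M * \int[mu]_(x in II) `|f x|.
Proof.
move=> fi mh hM; have mI := measurable_0L L.
have mf : measurable_fun II f by case/integrableP : fi => /measurable_EFinP.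
have ia : mu.-integrable II (EFin \o (fun x => `|f x|)) by exact: integrable_norm.
have bd x : II x -> `|f x * h x| <= M * `|f x|.
  by move=> Ix; rewrite normrM mulrC ler_wpM2r// hM.
have ip : mu.-integrable II (EFin \o (fun x => f x * h x)).
  apply: (le_integrableR (g := fun x => M * `|f x|)) => //; last exact: integrableZR.
  exact: measurable_funM.
split=> //; apply: (le_trans (le_normr_Rintegral mI ip)).
rewrite -RintegralZl//; apply: le_Rintegral => //; first exact: integrable_norm.
exact: integrableZR.
Qed.

Lemma L2normE f : L2norm L f = ((\int[mu]_(x in II) (f x ^+ 2)%:E) `^ 2^-1)%E.
Proof.
rewrite /L2norm unlock; congr (_ `^ _)%E.
rewrite [RHS]integral_mkcond; apply: eq_integral => x _.
rewrite /= !patchE; case: ifP => _.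
  by rewrite powR_mulrn// real_normK// num_real.
by rewrite normr0 powR0.
Qed.

Lemma L2norm_lt f (e : R) : 0 < e -> measurable_fun II f -> (L2norm L f < e%:E)%E ->
  (\int[mu]_(x in II) (f x ^+ 2)%:E <= (e ^+ 2)%:E)%E.
Proof.
move=> e0 mf; rewrite L2normE; apply: contraTT; rewrite -ltNge -leNgt => h.
have -> : (e%:E = (e ^+ 2)%:E `^ 2^-1)%E.
  by rewrite poweR_EFin powR12_sqrt ?sqr_ge0// sqrtr_sqr gtr0_norm.
apply: gt0_ler_poweR; rewrite ?invr_ge0 ?(ltW h)//.
- by rewrite in_itv/= lee_fin sqr_ge0 leey.
- by rewrite in_itv/= leey andbT; apply: integral_ge0 => x _; rewrite lee_fin sqr_ge0.
Qed.

(** The inequality of Young |f| <= e + f^2 / e, at the scale e of the norm, does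
    the work of the Cauchy-Schwarz inequality here. *)
Lemma L2norm_L1 f (e : R) : 0 < e -> measurable_fun II f -> (L2norm L f < e%:E)%E ->
  mu.-integrable II (EFin \o f) /\ \int[mu]_(x in II) `|f x| <= e * (L + 1).
Proof.
move=> e0 mf /(L2norm_lt e0 mf) h; have mI := measurable_0L L.
have isq : mu.-integrable II (EFin \o (fun x => f x ^+ 2)).
  apply/integrableP; split; first by apply/measurable_EFinP; exact: measurable_funX.
  apply: (@le_lt_trans _ _ (e ^+ 2)%:E); last exact: ltry.
  apply: le_trans h; apply: ge0_le_integral => //.
  - by apply/measurable_EFinP/measurableT_comp => //; exact: measurable_funX.
  - by apply/measurable_EFinP; exact: measurable_funX.
  - by move=> x _ /=; rewrite lee_fin ger0_norm// sqr_ge0.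
have bd x : `|f x| <= e + e^-1 * f x ^+ 2.
  rewrite -(ler_pM2l e0) mulrDr mulrA divff ?gt_eqF// mul1r -(real_normK (num_real (f x))).
  have := normr_ge0 (f x); move: `|f x| => y y0; nra.
have ig : mu.-integrable II (EFin \o (fun x => e + e^-1 * f x ^+ 2)).
  by apply: integrableDR => //; [exact: integrable_0L_cst|exact: integrableZR].
have fi : mu.-integrable II (EFin \o f) by apply: (le_integrableR mI mf _ ig).
split=> //; apply: (@le_trans _ _ (\int[mu]_(x in II) (e + e^-1 * f x ^+ 2))).
  by apply: le_Rintegral => //; exact: integrable_norm.
rewrite RintegralD//; [|exact: integrable_0L_cst|exact: integrableZR].
rewrite Rintegral_cst// [X in fine X](lebesgue_0L L0)/= RintegralZl// mulrDr mulr1 lerD2l.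
rewrite -(ler_pM2l e0) mulrA divff ?gt_eqF// mul1r -expr2.
by rewrite -lee_fin /Rintegral fineK//; exact: integrable_fin_num.
Qed.

End L2facts.

(** * Cutoffs with compact support in the interval *)

Section Cutoff.
Context {R : realType}.
Variable (L : R).
Hypothesis (L0 : 0 < L).
Local Notation II := (`]0%R, L[%classic : set (measurableTypeR R)).

(** A Taylor estimate at every increment computes a derivative without separating the
    cases that occur in piecewise definitions. *)
Lemma is_derive_quadratic (f : R -> R) (x d C : R) :
  (forall h, `|f (x + h) - f x - d * h| <= C * h ^+ 2) -> is_derive x 1 f d.
Proof.
move=> hf.
have C0 : 0 <= C by have := hf 1; rewrite expr1n !mulr1; exact: le_trans.
have c : (fun h : R => h^-1 *: ((f \o shift x) (h *: (1 : R)) - f x)) @ 0^' --> d.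
  apply/cvgrPdist_le => e e0.
  have C1 : 0 < C + 1 by rewrite ltr_wpDl.
  near=> h.
  have h0 : h != 0 by near: h; exact: nbhs_dnbhs_neq.
  have he : `|h| < e / (C + 1).
    near: h; apply: dnbhs0_lt; exact: divr_gt0.
  rewrite /= /GRing.scale/= mulr1 addrC.
  have hn : 0 < `|h| by rewrite normr_gt0.
  rewrite -(ler_pM2r hn) -normrM.
  have -> : (- (h^-1 * (f (h + x) - f x)) + d) * h = - (f (x + h) - f x - d * h).
    by rewrite (addrC h x); field.
  rewrite normrN (le_trans (hf h))// -real_normK ?num_real// expr2 mulrA ler_wpM2r//.
  move: he; rewrite ltr_pdivlMr// => /ltW; apply: le_trans.
  by rewrite mulrC ler_wpM2l// lerDl.
apply: DeriveDef; first exact: cvgP c.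
exact: cvg_lim c.
Unshelve. all: end_near. Qed.

(** The square of the positive part is C^1, which is all the smoothness that the test
    functions need. *)
Definition sqpos (y : R) : R := Num.max y 0 ^+ 2.

Lemma sqpos_ge0 y : 0 <= sqpos y. Proof. exact: sqr_ge0. Qed.

Lemma sqpos_derive (y : R) : is_derive y 1 sqpos (2 * Num.max y 0).
Proof.
apply: (@is_derive_quadratic _ _ _ 1) => h; rewrite /sqpos mul1r.
have [h1|h1] := leP (y + h) 0; have [h2|h2] := leP y 0;
  rewrite ler_norml; apply/andP; split; nra.
Qed.

Lemma maxr0_continuous : continuous (fun y : R => Num.max y 0).
Proof. by move=> y; apply: continuous_max; [exact: cvg_id|exact: cvg_cst]. Qed.

(** A C^1 step that vanishes on the negative axis and tends to 1 at infinity. *)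
Definition zeta (y : R) : R := 1 - (1 + sqpos y)^-1.
Definition dzeta (y : R) : R := 2 * Num.max y 0 / (1 + sqpos y) ^+ 2.

Let pos y : 0 < 1 + sqpos y.
Proof. by rewrite ltr_pwDl// sqpos_ge0. Qed.

Lemma zeta_derive (y : R) : is_derive y 1 zeta (dzeta y).
Proof.
have h := sqpos_derive y.
have n := lt0r_neq0 (pos y).
have h1 : is_derive y 1 (fun y => 1 + sqpos y) (2 * Num.max y 0).
  by have := is_deriveD (is_derive_cst (1 : R) y 1) h; rewrite add0r.
have h2 := @is_deriveV _ (fun y => 1 + sqpos y) y _ 1 n h1.
have := is_deriveB (is_derive_cst (1 : R) y 1) h2.
by rewrite /dzeta /GRing.scale/= sub0r mulNr opprK mulrC.
Qed.

Lemma dzeta_continuous : continuous dzeta.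
Proof.
move=> y; apply: cvgM; first by apply: cvgMr; exact: maxr0_continuous.
apply: cvgV; first by rewrite expf_neq0// gt_eqF// pos.
have c : {for y, continuous (fun y => 1 + sqpos y)}.
  by apply: cvgD; [exact: cvg_cst|exact: is_derive_continuous (sqpos_derive y)].
by apply: (@continuous_comp _ _ _ (fun y => 1 + sqpos y) (fun y => y ^+ 2)); [exact: c|exact: exprn_continuous].
Qed.

Let p (x : R) := x * (L - x).
(** The cutoff at distance about 1/k from the boundary; x (L - x) is a smooth
    substitute for the distance to the boundary. *)
Definition cutoff (k : nat) (x : R) : R := zeta (k.+1%:R * (x * (L - x)) - 1).
Definition dcutoff (k : nat) (x : R) : R :=
  dzeta (k.+1%:R * (x * (L - x)) - 1) * (k.+1%:R * (L - 2 * x)).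

Lemma cutoff_derive k (x : R) : is_derive x 1 (cutoff k) (dcutoff k x).
Proof.
have dg : is_derive x 1 (fun x : R => k.+1%:R * p x - 1) (k.+1%:R * (L - 2 * x)).
  apply: (@is_derive_quadratic _ _ _ k.+1%:R) => h; rewrite /p.
  have -> : k.+1%:R * ((x + h) * (L - (x + h))) - 1 - (k.+1%:R * (x * (L - x)) - 1) -
     k.+1%:R * (L - 2 * x) * h = - (k.+1%:R * h ^+ 2) by ring.
  by rewrite normrN ger0_norm// mulr_ge0// sqr_ge0.
have := @is_derive1_comp _ zeta (fun x : R => k.+1%:R * p x - 1) x _ _ (zeta_derive _) dg.
by rewrite /dcutoff mulrC.
Qed.

Lemma dcutoff_continuous k : continuous (dcutoff k).
Proof.
have cp (x : R) : {for x, continuous p}.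
  by apply: cvgM; [exact: cvg_id|apply: cvgB; [exact: cvg_cst|exact: cvg_id]].
move=> x; apply: cvgM; last first.
  by apply: cvgMr; apply: cvgB; [exact: cvg_cst|apply: cvgMr; exact: cvg_id].
apply: (@continuous_comp _ _ _ (fun x => k.+1%:R * p x - 1) dzeta); last exact: dzeta_continuous.
by apply: cvgB; [apply: cvgMr; exact: cp|exact: cvg_cst].
Qed.

Lemma mulB_gt0 x : II x -> 0 < x * (L - x).
Proof. by rewrite /= in_itv/= => /andP[? ?]; rewrite mulr_gt0// subr_gt0. Qed.

(** The last bound is the one that matters: the derivative of the cutoff is of size
    k where it does not vanish, but multiplied by x (L - x) it is bounded uniformly in
    k and tends to 0. *)
Lemma cutoff_bounds k x : II x -> [/\ 0 <= cutoff k x, 0 <= 1 - cutoff k x,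
  1 - cutoff k x <= 2 / (x * (L - x)) * k.+1%:R^-1 &
  `|dcutoff k x| * (x * (L - x)) <= 4 * L * (1 - cutoff k x)].
Proof.
rewrite -/(p x).
move=> Ix; have p0 := mulB_gt0 Ix; rewrite /cutoff /dcutoff.
have k0 : 0 < k.+1%:R :> R by [].
set y := k.+1%:R * p x - 1.
have kp : k.+1%:R * p x = y + 1 by rewrite /y subrK.
have y1 : 0 < y + 1 by rewrite -kp mulr_gt0.
have S0 := pos y.
have zE : 1 - zeta y = (1 + sqpos y)^-1 by rewrite /zeta opprB addrC subrK.
split.
- by rewrite /zeta subr_ge0 invf_le1// lerDl sqpos_ge0.
- by rewrite zE invr_ge0 ltW.
- rewrite zE -mulrA -invfM mulrC (mulrC (p x)) kp mulrC.
  rewrite -[leLHS]mul1r ler_pdivrMr// mulrAC ler_pdivlMr// mul1r /sqpos.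
  by have [h|h] := leP y 0; nra.
- rewrite zE normrM ger0_norm; last by rewrite divr_ge0 ?sqr_ge0// mulr_ge0// le_max lexx orbT.
  have xL : `|L - 2 * x| <= L.
    by move: Ix; rewrite /= in_itv/= => /andP[? ?]; rewrite ler_norml; apply/andP; split; lra.
  rewrite normrM ger0_norm// (_ : _ * p x = `|L - 2 * x| * (dzeta y * (y + 1))); last by rewrite -kp; ring.
  rewrite (_ : 4 * L * _ = L * (4 / (1 + sqpos y))); last by ring.
  apply: ler_pM => //.
    by rewrite mulr_ge0 ?(ltW y1)// divr_ge0 ?sqr_ge0// mulr_ge0// le_max lexx orbT.
  rewrite /dzeta mulrAC ler_pdivrMr ?exprn_gt0// expr2 mulrA divfK ?gt_eqF// /sqpos.
  by have [h|h] := leP y 0; nra.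
Qed.

Lemma cutoff_cvg x : II x -> 1 - cutoff k x @[k --> \oo] --> 0.
Proof.
move=> Ix; apply: (@squeeze_cvgr _ _ _ _ (fun=> 0) (fun k => 2 / (x * (L - x)) * k.+1%:R^-1)).
- by apply: nearW => k; have [_ -> -> _] := cutoff_bounds k Ix.
- exact: cvg_cst.
- by rewrite -(mulr0 (2 / (x * (L - x)))); apply: cvgMr; exact: cvg_harmonic.
Qed.

Lemma cutoff_cvg1 x : II x -> cutoff k x @[k --> \oo] --> (1 : R).
Proof.
move=> Ix; rewrite (_ : (fun k => cutoff k x) = (fun k => 1 - (1 - cutoff k x))); last first.
  by apply/funext => k; rewrite opprB addrC subrK.
rewrite -[X in _ --> X]subr0; apply: cvgB; [exact: cvg_cst|exact: cutoff_cvg].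
Qed.

Section Test.
Variables (h h' : R -> R).
Hypotheses (dh : forall x : R, is_derive x 1 h (h' x)) (ch' : continuous h').

Lemma cutoff_test_derive k (x : R) :
  is_derive x 1 (fun x => cutoff k x * h x) (cutoff k x * h' x + dcutoff k x * h x).
Proof.
have := is_deriveM (cutoff_derive k x) (dh x).
by rewrite /GRing.scale/= (mulrC (h x)).
Qed.

Lemma cutoff_test k : C1c L (fun x => cutoff k x * h x).
Proof.
have d1 : (fun x => cutoff k x * h x)^`()%classic = (fun x => cutoff k x * h' x + dcutoff k x * h x).
  by apply/funext => x; rewrite derive1E; have := cutoff_test_derive k x => dd; rewrite derive_val.
split.
- by move=> x; have := cutoff_test_derive k x => dd.
- rewrite d1 => x; apply: cvgD.
    by apply: cvgM; [exact: is_derive_continuous (cutoff_derive k x)|exact: ch'].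
  by apply: cvgM; [exact: dcutoff_continuous|exact: is_derive_continuous (dh x)].
- exists [set x | x \in `[0, L] /\ 1 <= k.+1%:R * p x]; split.
  + apply: (@subclosed_compact _ _ `[0, L]%classic) => //; last by move=> x [].
      apply: closedI; first exact: interval_closed.
      apply: (@closed_comp _ _ (fun x => k.+1%:R * p x) [set y | 1 <= y]).
        move=> x _; apply: cvgMr.
        by apply: cvgM; [exact: cvg_id|apply: cvgB; [exact: cvg_cst|exact: cvg_id]].
      exact: closed_ge.
    exact: segment_compact.
  + move=> x []; rewrite /= !in_itv/= => /andP[h1 h2] h3; apply/andP; split.
      rewrite lt_neqAle h1 andbT; apply/eqP => x0; move: h3.
      by rewrite /p -x0 mul0r mulr0 leNgt ltr01.
    rewrite lt_neqAle h2 andbT; apply/eqP => x0; move: h3.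
    by rewrite /p x0 subrr !mulr0 leNgt ltr01.
  + move=> x xK; rewrite /cutoff /zeta /sqpos; suff h0 : k.+1%:R * p x - 1 <= 0.
      by rewrite max_r// expr0n/= addr0 invr1 subrr mul0r.
    rewrite leNgt; apply/negP => h1; apply: xK; split; last by lra.
    have p0 : 0 < p x.
      by rewrite -(@pmulr_rgt0 _ k.+1%:R)//; lra.
    have [x0|x0] := ltP x 0; first by move: p0; rewrite /p nmulr_rgt0// subr_lt0 => /(lt_trans L0)/ltW; rewrite leNgt x0.
    have [x1|x1] := leP x L; first by rewrite in_itv/= x0.
    by move: p0; rewrite /p ltNge mulr_ge0_le0// subr_le0 ltW.
Qed.

End Test.

End Cutoff.

(** * Integration by parts for weak derivatives *)

Section Elliptic.
Context {R : realType}.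
Variable (L : R).
Hypothesis (L0 : 0 < L).
Local Notation II := (`]0%R, L[%classic : set (measurableTypeR R)).

Lemma bounded_0L (h : R -> R) : continuous h -> exists2 M, 0 <= M & forall x, II x -> `|h x| <= M.
Proof.
move=> ch; have ca : {within `[0, L], continuous (fun x => `|h x|)}.
  by apply: continuous_subspaceT => x; apply: cvg_norm; exact: ch.
have [c _ hc] := EVT_max (ltW L0) ca.
exists `|h c| => // x; rewrite /= in_itv/= => /andP[x1 x2].
by apply: hc; rewrite in_itv/= !ltW.
Qed.

Lemma measurable_0L_cont (h : R -> R) : continuous h -> measurable_fun II h.
Proof. by move=> ch; apply: measurable_funTS; exact: continuous_measurable_fun. Qed.

Lemma integrableM_cont (f h : R -> R) : mu.-integrable II (EFin \o f) -> continuous h ->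
  mu.-integrable II (EFin \o (fun x => f x * h x)).
Proof.
move=> fi ch; have [M _ hM] := bounded_0L ch.
by have [] := integrableM_bounded fi (measurable_0L_cont ch) hM.
Qed.

Lemma C1c_derive psi : C1c L psi -> (forall x : R, is_derive x 1 psi (derive1 psi x)) /\
  continuous psi.
Proof.
move=> [d c _]; have dd (x : R) : is_derive x 1 psi (derive1 psi x).
  by rewrite derive1E; apply: DeriveDef => //; exact: d.
by split=> // x; exact: is_derive_continuous (dd x).
Qed.

Lemma C1c_by_parts psi (h h' : R -> R) : C1c L psi ->
  (forall x : R, is_derive x 1 h (h' x)) -> continuous h' ->
  \int[mu]_(x in II) (psi x * h' x) = - \int[mu]_(x in II) (derive1 psi x * h x).
Proof.
move=> hpsi dh ch'; have [dpsi cpsi] := C1c_derive hpsi.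
have [_ cdpsi [K [_ KI K0]]] := hpsi.
have mI := measurable_0L L.
have ch : continuous h by move=> x; exact: is_derive_continuous (dh x).
have dF (x : R) : is_derive x 1 (fun x => psi x * h x) (psi x * h' x + derive1 psi x * h x).
  have := is_deriveM (dpsi x) (dh x).
  by rewrite /GRing.scale/= (mulrC (h x)).
have z (x : R) : x \notin `]0, L[ -> psi x = 0.
  by move=> xI; apply: K0 => /KI/=; exact/negP.
have c1 : continuous (fun x => psi x * h' x) by move=> x; apply: cvgM; [exact: cpsi|exact: ch'].
have c2 : continuous (fun x => derive1 psi x * h x) by move=> x; apply: cvgM; [exact: cdpsi|exact: ch].
have := Rintegral_0L_FTC L0 dF.
rewrite z ?in_itv/= ?ltxx ?andbF// [psi 0]z ?in_itv/= ?ltxx// !mul0r subr0.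
rewrite RintegralD//; try (apply: integrable_0L; exact: continuous_subspaceT).
move=> H; apply/eqP; rewrite -addr_eq0; apply/eqP; apply: H.
by move=> x; apply: cvgD; [exact: c1|exact: c2].
Qed.

(** For w in H^1_0 no boundary terms appear although h need not vanish at the
    boundary: the identity holds for the approximating test functions and passes to
    the limit in L^2. *)
Lemma H10_by_parts w g (h h' : R -> R) : L2 L w -> L2 L g ->
  (forall e : R, 0 < e -> exists psi, [/\ C1c L psi,
       (L2norm L (fun x => w x - psi x)%R < e%:E)%E &
       (L2norm L (fun x => g x - derive1 psi x)%R < e%:E)%E]) ->
  (forall x : R, is_derive x 1 h (h' x)) -> continuous h' ->
  \int[mu]_(x in II) (w x * h' x) = - \int[mu]_(x in II) (g x * h x).
Proof.
move=> w2 g2 hw dh ch'; have mI := measurable_0L L.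
have ch : continuous h by move=> x; exact: is_derive_continuous (dh x).
have [M M0 hM] := bounded_0L ch; have [M' M'0 hM'] := bounded_0L ch'.
have wi := L2_integrable w2; have gi := L2_integrable g2.
apply/eqP; rewrite -addr_eq0 -normr_le0; apply/ler_addgt0Pl => e e0; rewrite addr0.
pose C := (M + M') * (L + 1) + 1.
have C0 : 0 < C by rewrite ltr_wpDl// mulr_ge0// addr_ge0// ltW.
have eC : 0 < e / C by rewrite divr_gt0.
have [psi [hpsi wpsi gpsi]] := hw _ eC.
have [_ cpsi] := C1c_derive hpsi; have [_ cdpsi _] := hpsi.
have m1 : measurable_fun II (fun x => w x - psi x).
  by apply: measurable_funB; [exact: L2_measurable|exact: measurable_0L_cont].
have m2 : measurable_fun II (fun x => g x - derive1 psi x).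
  by apply: measurable_funB; [exact: L2_measurable|exact: measurable_0L_cont].
have [i1 b1] := L2norm_L1 L0 eC m1 wpsi.
have [i2 b2] := L2norm_L1 L0 eC m2 gpsi.
have [j1 k1] := integrableM_bounded i1 (measurable_0L_cont ch') hM'.
have [j2 k2] := integrableM_bounded i2 (measurable_0L_cont ch) hM.
have pi1 : mu.-integrable II (EFin \o psi) by apply: integrable_0L; exact: continuous_subspaceT.
have pi2 : mu.-integrable II (EFin \o derive1 psi) by apply: integrable_0L; exact: continuous_subspaceT.
have -> : \int[mu]_(x in II) (w x * h' x) + \int[mu]_(x in II) (g x * h x) =
    \int[mu]_(x in II) ((w x - psi x) * h' x) + \int[mu]_(x in II) ((g x - derive1 psi x) * h x).
  under [X in _ = X + _]eq_Rintegral do rewrite mulrBl.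
  under [X in _ = _ + X]eq_Rintegral do rewrite mulrBl.
  rewrite !RintegralB//; try exact: integrableM_cont.
  rewrite (C1c_by_parts hpsi dh ch'); ring.
apply: (le_trans (ler_normD _ _)).
have /= e1 := ler_wpM2l M'0 b1; have /= e2 := ler_wpM2l M0 b2.
have h3 : e = e / C * C by rewrite divfK// gt_eqF.
rewrite [leRHS]h3 /C; move: k1 k2 e1 e2 eC; rewrite /C.
move: (e / _) => z; lra.
Qed.

Lemma mid_0L : II (L / 2).
Proof.
by rewrite /= in_itv/= divr_gt0//= ltr_pdivrMr// ltr_pMr// ltr1n.
Qed.

(** If h vanishes linearly at the boundary, then it can be used as a test function:
    cut it off, and let the cutoff tend to 1.  The term in which the cutoff is
    differentiated is controlled by the bound on h. *)
Lemma weak_deriv_cutoff f g (h h' : R -> R) (C : R) : weak_deriv L f g ->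
  (forall x : R, is_derive x 1 h (h' x)) -> continuous h' ->
  (forall x, II x -> `|h x| <= C * (x * (L - x))) ->
  \int[mu]_(x in II) (f x * h' x) = - \int[mu]_(x in II) (g x * h x).
Proof.
move=> [f2 g2 fg] dh ch' hC; have mI := measurable_0L L.
have ch : continuous h by move=> x; exact: is_derive_continuous (dh x).
have [M M0 hM] := bounded_0L ch; have [M' M'0 hM'] := bounded_0L ch'.
have fi := L2_integrable f2; have gi := L2_integrable g2.
have mf := L2_measurable f2; have mg := L2_measurable g2.
have C0 : 0 <= C.
  have := le_trans (normr_ge0 _) (hC _ mid_0L); rewrite pmulr_lge0//.
  exact: (mulB_gt0 mid_0L).
have cc k : continuous (cutoff L k) by move=> x; exact: is_derive_continuous (cutoff_derive L k x).
have cdc k : continuous (dcutoff L k) by exact: dcutoff_continuous.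
pose F k x := f x * (cutoff L k x * h' x + dcutoff L k x * h x).
pose G k x := g x * (cutoff L k x * h x).
have FG k : \int[mu]_(x in II) F k x = - \int[mu]_(x in II) G k x.
  have := fg _ (cutoff_test L0 dh ch' k).
  rewrite (_ : (fun x => cutoff L k x * h x)^`()%classic = (fun x => cutoff L k x * h' x + dcutoff L k x * h x))//.
  by apply/funext => x; rewrite derive1E; have dd := cutoff_test_derive L dh k x; rewrite derive_val.
have ia : mu.-integrable II (EFin \o (fun x => `|f x|)) by exact: integrable_norm.
have ib : mu.-integrable II (EFin \o (fun x => `|g x|)) by exact: integrable_norm.
have dchb k x : II x -> `|dcutoff L k x * h x| <= 4 * L * C * (1 - cutoff L k x).
  move=> Ix; have [c0 c1 _ c3] := cutoff_bounds k Ix.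
  rewrite normrM (@le_trans _ _ (`|dcutoff L k x| * (C * (x * (L - x)))))//.
    by rewrite ler_wpM2l// hC.
  by rewrite mulrCA (_ : 4 * L * C * _ = C * (4 * L * (1 - cutoff L k x))); [rewrite ler_wpM2l|ring].
have cvc := @cutoff_cvg1 R L.
have [_ l1] : mu.-integrable II (EFin \o (fun x => f x * h' x)) /\
    \int[mu]_(x in II) F k x @[k --> \oo] --> \int[mu]_(x in II) (f x * h' x).
  apply: (@Rdominated_cvg _ _ _ _ (fun x => (M' + 4 * L * C) * `|f x|)) => //.
  - move=> k; apply: measurable_funM => //; apply: measurable_0L_cont => x.
    apply: cvgD; first by apply: cvgM; [exact: cc|exact: ch'].
    by apply: cvgM; [exact: cdc|exact: ch].
  - move=> x Ix; apply: cvgMr; rewrite -[X in _ --> X]addr0; apply: cvgD.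
      by rewrite -[X in _ --> X]mul1r; apply: cvgM; [exact: cvc|exact: cvg_cst].
    apply: norm_cvg0; apply: (@squeeze_cvgr _ _ _ _ (fun=> 0) (fun k => 4 * L * C * (1 - cutoff L k x))).
    + by apply: nearW => k; rewrite normr_ge0 dchb.
    + exact: cvg_cst.
    + by rewrite -(mulr0 (4 * L * C)); apply: cvgMr; exact: cutoff_cvg.
  - move=> k x Ix; rewrite /F normrM mulrC ler_wpM2r// (le_trans (ler_normD _ _))//.
    have [c0 c1 _ _] := cutoff_bounds k Ix.
    apply: lerD.
      by rewrite normrM ger0_norm// (le_trans _ (hM' _ Ix))// ler_piMl//; lra.
    apply: (le_trans (dchb _ _ Ix)); rewrite ler_piMr//; last by lra.
    by rewrite !mulr_ge0// ltW.
  - exact: integrableZR.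
have [_ l2] : mu.-integrable II (EFin \o (fun x => g x * h x)) /\
    \int[mu]_(x in II) G k x @[k --> \oo] --> \int[mu]_(x in II) (g x * h x).
  apply: (@Rdominated_cvg _ _ _ _ (fun x => M * `|g x|)) => //.
  - move=> k; apply: measurable_funM => //; apply: measurable_0L_cont => x.
    by apply: cvgM; [exact: cc|exact: ch].
  - move=> x Ix; apply: cvgMr; rewrite -[X in _ --> X]mul1r.
    by apply: cvgM; [exact: cvc|exact: cvg_cst].
  - move=> k x Ix; rewrite /G normrM mulrC ler_wpM2r// normrM.
    have [c0 c1 _ _] := cutoff_bounds k Ix.
    by rewrite ger0_norm// (le_trans _ (hM _ Ix))// ler_piMl//; lra.
  - exact: integrableZR.
apply: (cvg_unique _ l1); rewrite //=.
rewrite (_ : (fun k => _) = (fun k => - \int[mu]_(x in II) G k x)); last by apply/funext => k; exact: FG.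
exact: cvgN.
Qed.

(** Weak derivatives agree against every C^1 function, by cutting it off.  Only the
    values of the cutoff occur in the limit, so that h need not vanish at the
    boundary. *)
Lemma weak_deriv_unique w g1 g2 (h h' : R -> R) : weak_deriv L w g1 -> weak_deriv L w g2 ->
  (forall x : R, is_derive x 1 h (h' x)) -> continuous h' ->
  \int[mu]_(x in II) (g1 x * h x) = \int[mu]_(x in II) (g2 x * h x).
Proof.
move=> [w2 g12 wg1] [_ g22 wg2] dh ch'; have mI := measurable_0L L.
have ch : continuous h by move=> x; exact: is_derive_continuous (dh x).
have [M M0 hM] := bounded_0L ch.
have cc k : continuous (cutoff L k) by move=> x; exact: is_derive_continuous (cutoff_derive L k x).
have cvc := @cutoff_cvg1 R L.
have lim g : L2 L g -> \int[mu]_(x in II) (g x * (cutoff L k x * h x)) @[k --> \oo] -->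
    \int[mu]_(x in II) (g x * h x).
  move=> g2'; have gi := L2_integrable g2'; have mg := L2_measurable g2'.
  have ib : mu.-integrable II (EFin \o (fun x => `|g x|)) by exact: integrable_norm.
  suff [] : mu.-integrable II (EFin \o (fun x => g x * h x)) /\
      \int[mu]_(x in II) (g x * (cutoff L k x * h x)) @[k --> \oo] --> \int[mu]_(x in II) (g x * h x) by [].
  apply: (@Rdominated_cvg _ _ _ _ (fun x => M * `|g x|)) => //.
  - move=> k; apply: measurable_funM => //; apply: measurable_0L_cont => x.
    by apply: cvgM; [exact: cc|exact: ch].
  - move=> x Ix; apply: cvgMr; rewrite -[X in _ --> X]mul1r.
    by apply: cvgM; [exact: cvc|exact: cvg_cst].
  - move=> k x Ix; rewrite normrM mulrC ler_wpM2r// normrM.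
    have [c0 c1 _ _] := cutoff_bounds k Ix.
    by rewrite ger0_norm// (le_trans _ (hM _ Ix))// ler_piMl//; lra.
  - exact: integrableZR.
apply: (cvg_unique _ (lim _ g12)); rewrite //=.
apply: cvg_trans (lim _ g22); apply: near_eq_cvg; apply: nearW => k.
have ht := cutoff_test L0 dh ch' k.
by apply: oppr_inj; rewrite -wg1// -wg2.
Qed.

End Elliptic.

(** * The sine coefficients of the solution of the elliptic problem *)

Section Eigen.
Context {R : realType}.
Variables (L kappa q : R).
Hypothesis (L0 : 0 < L).
Local Notation II := (`]0%R, L[%classic : set (measurableTypeR R)).
Local Notation ef := (eigfun L).
Local Notation om n := (n%:R * pi / L).

Let dv n x : R := Num.sqrt (2 / L) * (cos (n%:R * pi * x / L) * om n).
Let ddv n x : R := - om n ^+ 2 * ef n x.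

Lemma eigfun_derive2 n (x : R) : is_derive x 1 (dv n) (ddv n x).
Proof.
have h := @derive_scaled _ L cos (fun x => - sin x) (n%:R * pi) x (@is_derive_cos R).
rewrite /dv (_ : (fun x => _) = (Num.sqrt (2 / L) * om n) *: (fun x => cos (n%:R * pi * x / L))); last first.
  apply/funext => z; transitivity (Num.sqrt (2 / L) * om n * cos (n%:R * pi * z / L)) => //.
  by rewrite [LHS]mulrA [LHS]mulrAC.
have := is_deriveZ (Num.sqrt (2 / L) * om n) h.
rewrite (_ : _ *: _ = ddv n x)//.
rewrite /ddv /eigfun /GRing.scale/=; ring.
Qed.

(** |sin| is Lipschitz and the eigenfunction vanishes at both ends; use the end
    that is closer to x. *)
Lemma eigfun_le_dist n x : II x ->
  `|ef n x| <= 2 / L * Num.sqrt (2 / L) * om n * (x * (L - x)).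
Proof.
rewrite /= in_itv/= => /andP[x0 xL].
have s0 : 0 <= Num.sqrt (2 / L) := sqrtr_ge0 _.
have om0 : 0 <= om n by rewrite divr_ge0 ?(ltW L0)// mulr_ge0// pi_ge0.
have tE : n%:R * pi * x / L = om n * x by rewrite mulrAC.
have b1 : `|ef n x| <= Num.sqrt (2 / L) * (om n * x).
  rewrite /eigfun normrM ger0_norm// ler_wpM2l// -[sin _]subr0 -[X in _ - X]sin0.
  by rewrite (le_trans (sin_lip _ _))// subr0 tE ger0_norm// mulr_ge0// ltW.
have b2 : `|ef n x| <= Num.sqrt (2 / L) * (om n * (L - x)).
  have sE : sin (om n * L) = 0 by rewrite divfK ?gt_eqF// sin_natpi.
  rewrite /eigfun normrM ger0_norm// ler_wpM2l// -[sin _]subr0 -[X in _ - X]sE.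
  by rewrite (le_trans (sin_lip _ _))// distrC tE -mulrBr ger0_norm// mulr_ge0// subr_ge0 ltW.
set c := Num.sqrt (2 / L) * om n in b1 b2 *.
rewrite mulrA in b1; rewrite mulrA in b2.
have c0 : 0 <= c by exact: mulr_ge0.
have e : 2 / L * Num.sqrt (2 / L) * om n * (x * (L - x)) = c * (x * (2 * (L - x) / L)).
  by rewrite /c; ring.
have e' : 2 / L * Num.sqrt (2 / L) * om n * (x * (L - x)) = c * ((L - x) * (2 * x / L)).
  by rewrite /c; ring.
have [h|h] := leP x (L / 2).
  rewrite e (le_trans b1)// ler_wpM2l// ler_peMr ?(ltW x0)// ler_pdivlMr// mul1r.
  move: h; rewrite ler_pdivlMr// => h; lra.
rewrite e' (le_trans b2)// ler_wpM2l// ler_peMr ?subr_ge0 ?(ltW xL)// ler_pdivlMr// mul1r.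
by move: h; rewrite ltr_pdivrMr// => h; rewrite mulrC ltW.
Qed.

(** The eigenfunction v satisfies v'' = - om^2 v.  Moving both derivatives from w to v
    uses v as test function for the second one, as v vanishes at the boundary, and
    v' for the first one, where w in H^1_0 takes care of the boundary. *)
Lemma graphA_coef w phi n : L2 L phi -> graphA L kappa q w phi ->
  coef L phi n = eigval L kappa q n * coef L w n.
Proof.
move=> phi2 [[_ [g wg hg]] [w1 [w2 [ww1 w12 ae]]]].
have mI := measurable_0L L.
have [wL2 gL2 _] := wg; have [w1L2 w2L2 _] := w12.
have dv0 (x : R) : is_derive x 1 (ef n) (dv n x) by exact: eigfun_derive.
have cddv : continuous (ddv n) by move=> x; apply: cvgMr; exact: eigfun_continuous.
have cdv : continuous (dv n) by move=> x; exact: is_derive_continuous (eigfun_derive2 n x).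
have e1 := weak_deriv_cutoff L0 w12 dv0 cdv (@eigfun_le_dist n).
have e2 := weak_deriv_unique L0 ww1 wg (eigfun_derive2 n) cddv.
have e3 := H10_by_parts L0 wL2 gL2 hg (eigfun_derive2 n) cddv.
have iM f : L2 L f -> mu.-integrable II (EFin \o (fun x => f x * ef n x)).
  by move=> /L2_integrable fi; apply: integrableM_cont => //; exact: eigfun_continuous.
have e4 : \int[mu]_(x in II) (w2 x * ef n x) = - om n ^+ 2 * coef L w n.
  rewrite /coef -RintegralZl//; last exact: iM.
  rewrite -[LHS]opprK -e1 e2 -e3; apply: eq_Rintegral => x _; rewrite /ddv; ring.
have e5 : coef L phi n = \int[mu]_(x in II) (- kappa * (w2 x * ef n x) + q * (w x * ef n x)).
  rewrite /coef /Rintegral; congr fine; apply: ae_eq_integral => //.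
  - by apply/measurable_EFinP; case/integrableP: (iM _ phi2) => /measurable_EFinP.
  - apply/measurable_EFinP; apply: measurable_funD; apply: measurable_funM => //.
      by case/integrableP: (iM _ w2L2) => /measurable_EFinP.
    by case/integrableP: (iM _ wL2) => /measurable_EFinP.
  - apply: filterS ae => x /= h Ix; congr EFin; rewrite h//; ring.
rewrite e5 RintegralD//; [|by apply: integrableZR => //; exact: iM..].
rewrite !RintegralZl//; try exact: iM.
rewrite e4 /eigval /coef; ring.
Qed.

Lemma invA_coef phi xs : L2 L phi -> invA L kappa q phi xs != 0 ->
  {within `[0, L], continuous (invA L kappa q phi)} /\
  forall n, coef L phi n = eigval L kappa q n * coef L (invA L kappa q phi) n.
Proof.
move=> phi2; rewrite /invA; case: xgetP => [w _ [cw gw] _|_]; last by rewrite eqxx.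
by split=> // n; exact: graphA_coef.
Qed.

End Eigen.

(** * The sum of a sine series in the mean *)

Section Mild.
Context {R : realType}.
Variables (L : R).
Hypothesis (L0 : 0 < L).
Local Notation II := (`]0%R, L[%classic : set (measurableTypeR R)).
Local Notation ef := (eigfun L).

Section L2sum.
Variable a : nat -> R.
Hypothesis ca : cvgn (series (fun n => `|a n|)).

Let P N x := \sum_(1 <= n < N.+1) a n * ef n x.

Let PE N x : P N x = series (fun n => a n * ef n x) N.+1.
Proof. by rewrite /P /series/= [RHS]big_nat_recl// eigfun0 mulr0 add0r big_add1. Qed.

Let P_continuous N : continuous (P N).
Proof.
rewrite /P => x; elim: N.+1 => [|n IH].
  by rewrite (_ : (fun x => _) = (fun=> 0)); [exact: cvg_cst|apply/funext => z; rewrite big_geq].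
have [n0|n0] := leqP 1 n; last first.
  by rewrite (_ : (fun x => _) = (fun=> 0)); [exact: cvg_cst|apply/funext => z; rewrite big_geq].
rewrite (_ : (fun x => _) = (fun x => \sum_(1 <= i < n) a i * ef i x + a n * ef n x)).
  by apply: cvgD; [exact: IH|apply: cvgMr; exact: eigfun_continuous].
by apply/funext => z; rewrite big_nat_recr.
Qed.

Lemma sine_sum_L2 : L2norm L (fun x => sine_sum L a x - P N x) @[N --> \oo] --> 0%E.
Proof.
have mI := measurable_0L L.
pose T N := limn (series (fun n => `|a n| * Num.sqrt (2 / L))) - series (fun n => `|a n| * Num.sqrt (2 / L)) N.
have hT N x : `|sine_sum L a x - P N x| <= T N.+1 by rewrite PE; exact: sine_sum_tail.
have T0 N : 0 <= T N.+1 by apply: le_trans (hT N 0).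
have bd N : (L2norm L (fun x => sine_sum L a x - P N x)%R <= (T N.+1 * Num.sqrt L)%R%:E)%E.
  rewrite L2normE.
  have -> : ((T N.+1 * Num.sqrt L)%R%:E = (T N.+1 ^+ 2 * L)%R%:E `^ 2^-1)%E.
    rewrite poweR_EFin powR12_sqrt ?mulr_ge0 ?sqr_ge0 ?(ltW L0)//.
    by rewrite sqrtrM ?sqr_ge0// sqrtr_sqr ger0_norm.
  have i0 : (0 <= \int[mu]_(x in II) ((sine_sum L a x - P N x) ^+ 2)%R%:E)%E.
    by apply: integral_ge0 => x _; rewrite lee_fin sqr_ge0.
  apply: gt0_ler_poweR; rewrite ?invr_ge0//.
  - by rewrite in_itv/= i0 leey.
  - by rewrite in_itv/= lee_fin mulr_ge0 ?sqr_ge0 ?(ltW L0)// leey.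
  - have -> : ((T N.+1 ^+ 2 * L)%R%:E = \int[mu]_(x in II) (T N.+1 ^+ 2)%R%:E)%E.
      by rewrite integral_cst// [X in (_ * X)%E](lebesgue_0L L0).
    apply: ge0_le_integral => //.
    + by move=> x _; rewrite lee_fin sqr_ge0.
    + apply/measurable_EFinP; apply: measurable_0L_cont => x.
      apply: (@continuous_comp _ _ _ (fun x => sine_sum L a x - P N x) (fun y => y ^+ 2)); last exact: exprn_continuous.
      by apply: cvgB; [exact: sine_sum_continuous|exact: P_continuous].
    + by move=> x _; rewrite lee_fin -real_normK ?num_real// lerXn2r ?nnegrE.
apply: (@squeeze_cvge _ _ _ _ (fun=> 0%E) _ (fun N => (T N.+1 * Num.sqrt L)%R%:E)).
- by apply: nearW => N; rewrite bd L2normE poweR_ge0.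
- exact: cvg_cst.
- apply: cvg_EFin; first exact: nearW.
  rewrite -(mul0r (Num.sqrt L)); apply: cvgM; last exact: cvg_cst.
  rewrite (_ : (fun N => T N.+1) = [sequence T n.+1]_n)// cvg_shiftS.
  exact: sine_sum_tail_cvg.
Qed.

(** Convergence in L^2 determines the sine coefficients, and these determine a
    continuous function. *)
Lemma L2_limit_sine_sum U x : {within `[0, L], continuous U} ->
  L2norm L (fun x => U x - P N x) @[N --> \oo] --> 0%E ->
  0 < x < L -> U x = sine_sum L a x.
Proof.
move=> cU hU xI; have mI := measurable_0L L.
apply: (coef_inj L0 cU _ _ xI).
  by apply: continuous_subspaceT; exact: sine_sum_continuous.
move=> m m0; rewrite sine_sum_coef//.
apply/eqP; rewrite -subr_eq0 -normr_le0; apply/ler_addgt0Pl => e e0; rewrite addr0.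
have s0 : 0 < Num.sqrt (2 / L) by rewrite sqrtr_gt0 divr_gt0.
pose d := e / (Num.sqrt (2 / L) * (L + 1)).
have L1 : 0 < L + 1 by rewrite addr_gt0.
have d0 : 0 < d by rewrite divr_gt0// mulr_gt0.
have Ui := integrable_0L cU.
have mU : measurable_fun II U by case/integrableP : (Ui) => /measurable_EFinP.
have [N mN hN] : exists2 N, (m <= N)%N & (L2norm L (fun x => U x - P N x)%R < d%:E)%E.
  have : \forall N \near \oo, (L2norm L (fun x => (U x - P N x)%R) < d%:E)%E.
    move: hU => /fine_cvgP[hfin hcv].
    apply: filterS2 hfin (cvgr_lt _ hcv _ d0) => N hf.
    by rewrite -lte_fin /= fineK.
  move=> /filterI/(_ (nbhs_infty_ge m))[N _ /(_ N (leqnn N))/= [h1 h2]].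
  by exists N.
have mUP : measurable_fun II (fun x => U x - P N x).
  by apply: measurable_funB => //; exact: measurable_0L_cont.
have [i1 b1] := L2norm_L1 L0 d0 mUP hN.
have [i2 b2] := integrableM_bounded i1 (measurable_0L_cont (@eigfun_continuous _ L m)) (fun x _ => eigfun_le L m x).
have iPn n : mu.-integrable II (EFin \o (fun x => a n * (ef n x * ef m x))).
  apply: integrableZR => //; apply: integrable_0L; apply: continuous_subspaceT => z.
  by apply: cvgM; exact: eigfun_continuous.
have Pm : \int[mu]_(x in II) (P N x * ef m x) = a m.
  have H k : mu.-integrable II (EFin \o (fun x => \sum_(1 <= n < k) a n * (ef n x * ef m x))) /\
     \int[mu]_(x in II) (\sum_(1 <= n < k) a n * (ef n x * ef m x)) = \sum_(1 <= n < k | n == m) a n.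
    elim: k => [|k [IH1 IH2]].
      split; last by rewrite big_geq//; under eq_Rintegral do rewrite big_geq//; rewrite Rintegral_cst// mul0r.
      by under [X in EFin \o X]eq_fun do rewrite big_geq//; exact: integrable0.
    have [k0|k0] := leqP 1 k; last first.
      split; last by rewrite big_geq//; under eq_Rintegral do rewrite big_geq//; rewrite Rintegral_cst// mul0r.
      by under [X in EFin \o X]eq_fun do rewrite big_geq//; exact: integrable0.
    have -> : (fun x => \sum_(1 <= n < k.+1) a n * (ef n x * ef m x)) =
        (fun x => \sum_(1 <= n < k) a n * (ef n x * ef m x) + a k * (ef k x * ef m x)).
      by apply/funext => z; rewrite big_nat_recr.
    split; first exact: integrableDR.
    rewrite RintegralD// IH2 [RHS]big_mkcond/= [RHS]big_nat_recr//= -big_mkcond/=; congr (_ + _).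
    rewrite RintegralZl//; last first.
      apply: integrable_0L; apply: continuous_subspaceT => z.
      by apply: cvgM; exact: eigfun_continuous.
    by rewrite eigfun_orthonormal//; case: eqP => _; rewrite ?mulr1 ?mulr0.
  have -> : \int[mu]_(x in II) (P N x * ef m x) =
      \int[mu]_(x in II) (\sum_(1 <= n < N.+1) a n * (ef n x * ef m x)).
    apply: eq_Rintegral; by move=> z _; rewrite /P big_distrl; apply: eq_bigr => i _; rewrite /= mulrA.
  have [_ ->] := H N.+1.
  by rewrite (big_nat1_eq _ a) m0 ltnS mN.
have -> : coef L U m - a m = \int[mu]_(x in II) ((U x - P N x) * ef m x).
  rewrite -Pm /coef -RintegralB//.
  - by apply: eq_Rintegral => z _; rewrite mulrBl.
  - by apply: integrableM_cont => //; exact: eigfun_continuous.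
  - apply: integrable_0L; apply: continuous_subspaceT => z.
    by apply: cvgM; [exact: P_continuous|exact: eigfun_continuous].
apply: (le_trans b2).
have -> : e = Num.sqrt (2 / L) * (d * (L + 1)) by rewrite /d; field; rewrite !gt_eqF.
by rewrite ler_wpM2l// ltW.
Qed.

End L2sum.
End Mild.

(** * Monotonicity in the order for large times *)

Section Monotone.
Context {R : realType}.

Lemma lim_series_le (u M : R^nat) : (forall i, `|u i| <= M i) -> cvgn (series M) ->
  `|limn (series u)| <= limn (series M).
Proof.
move=> uM cM; have [_ /(_ 0%N)] := series_tail uM cM.
by rewrite /series/= !big_geq// !subr0.
Qed.

Lemma lim_seriesB (u v : R^nat) : cvgn (series u) -> cvgn (series v) ->
  limn (series (fun i => u i - v i)) = limn (series u) - limn (series v).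
Proof.
move=> cu cv; apply/cvg_lim => //.
rewrite (_ : series _ = (fun n => series u n - series v n)); first exact: cvgB.
by apply/funext => n; rewrite /series/= -sumrB.
Qed.

Lemma lim_seriesZ (u : R^nat) k : cvgn (series u) ->
  cvgn (series (fun i => u i * k)) /\ limn (series (fun i => u i * k)) = limn (series u) * k.
Proof.
move=> cu; have c : series (fun i => u i * k) @ \oo --> limn (series u) * k.
  rewrite (_ : series _ = (fun n => series u n * k)); first by apply: cvgM => //; exact: cvg_cst.
  by apply/funext => n; rewrite /series/= big_distrl.
by split; [exact: cvgP c|exact: cvg_lim c].
Qed.

Variables (al0 al1 lmin : R).
Hypotheses (h0 : 0 < al0) (h01 : al0 <= al1) (h1 : al1 < 1) (lmin0 : 0 < lmin).
Variables (lam : nat -> R) (b : nat -> R).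
Hypotheses (b0 : b 0%N = 0) (lamP : forall n, (0 < n)%N -> lmin <= lam n).
Hypothesis (cb : cvgn (series (fun n => `|b n|))).

(** At time t the solution is t^(-a) mode_sum a t, with lam n the eigenvalues and
    b n the values at the observation point of the modes of A^-1 phi. *)
Definition mode_sum (a t : R) : R := limn (series (fun n => b n * ml_profile a (t `^ (- a) / lam n))).

Lemma mode_sum_arg a t n : al0 <= a <= al1 -> 1 <= t -> (0 < n)%N ->
  0 <= t `^ (- a) / lam n <= lmin^-1 /\ t `^ (- a) / lam n <= lmin^-1 * t `^ (- al0).
Proof.
move=> /andP[a0 a1] t1 n0.
have X0 : 0 < lmin^-1 by rewrite invr_gt0.
have ln0 : 0 < lam n by exact: lt_le_trans (lamP n0).
have ta : t `^ (- a) <= t `^ (- al0) by rewrite ler_powR// lerN2.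
have ta1 : t `^ (- al0) <= 1.
  by rewrite powRN invf_le1 ?powR_gt0 ?(lt_le_trans ltr01)// powR_ge1// ltW.
have il : (lam n)^-1 <= lmin^-1 by rewrite lef_pV2 ?posrE// lamP.
have k : t `^ (- a) / lam n <= lmin^-1 * t `^ (- al0).
  by rewrite mulrC; apply: ler_pM; rewrite ?invr_ge0 ?powR_ge0// ltW.
split=> //; rewrite divr_ge0 ?powR_ge0 ?(ltW ln0)//=.
by rewrite (le_trans k)// ler_piMr// ltW.
Qed.

Lemma mode_sum_cvg a t : al0 <= a <= al1 -> 1 <= t ->
  cvgn (series (fun n => b n * ml_profile a (t `^ (- a) / lam n))).
Proof.
move=> ha t1; have X0 : 0 <= lmin^-1 by rewrite invr_ge0 ltW.
have [C C0 hC] := ml_profile_lip h0 h01 h1 X0.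
have [cbC _] := lim_seriesZ C cb.
have [] := @series_tail _ (fun n => b n * ml_profile a (t `^ (- a) / lam n)) _ _ cbC => //.
case=> [|n]; first by rewrite b0 !mul0r normr0 mul0r.
rewrite normrM ler_wpM2l//; have [hx _] := mode_sum_arg ha t1 (ltn0Sn n).
by have [] := hC a a _ _ ha ha hx hx.
Qed.

(** As t tends to infinity, mode_sum a t tends to ml_profile a 0 times the sum of b,
    uniformly in a, so that it is bounded below by a positive constant; and it is
    Lipschitz in a, uniformly in t, because the derivative t^(-a) ln t of the
    argument is bounded.  The logarithmic derivative of the prefactor t^(-a) is
    - ln t, which wins against any Lipschitz constant once t is large. *)
Lemma mode_sum_decreasing : 0 < limn (series b) ->
  exists2 T, 1 < T & forall t x y, T <= t -> al0 <= x <= al1 -> al0 <= y <= al1 -> x < y ->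
    t `^ (- y) * mode_sum y t < t `^ (- x) * mode_sum x t.
Proof.
set W := limn (series b) => W0.
pose X := lmin^-1; have X0 : 0 < X by rewrite invr_gt0.
have [C C0 hC] := ml_profile_lip h0 h01 h1 (ltW X0).
have [m m0 hm] := ml_profile0_ge h0 h01 h1.
pose B := limn (series (fun n => `|b n|)).
have B0 : 0 <= B by apply: limr_ge => //; apply: nearW => n; exact: sumr_ge0.
have cbb : cvgn (series b) by exact: normed_cvg.
pose xi a t n := t `^ (- a) / lam n.
have xiP a t n : al0 <= a <= al1 -> 1 <= t -> (0 < n)%N ->
    0 <= xi a t n <= X /\ xi a t n <= X * t `^ (- al0) by exact: mode_sum_arg.
have cterm a t : al0 <= a <= al1 -> 1 <= t -> cvgn (series (fun n => b n * ml_profile a (xi a t n))).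
  by exact: mode_sum_cvg.
have psi0 a t : al0 <= a <= al1 -> 1 <= t ->
    `|mode_sum a t - W * ml_profile a 0| <= B * (C * (X * t `^ (- al0))).
  move=> ha t1; have [c2 <-] := lim_seriesZ (ml_profile a 0) cbb.
  have [c3 <-] := lim_seriesZ (C * (X * t `^ (- al0))) cb.
  rewrite -(lim_seriesB (cterm a t ha t1) c2).
  apply: (lim_series_le _ c3) => -[|n]; first by rewrite b0 !mul0r subrr normr0 mul0r.
  rewrite -mulrBr normrM ler_wpM2l//; have [hx hx2] := xiP a t n.+1 ha t1 isT.
  have h00 : 0 <= (0 : R) <= X by rewrite lexx ltW.
  have [_] := hC a a _ _ ha ha hx h00; rewrite subrr normr0 add0r subr0 => /le_trans; apply.
  by rewrite ler_wpM2l// ger0_norm//; case/andP: hx.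
pose C2 := B * (C * (1 + 4 / al0 * X)).
have C20 : 0 <= C2.
  rewrite /C2 mulr_ge0// mulr_ge0// addr_ge0// mulr_ge0 ?(ltW X0)//.
  by rewrite divr_ge0// ltW.
have psi_lip x y t : al0 <= x <= al1 -> al0 <= y <= al1 -> 1 <= t ->
    `|mode_sum x t - mode_sum y t| <= C2 * `|x - y|.
  move=> hx hy t1; have t0 := lt_le_trans ltr01 t1.
  have tg : `|t `^ (- x) - t `^ (- y)| <= 4 / al0 * `|x - y|.
    apply: (le_trans (powR_lip_exp _ _ t0)).
    rewrite (_ : - x - - y = - (x - y)); last by rewrite opprB opprK addrC.
    rewrite normrN mulrC ler_wpM2r//.
    have /andP[x0 _] := hx; have /andP[y0 _] := hy.
    have tx : t `^ (- x) <= t `^ (- al0) by rewrite ler_powR// lerN2.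
    have ty : t `^ (- y) <= t `^ (- al0) by rewrite ler_powR// lerN2.
    have l := ln_le_powR t0 h0.
    have p1 : 1 <= t `^ al0 by rewrite powR_ge1// ltW.
    have p2 : t `^ (- al0) * t `^ al0 = 1 by rewrite powRN mulVf// gt_eqF// powR_gt0.
    have p3 : 0 <= t `^ (- al0) by exact: powR_ge0.
    apply: (@le_trans _ _ ((2 * t `^ al0 / al0) * (2 * t `^ (- al0)))).
      apply: ler_pM => //; first by rewrite addr_ge0 ?powR_ge0.
        by apply: (le_trans l); rewrite ler_pM2r ?invr_gt0//; nra.
      lra.
    by rewrite [leLHS](_ : _ = 4 / al0 * (t `^ (- al0) * t `^ al0)); [rewrite p2 mulr1|ring].
  rewrite -(lim_seriesB (cterm x t hx t1) (cterm y t hy t1)).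
  have -> : C2 * `|x - y| = B * (C * (`|x - y| + 4 / al0 * `|x - y| * X)).
    by rewrite /C2; ring.
  have [c3 <-] := lim_seriesZ (C * (`|x - y| + 4 / al0 * `|x - y| * X)) cb.
  apply: (lim_series_le _ c3) => -[|n]; first by rewrite b0 !mul0r subrr normr0 mul0r.
  rewrite -mulrBr normrM ler_wpM2l//.
  have [kx _] := xiP x t n.+1 hx t1 isT; have [ky _] := xiP y t n.+1 hy t1 isT.
  have [_ /le_trans] := hC x y _ _ hx hy kx ky; apply.
  rewrite ler_wpM2l// lerD2l /xi -mulrBl normrM.
  have ln0 : 0 < lam n.+1 by exact: lt_le_trans (lamP _).
  apply: ler_pM => //; rewrite gtr0_norm ?invr_gt0//.
  by rewrite lef_pV2 ?posrE// lamP.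
(* The last two terms of K are what the Lipschitz constant C2 and the distance
   of mode_sum to its limit require of ln t. *)
pose K := 1 + 2 * C2 / (W * m) + 2 * (B * (C * X)) / (al0 * (W * m)).
have Wm : 0 < W * m by rewrite mulr_gt0.
have z1 : 0 <= 2 * C2 / (W * m) by rewrite divr_ge0 ?(ltW Wm)// mulr_ge0.
have BCX : 0 <= B * (C * X) by rewrite mulr_ge0// mulr_ge0// ltW.
have z2 : 0 <= 2 * (B * (C * X)) / (al0 * (W * m)).
  by rewrite divr_ge0 ?(mulr_ge0 _ BCX)// mulr_ge0 ?(ltW h0) ?(ltW Wm).
have K1 : 1 <= K by rewrite /K -addrA lerDl addr_ge0.
have K0 : 0 < K by exact: lt_le_trans K1.
exists (expR K); first by rewrite expR_gt1.
move=> t x y Tt hx hy xy.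
have t1 : 1 <= t by rewrite (le_trans _ Tt)// ltW// expR_gt1.
have t0 := lt_le_trans ltr01 t1.
have lnK : K <= ln t by rewrite -[K]expRK ler_ln// posrE// expR_gt0.
have P2 : C2 < ln t * (W * m / 2).
  have : 2 * C2 / (W * m) < K by rewrite /K; lra.
  rewrite ltr_pdivrMr// => h; have := ler_wpM2r (ltW Wm) lnK; lra.
have P1 : W * m / 2 <= mode_sum x t.
  have := psi0 x t hx t1; rewrite ler_norml => /andP[+ _].
  have mx := ler_wpM2l (ltW W0) (hm x hx).
  suff : B * (C * (X * t `^ (- al0))) <= W * m / 2 by move: mx; lra.
  have e1 : t `^ (- al0) <= (al0 * K)^-1.
    rewrite powRN lef_pV2 ?posrE ?powR_gt0 ?mulr_gt0//.
    rewrite /powR gt_eqF// (le_trans _ (expR_ge1Dx _))//.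
    by have := ler_wpM2l (ltW h0) lnK; lra.
  have -> : B * (C * (X * t `^ (- al0))) = B * (C * X) * t `^ (- al0) by ring.
  apply: (le_trans (ler_wpM2l BCX e1)); rewrite ler_pdivrMr ?mulr_gt0//.
  have : 2 * (B * (C * X)) / (al0 * (W * m)) <= K by rewrite /K; lra.
  by rewrite ler_pdivrMr ?mulr_gt0//; lra.
have d0 : 0 < y - x by rewrite subr_gt0.
have P3 : (y - x) * ln t <= t `^ (y - x) - 1.
  by rewrite lerBrDl /powR gt_eqF// expR_ge1Dx.
have -> : t `^ (- x) = t `^ (- y) * t `^ (y - x).
  by rewrite -powRD ?(gt_eqF t0) ?implybT//; congr powR; ring.
rewrite -mulrA ltr_pM2l ?powR_gt0//.
have L := psi_lip x y t hx hy t1.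
rewrite distrC (distrC x) (gtr0_norm d0) in L.
have := le_trans (ler_norm _) L.
have lt0 : 0 <= ln t by exact: le_trans (ltW K0) lnK.
have Wm2 : 0 < W * m / 2 by rewrite divr_gt0.
have Q : (y - x) * (ln t * (W * m / 2)) <= (t `^ (y - x) - 1) * mode_sum x t.
  rewrite mulrA; apply: ler_pM => //; [by rewrite mulr_ge0// ltW|exact: ltW].
have Q2 : C2 * (y - x) < (y - x) * (ln t * (W * m / 2)) by rewrite mulrC ltr_pM2l.
move: Q Q2; move: (mode_sum x t) (mode_sum y t) (t `^ (y - x)) (C2 * _) (_ * (ln t * _)) => p r z u v; lra.
Qed.

End Monotone.

Lemma mode_sum_increasing {R : realType} (al0 al1 lmin : R) (lam b : nat -> R) :
  0 < al0 -> al0 <= al1 -> al1 < 1 -> 0 < lmin -> b 0%N = 0 ->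
  (forall n, (0 < n)%N -> lmin <= lam n) -> cvgn (series (fun n => `|b n|)) ->
  limn (series b) < 0 ->
  exists2 T, 1 < T & forall t x y, T <= t -> al0 <= x <= al1 -> al0 <= y <= al1 -> x < y ->
    t `^ (- x) * mode_sum lam b x t < t `^ (- y) * mode_sum lam b y t.
Proof.
move=> h0 h01 h1 lmin0 b0 lamP cb W0.
have b0' : b 0%N * -1 = 0 by rewrite b0 mul0r.
have cb' : cvgn (series (fun n => `|b n * -1|)).
  by under eq_fun do rewrite mulrN1 normrN.
have W0' : 0 < limn (series (fun n => b n * -1)).
  by have [_ ->] := lim_seriesZ (-1) (normed_cvg cb); rewrite mulrN1 oppr_gt0.
have [T T1 hT] := mode_sum_decreasing h0 h01 h1 lmin0 b0' lamP cb' W0'.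
exists T; first exact: T1.
move=> t x y Tt hx hy xy.
have t1 : 1 <= t by exact: le_trans (ltW T1) Tt.
have e a : al0 <= a <= al1 -> mode_sum lam (fun n => b n * -1) a t = - mode_sum lam b a t.
  move=> ha; have [_ h] := lim_seriesZ (-1) (mode_sum_cvg h0 h01 h1 lmin0 b0 lamP cb ha t1).
  transitivity (mode_sum lam b a t * -1); last by rewrite mulrN1.
  rewrite /mode_sum -h; congr (limn (series _)).
  by apply/funext => n; rewrite mulrAC.
by have := hT t x y Tt hx hy xy; rewrite (e x hx) (e y hy) !mulrN ltrN2.
Qed.

(** * The mild solution at the observation point *)

Section MildValue.
Context {R : realType}.
Variables (L kappa q : R).
Hypotheses (L0 : 0 < L) (kappa0 : 0 < kappa) (q0 : 0 <= q).
Local Notation II := (`]0%R, L[%classic : set (measurableTypeR R)).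
Local Notation ef := (eigfun L).
Local Notation lam := (eigval L kappa q).

Let lmin : R := kappa * (pi / L) ^+ 2.

Lemma eigval_lb_gt0 : 0 < lmin.
Proof. by rewrite mulr_gt0// exprn_gt0// divr_gt0// pi_gt0. Qed.

Lemma eigval_ge n : lmin * n%:R ^+ 2 <= lam n.
Proof.
rewrite /eigval /lmin -mulrA -exprMn (_ : pi / L * n%:R = n%:R * pi / L); last by ring.
by rewrite lerDl.
Qed.

Lemma eigval_ge_lmin n : (0 < n)%N -> lmin <= lam n.
Proof.
move=> n0; apply: le_trans (eigval_ge n); rewrite ler_peMr ?(ltW eigval_lb_gt0)//.
by rewrite exprn_ege1// ler1n.
Qed.

Lemma eigval_gt0 n : (0 < n)%N -> 0 < lam n.
Proof. by move=> n0; apply: lt_le_trans (eigval_ge_lmin n0); exact: eigval_lb_gt0. Qed.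

(** Comparison with a telescoping series; the constant 6 is the ratio
    (n+1) (n+2) / n^2 at n = 1.  The term of index 0 vanishes, as 1 / 0 = 0. *)
Lemma cvg_series_inv_sqr (K : R) : 0 <= K -> cvgn (series (fun n : nat => K / n%:R ^+ 2)).
Proof.
move=> K0.
pose v n : R := 6 * K * (n.+1%:R^-1 - n.+2%:R^-1).
apply: (@series_le_cvg _ _ v) => [n|n|n|].
- by rewrite divr_ge0// sqr_ge0.
- by rewrite mulr_ge0 ?mulr_ge0// subr_ge0 lef_pV2 ?posrE// ler_nat.
- rewrite /v; case: n => [|n].
    by rewrite expr0n/= invr0 mulr0 mulr_ge0 ?mulr_ge0// subr_ge0 lef_pV2 ?posrE// ler_nat.
  rewrite -[n.+3%:R]natr1 -[n.+2%:R]natr1.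
  have : 1 <= n.+1%:R :> R by rewrite ler1n.
  move: n.+1%:R => x x1; have x0 : 0 < x by exact: lt_le_trans x1.
  have -> : 6 * K * ((x + 1)^-1 - (x + 1 + 1)^-1) = K * (6 / ((x + 1) * (x + 1 + 1))).
    by field; rewrite !gt_eqF// ?addr_gt0.
  rewrite ler_wpM2l// ler_pdivlMr ?mulr_gt0 ?addr_gt0// mulrC ler_pdivrMr ?exprn_gt0//.
  nra.
- apply: nondecreasing_is_cvgn.
    apply: nondecreasing_series => n _ _.
    by rewrite mulr_ge0 ?mulr_ge0// subr_ge0 lef_pV2 ?posrE// ler_nat.
  exists (6 * K) => _ [n _ <-]; rewrite /series/= -big_distrr/=.
  rewrite (_ : \sum_(0 <= i < n) _ = 1 - n.+1%:R^-1).
    by rewrite ler_piMr ?mulr_ge0// gerBl.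
  elim: n => [|n IH]; first by rewrite big_geq// invr1 subrr.
  by rewrite big_nat_recr//= IH addrA subrK.
Qed.

Lemma cvg_series_div_eigval (c : nat -> R) (M : R) : (forall n, `|c n| <= M) -> c 0%N = 0 ->
  cvgn (series (fun n => `|c n / lam n|)).
Proof.
move=> cM c0.
have M0 : 0 <= M by exact: le_trans (cM 0%N).
have l0 := eigval_lb_gt0.
have K0 : 0 <= M / lmin by rewrite divr_ge0// ltW.
apply: (series_le_cvg _ _ _ (cvg_series_inv_sqr K0)) => // [n|[|n]].
- by rewrite divr_ge0// sqr_ge0.
- by rewrite c0 mul0r normr0 divr_ge0// sqr_ge0.
- have ln := eigval_gt0 (ltn0Sn n); have sqabsB : 0 < n.+1%:R ^+ 2 :> R by rewrite exprn_gt0.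
  rewrite normrM (gtr0_norm (x := _^-1)) ?invr_gt0// -mulrA -invfM.
  apply: ler_pM; rewrite ?invr_ge0 ?(ltW ln)//.
  have d0 : 0 < lmin * n.+1%:R ^+ 2 by exact: mulr_gt0.
  by rewrite lef_pV2 ?posrE//; exact: eigval_ge.
Qed.

Lemma coef0 f : coef L f 0 = 0.
Proof.
rewrite /coef; under eq_Rintegral do rewrite eigfun0 mulr0.
by rewrite Rintegral_cst ?mul0r//; exact: measurable_0L.
Qed.

Lemma coef_le f n : mu.-integrable II (EFin \o f) ->
  `|coef L f n| <= Num.sqrt (2 / L) * \int[mu]_(x in II) `|f x|.
Proof.
move=> fi; rewrite /coef.
have me : measurable_fun II (ef n).
  by apply: measurable_0L_cont; exact: eigfun_continuous.
by have [_] := integrableM_bounded fi me (fun x _ => eigfun_le L n x).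
Qed.

Variables (phi : R -> R) (xs : R).
Hypotheses (hphi : L2 L phi) (hxs : 0 < xs < L).

Let b n := coef L phi n / lam n * ef n xs.

Lemma coef_div_eigval_summable : cvgn (series (fun n => `|coef L phi n / lam n|)).
Proof.
have phii := L2_integrable hphi.
by apply: cvg_series_div_eigval (coef0 phi) => n; exact: coef_le.
Qed.

Lemma mode_summable : cvgn (series (fun n => `|b n|)).
Proof.
have [c _] := lim_seriesZ (Num.sqrt (2 / L)) coef_div_eigval_summable.
apply: series_le_cvg c => [n|n|n]; [exact: normr_ge0|exact: mulr_ge0 (normr_ge0 _) (sqrtr_ge0 _)|].
by rewrite /b normrM ler_wpM2l// eigfun_le.
Qed.

(** The modes of A^-1 phi are those of phi divided by the eigenvalues, so that the
    sum of their values at xs is the leading coefficient for large times. *)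
Lemma invA_series : invA L kappa q phi xs != 0 -> limn (series b) = invA L kappa q phi xs.
Proof.
move=> hA; have [cw hw] := invA_coef L0 hphi hA.
set w := invA L kappa q phi in cw hw *.
pose a n := coef L phi n / lam n.
have aE n : (0 < n)%N -> a n = coef L w n.
  by move=> n0; rewrite /a hw mulrAC divff ?mul1r// gt_eqF// eigval_gt0.
have ca := coef_div_eigval_summable.
rewrite (@coef_inj _ L L0 w (sine_sum L a) cw _ _ xs hxs)//.
  by apply: continuous_subspaceT; exact: sine_sum_continuous.
by move=> n n0; rewrite sine_sum_coef// aE.
Qed.

(** By the representation of the Mittag-Leffler function, its values are at most
    C t^(-alpha) / lam n, so that the series converges absolutely and uniformly; its
    sum is then the continuous representative. *)
Lemma mild_solution_value (alpha t : R) : 0 < alpha -> alpha < 1 -> 0 < t ->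
  mild_solution L kappa q phi alpha t xs = t `^ (- alpha) * mode_sum lam b alpha t.
Proof.
move=> a0 a1 t0.
pose A n := coef L phi n * mittag_leffler alpha 1 (- lam n * t `^ alpha).
have ta : 0 < t `^ alpha by rewrite powR_gt0.
have X0 : 0 <= t `^ (- alpha) / lmin by rewrite divr_ge0 ?powR_ge0// ltW// eigval_lb_gt0.
have [C C0 hC] := ml_profile_lip a0 (lexx alpha) a1 X0.
have AE n : (0 < n)%N -> A n = coef L phi n / lam n * (t `^ (- alpha) * ml_profile alpha (t `^ (- alpha) / lam n)).
  move=> n0; have ln := eigval_gt0 n0.
  rewrite /A mulNr ml_representation ?mulr_gt0// invfM powRN (mulrC (lam n)^-1).
  by ring.
have ca : cvgn (series (fun n => `|A n|)).
  have [c _] := lim_seriesZ (t `^ (- alpha) * C) coef_div_eigval_summable.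
  apply: series_le_cvg c => [n|n|[|n]].
  - exact: normr_ge0.
  - exact: mulr_ge0 (normr_ge0 _) (mulr_ge0 (powR_ge0 _ _) C0).
  - by rewrite /A coef0 !mul0r normr0 mul0r.
  - have ln := eigval_gt0 (ltn0Sn n).
    rewrite AE// normrM ler_wpM2l// normrM ger0_norm ?powR_ge0// ler_wpM2l ?powR_ge0//.
    have haa : alpha <= alpha <= alpha by rewrite lexx.
    have hx : 0 <= t `^ (- alpha) / lam n.+1 <= t `^ (- alpha) / lmin.
      rewrite divr_ge0 ?powR_ge0 ?(ltW ln)//= ler_wpM2l ?powR_ge0// lef_pV2 ?posrE ?eigval_lb_gt0//.
      exact: eigval_ge_lmin.
    by have [] := hC alpha alpha _ _ haa haa hx hx.
have -> : mild_solution L kappa q phi alpha t xs = sine_sum L A xs.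
  rewrite /mild_solution; case: xgetP => [U _ [cU hU]|].
    exact: (L2_limit_sine_sum L0 ca cU hU hxs).
  move=> /(_ (sine_sum L A)); case; split; last exact: (sine_sum_L2 L0 ca).
  by apply: continuous_subspaceT; exact: sine_sum_continuous.
have cs : cvgn (series (fun n => A n * ef n xs)).
  have [c _] := lim_seriesZ (Num.sqrt (2 / L)) ca.
  have [] := @series_tail _ (fun n => A n * ef n xs) _ _ c => // n.
  by rewrite normrM ler_wpM2l// eigfun_le.
have [_ e] := lim_seriesZ (t `^ alpha) cs.
rewrite /mode_sum (_ : (fun n => _) = (fun n => A n * ef n xs * t `^ alpha)).
  by rewrite e powRN mulrC mulfK ?gt_eqF.
apply/funext => -[|n]; first by rewrite /b eigfun0 !mulr0 !mul0r.
rewrite AE// /b powRN; field.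
by rewrite !gt_eqF// eigval_gt0.
Qed.

End MildValue.

Theorem theorem7p1 (R : realType) (L kappa q : R)
  (hL : 0 < L) (hkappa : 0 < kappa) (hq : 0 <= q)
  (alpha0 alpha1 : R) (h0 : 0 < alpha0) (h01 : alpha0 <= alpha1)
  (h1 : alpha1 < 1)
  (phi : R -> R) (hphi : L2 L phi)
  (xs : R) (hxs : xs \in `]0, L[)
  (hA : invA L kappa q phi xs != 0) :
  let u := fun alpha t => mild_solution L kappa q phi alpha t xs in
  [/\ exists TI : R, 1 < TI /\
        forall t0 d0 : R, TI <= t0 ->
          {in `[alpha0, alpha1] &, forall a b,
             u a t0 = d0 -> u b t0 = d0 -> a = b},
      0 < invA L kappa q phi xs ->
        \forall t0 \near +oo,
          {in `[alpha0, alpha1] &, {homo (fun a => u a t0) : a b /~ a < b}}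
    & invA L kappa q phi xs < 0 ->
        \forall t0 \near +oo,
          {in `[alpha0, alpha1] &, {homo (fun a => u a t0) : a b / a < b}}].
Proof.
move=> u.
have xI : 0 < xs < L by move: hxs; rewrite in_itv.
pose lam := eigval L kappa q.
pose b n := coef L phi n / lam n * eigfun L n xs.
have lmin0 := eigval_lb_gt0 hL hkappa.
have lamP n : (0 < n)%N -> kappa * (pi / L) ^+ 2 <= lam n by exact: eigval_ge_lmin.
have b0 : b 0%N = 0 by rewrite /b eigfun0 mulr0.
have cb : cvgn (series (fun n => `|b n|)) := @mode_summable _ _ _ _ hL hkappa hq _ xs hphi.
have W : limn (series b) = invA L kappa q phi xs := invA_series hL hkappa hq hphi xI hA.
have uE a t : alpha0 <= a <= alpha1 -> 1 <= t -> u a t = t `^ (- a) * mode_sum lam b a t.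
  move=> /andP[a0 a1] t1; apply: mild_solution_value => //.
  - exact: lt_le_trans h0 a0.
  - exact: le_lt_trans a1 h1.
  - exact: lt_le_trans ltr01 t1.
have dec : 0 < invA L kappa q phi xs -> exists2 T, 1 < T & forall t x y, T <= t ->
    x \in `[alpha0, alpha1] -> y \in `[alpha0, alpha1] -> x < y -> u y t < u x t.
  rewrite -W => W0; have [T T1 hT] := mode_sum_decreasing h0 h01 h1 lmin0 b0 lamP cb W0.
  exists T; first exact: T1.
  move=> t x y Tt hx hy xy; rewrite !in_itv/= in hx hy.
  have t1 := le_trans (ltW T1) Tt.
  rewrite (uE x t hx t1) (uE y t hy t1); exact: hT.
have inc : invA L kappa q phi xs < 0 -> exists2 T, 1 < T & forall t x y, T <= t ->
    x \in `[alpha0, alpha1] -> y \in `[alpha0, alpha1] -> x < y -> u x t < u y t.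
  rewrite -W => W0; have [T T1 hT] := mode_sum_increasing h0 h01 h1 lmin0 b0 lamP cb W0.
  exists T; first exact: T1.
  move=> t x y Tt hx hy xy; rewrite !in_itv/= in hx hy.
  have t1 := le_trans (ltW T1) Tt.
  rewrite (uE x t hx t1) (uE y t hy t1); exact: hT.
split.
- move: hA; rewrite neq_lt => /orP[/inc|/dec] [T T1 hT]; exists T; (split; first exact: T1) => t d Tt x y hx hy ux uy.
  + by have [xy|xy|//] := ltgtP x y; [have := hT t x y Tt hx hy xy|have := hT t y x Tt hy hx xy]; rewrite ux uy ltxx.
  + by have [xy|xy|//] := ltgtP x y; [have := hT t x y Tt hx hy xy|have := hT t y x Tt hy hx xy]; rewrite ux uy ltxx.
- move=> /dec[T T1 hT]; near=> t.
  have Tt : T <= t by near: t; apply: nbhs_pinfty_ge; exact: num_real.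
  move=> x y hx hy xy; exact: (hT t y x Tt hy hx xy).
- move=> /inc[T T1 hT]; near=> t.
  have Tt : T <= t by near: t; apply: nbhs_pinfty_ge; exact: num_real.
  move=> x y hx hy xy; exact: (hT t x y Tt hx hy xy).
Unshelve. all: end_near. Qed.
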